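(* Let $\mathfrak g=\mathfrak q(n)$ over $K$, let $\chi\in\mathfrak g_{\bar 0}^*$ be nilpotent, and let $\mathfrak m$, $K_\chi$, $\mathcal Q_{\mathfrak m}=U_\chi(\mathfrak g)\otimes_{U_\chi(\mathfrak m)}K_\chi$, $W_\chi(\mathfrak g)=\mathrm{End}_{U_\chi(\mathfrak g)}(\mathcal Q_{\mathfrak m})$ and $\delta=\dim U_\chi(\mathfrak m)$ be as defined in the context. Then: (1) The $U_\chi(\mathfrak g)$-module $\mathcal Q_{\mathfrak m}$ is projective. (2) There is an isomorphism of superalgebras $U_\chi(\mathfrak g)\cong M_\delta\big(W_\chi(\mathfrak g)^{\mathrm{op}}\big)$, where $M_\delta(W_\chi(\mathfrak g)^{\mathrm{op}})$ denotes the matrix algebra of size $\delta$ with entries in $W_\chi(\mathfrak g)^{\mathrm{op}}$.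
   Context: $K$ is an algebraically closed field of characteristic $p>2$. $\mathfrak g=\mathfrak q(n)=\mathfrak g_{\bar 0}\oplus\mathfrak g_{\bar 1}$ is the Lie superalgebra of matrices $\begin{pmatrix} A & B \\ B & A \end{pmatrix}$, $A,B\in M_n(K)$, in $\mathfrak{gl}(n|n)$; even elements have $B=0$, odd ones have $A=0$. The $p$-th power map $x\mapsto x^{[p]}$ on $\mathfrak g_{\bar 0}\cong\mathfrak{gl}(n)$ is the matrix $p$-th power. For a subalgebra $\mathfrak a$ with $\mathfrak a_{\bar 0}$ closed under $[p]$, $U_\chi(\mathfrak a)$ is the quotient of $U(\mathfrak a)$ by the ideal generated by $x^p-x^{[p]}-\chi(x)^p$, $x\in\mathfrak a_{\bar 0}$. The odd non-degenerate form $(x,y)=\mathrm{otr}(xy)$, $\mathrm{otr}\begin{pmatrix} A & B \\ B & A \end{pmatrix}=\mathrm{trace}(B)$, identifies $\mathfrak g_{\bar 0}^*$ with $\mathfrak g_{\bar 1}\cong\mathfrak{gl}(n)$ by $\chi=(X,-)$; $\chi$ is nilpotent if the matrix of $X$ is nilpotent. Regard $\chi\in\mathfrak g^*$ via $\chi(\mathfrak g_{\bar 1})=0$. Grading: up to $GL(n)$-conjugation, $X$ has as its matrix an upper triangular nilpotent Jordan form with blocks of sizes $d_1\ge\dots\ge d_r$. Let $H$ be the diagonal integer matrix which on the $i$-th block has entries $d_i-1,d_i-3,\dots,-(d_i-1)$, and grade $\mathfrak{gl}(n)=\bigoplus_{k\in\mathbb Z}\mathfrak{gl}(n)(k)$ by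 giving the matrix unit $E_{kl}$ degree $H_{kk}-H_{ll}$. This gives $\mathfrak g=\bigoplus_k\mathfrak g(k)$, with $\mathfrak g(k)$ consisting of the matrices with $A,B\in\mathfrak{gl}(n)(k)$; then $X\in\mathfrak g(2)$. On $\mathfrak g(-1)$ the form $\langle x,y\rangle=\chi([x,y])$ is even and non-degenerate, symplectic on $\mathfrak g(-1)_{\bar 0}$ and symmetric on $\mathfrak g(-1)_{\bar 1}$, both spaces being even-dimensional. Let $\mathfrak g(-1)'_i\subset\mathfrak g(-1)_i$ ($i\in\mathbb Z_2$) be maximal isotropic subspaces, $\mathfrak g(-1)'=\mathfrak g(-1)'_{\bar 0}\oplus\mathfrak g(-1)'_{\bar 1}$, and $\mathfrak m=\bigoplus_{k\ge2}\mathfrak g(-k)\oplus\mathfrak g(-1)'$, a $p$-nilpotent subalgebra. $U_\chi(\mathfrak m)$ has a unique simple module, which is one-dimensional and denoted $K_\chi$. One has $\delta=\dim U_\chi(\mathfrak m)=p^d2^d$, where $2d=\dim\mathfrak g_{\bar 0}-\dim\mathfrak g_{\chi,\bar 0}=\dim\mathfrak g_{\bar 1}-\dim\mathfrak g_{\chi,\bar 1}$ and $\mathfrak g_\chi=\{y\in\mathfrak g:\chi([y,\mathfrak g])=0\}$ is the centralizer of $\chi$. Modules are $\mathbb Z_2$-graded; $\mathrm{End}$ includes odd endomorphisms, so $W_\chi(\mathfrak g)$ is a $K$-superalgebra, and $W_\chi(\mathfrak g)^{\mathrm{op}}$ is its opposite. *)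

(* Defs.v *)
From HB Require Import structures.
From mathcomp Require Import all_boot all_order all_algebra.
From mathcomp Require Import boolp finmap monalg.

Set Implicit Arguments.
Unset Strict Implicit.
Unset Printing Implicit Defensive.

Import GRing.Theory Quotient.
Local Open Scope ring_scope.
Local Open Scope quotient_scope.

(* MathComp's lalgType/algType require 1 != 0, which is not available for an
   algebra given by generators and relations before a PBW theorem is proved.
   Hence K-algebras are rings with a central ring morphism from K. *)
HB.mixin Record isPzAlg (K : fieldType) A of GRing.PzRing A := {
  algC : K -> A;
  algCB : zmod_morphism algC;
  algCM : monoid_morphism algC;
  algC_comm : forall c (x : A), algC c * x = x * algC c }.
#[short(type="pzAlgType")]
HB.structure Definition PzAlg (K : fieldType) := {A of GRing.PzRing A & isPzAlg K A}.

Arguments algC {K A} : rename.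

HB.instance Definition _ (K : fieldType) (A : pzAlgType K) :=
  GRing.isZmodMorphism.Build K A algC algCB.
HB.instance Definition _ (K : fieldType) (A : pzAlgType K) :=
  GRing.isMonoidMorphism.Build K A algC algCM.

(* par b is the component of parity b.  Directness of the sum of the two components
   is not part of the structure: for algebras given by generators and relations
   it is a theorem. *)
HB.mixin Record hasParity (K : fieldType) A of PzAlg K A := {
  par : bool -> A -> Prop;
  par0 : forall b, par b 0;
  parC : forall c, par false (algC c);
  parD : forall b x y, par b x -> par b y -> par b (x + y);
  parM : forall b b' x y, par b x -> par b' y -> par (b (+) b') (x * y) }.
#[short(type="salgType")]
HB.structure Definition SAlg (K : fieldType) := {A of PzAlg K A & hasParity K A}.

Section QuotAlg.
Variables (K : fieldType) (A : pzAlgType K) (S : A -> Prop).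

Inductive ideal_gen : A -> Prop :=
| ideal_gen0 : ideal_gen 0
| ideal_gen_in x : S x -> ideal_gen x
| ideal_genB x y : ideal_gen x -> ideal_gen y -> ideal_gen (x - y)
| ideal_genMl a x : ideal_gen x -> ideal_gen (a * x)
| ideal_genMr a x : ideal_gen x -> ideal_gen (x * a).

Definition ideal_pred : pred A := fun x => `[< ideal_gen x >].

Lemma ideal_pred_zmod : zmod_closed ideal_pred.
Proof.
split=> [|x y /asboolP Ix /asboolP Iy]; apply/asboolP; first exact: ideal_gen0.
exact: ideal_genB.
Qed.
HB.instance Definition _ := GRing.isZmodClosed.Build A ideal_pred ideal_pred_zmod.

Definition quotalg := {quot (GRing.ZmodClosed.clone A ideal_pred _)}.
HB.instance Definition _ := GRing.Zmodule.on quotalg.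
HB.instance Definition _ := EqQuotient.on quotalg.

Definition quotpi (x : A) : quotalg := \pi x.
Definition quotrepr (x : quotalg) : A := repr x.

Lemma quotreprK x : quotpi (quotrepr x) = x. Proof. exact: reprK. Qed.

Lemma quotpiW (P : quotalg -> Prop) : (forall x, P (quotpi x)) -> forall x, P x.
Proof. by move=> h x; rewrite -[x]quotreprK. Qed.

Lemma quotpiP (x y : A) : quotpi x = quotpi y <-> ideal_gen (x - y).
Proof.
split=> [/eqP|h]; first by rewrite -idealrBE => /asboolP.
by apply/eqP; rewrite -idealrBE; apply/asboolP.
Qed.

Lemma ideal_repr (x : A) : ideal_gen (quotrepr (quotpi x) - x).
Proof. by apply/quotpiP; rewrite quotreprK. Qed.

Fact quotpi_zmod : zmod_morphism quotpi.
Proof.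
have piD x y : quotpi (x + y) = quotpi x + quotpi y by exact: pi_addr.
by move=> x y; apply: (addIr (quotpi y)); rewrite -piD !subrK.
Qed.
HB.instance Definition _ := GRing.isZmodMorphism.Build A quotalg quotpi quotpi_zmod.

Lemma ideal_genD x y : ideal_gen x -> ideal_gen y -> ideal_gen (x + y).
Proof.
move=> hx hy; rewrite -[y]opprK; apply: ideal_genB => //.
by rewrite -mulN1r; apply: ideal_genMl.
Qed.

Definition qalg_mul := locked (fun x y => quotpi (quotrepr x * quotrepr y)).

Lemma qalg_mulE (x y : A) : qalg_mul (quotpi x) (quotpi y) = quotpi (x * y).
Proof.
rewrite /qalg_mul -lock; apply/quotpiP; set x' := quotrepr _; set y' := quotrepr _.
have -> : x' * y' - x * y = (x' - x) * y' + x * (y' - y).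
  by rewrite mulrBl mulrBr addrA subrK.
apply: ideal_genD; first exact/ideal_genMr/ideal_repr.
exact/ideal_genMl/ideal_repr.
Qed.

Fact qalg_mulA : associative qalg_mul.
Proof.
by elim/quotpiW=> x; elim/quotpiW=> y; elim/quotpiW=> z; rewrite !qalg_mulE mulrA.
Qed.
Fact qalg_mul1 : left_id (quotpi 1) qalg_mul.
Proof. by elim/quotpiW=> x; rewrite qalg_mulE mul1r. Qed.
Fact qalg_mulr1 : right_id (quotpi 1) qalg_mul.
Proof. by elim/quotpiW=> x; rewrite qalg_mulE mulr1. Qed.
Fact qalg_mulDl : left_distributive qalg_mul +%R.
Proof.
elim/quotpiW=> x; elim/quotpiW=> y; elim/quotpiW=> z.
by rewrite !(qalg_mulE, =^~ raddfD) mulrDl.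
Qed.
Fact qalg_mulDr : right_distributive qalg_mul +%R.
Proof.
elim/quotpiW=> x; elim/quotpiW=> y; elim/quotpiW=> z.
by rewrite !(qalg_mulE, =^~ raddfD) mulrDr.
Qed.
HB.instance Definition _ := GRing.Zmodule_isPzRing.Build quotalg
  qalg_mulA qalg_mul1 qalg_mulr1 qalg_mulDl qalg_mulDr.

Fact quotpi_monoid : monoid_morphism quotpi.
Proof. by split=> // x y; rewrite -[LHS]qalg_mulE. Qed.
HB.instance Definition _ := GRing.isMonoidMorphism.Build A quotalg quotpi quotpi_monoid.

Definition qalg_C (c : K) : quotalg := quotpi (algC c).
Fact qalg_CB : zmod_morphism qalg_C.
Proof. by move=> c d; rewrite /qalg_C !rmorphB. Qed.
Fact qalg_CM : monoid_morphism qalg_C.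
Proof. by split=> [|c d]; rewrite /qalg_C ?rmorph1 // !rmorphM. Qed.
Fact qalg_C_comm c (x : quotalg) : qalg_C c * x = x * qalg_C c.
Proof. by elim/quotpiW: x => x; rewrite -!rmorphM algC_comm. Qed.
HB.instance Definition _ := isPzAlg.Build K quotalg qalg_CB qalg_CM qalg_C_comm.
Lemma quotpiC c : quotpi (algC c) = algC c. Proof. by []. Qed.

Section Lift.
Variables (B : pzAlgType K) (f : {rmorphism A -> B}).
Hypothesis fS : forall x, S x -> f x = 0.
Definition quotlift (_ : forall x, S x -> f x = 0) (x : quotalg) : B := f (quotrepr x).

Lemma quotliftE x : quotlift fS (quotpi x) = f x.
Proof.
apply/eqP; rewrite -subr_eq0 -rmorphB; apply/eqP.
elim: (ideal_repr x) => {x}[|x /fS//|x y _ fx _ fy|a x _ fx|a x _ fx].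
- exact: rmorph0.
- by rewrite rmorphB fx fy subr0.
- by rewrite rmorphM fx mulr0.
- by rewrite rmorphM fx mul0r.
Qed.

Fact quotlift_zmod : zmod_morphism (quotlift fS).
Proof. by elim/quotpiW=> x; elim/quotpiW=> y; rewrite -rmorphB !quotliftE rmorphB. Qed.
Fact quotlift_monoid : monoid_morphism (quotlift fS).
Proof.
split=> [|x y]; first by rewrite -(rmorph1 quotpi) quotliftE rmorph1.
by elim/quotpiW: x => x; elim/quotpiW: y => y; rewrite -rmorphM !quotliftE rmorphM.
Qed.
HB.instance Definition _ := GRing.isZmodMorphism.Build quotalg B (quotlift fS) quotlift_zmod.
HB.instance Definition _ := GRing.isMonoidMorphism.Build quotalg B (quotlift fS) quotlift_monoid.
End Lift.
End QuotAlg.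

Section FreeAlg.
Variables (K : fieldType) (I : choiceType).
Local Notation F := {malg K[{fmonom I}]}.
Implicit Type g : F.

Fact malgC_zmod : zmod_morphism (@mkmalgU {fmonom I} K (@mone {fmonom I})).
Proof. by move=> c d; rewrite raddfB. Qed.
Fact malgC_monoid : monoid_morphism (@mkmalgU {fmonom I} K (@mone {fmonom I})).
Proof. by split=> [|c d]; rewrite ?rmorph1 ?rmorphM. Qed.
Fact malgC_central c g : c%:MP * g = g * c%:MP.
Proof.
rewrite !malgM_def fgmulUg fgmulgU; apply: eq_bigr => m _.
by rewrite mulrC mul1m mulm1.
Qed.
HB.instance Definition _ := isPzAlg.Build K F malgC_zmod malgC_monoid malgC_central.

Definition freegen (x : I) : F := << fmu x >>.

Section Lift.
Variables (B : pzAlgType K) (f : I -> B).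
Definition freelift (g : F) : B :=
  \sum_(m <- msupp g) algC g@_m * \prod_(x <- (m : seq I)) f x.

Lemma freeliftEw (D : {fset {fmonom I}}) g : (msupp g `<=` D)%fset ->
  freelift g = \sum_(m <- D) algC g@_m * \prod_(x <- (m : seq I)) f x.
Proof.
move=> le; rewrite /freelift (big_fset_incl _ le) //= => m _ /mcoeff_outdom ->.
by rewrite rmorph0 mul0r.
Qed.

Lemma freeliftU c m : freelift << c *g m >> = algC c * \prod_(x <- (m : seq I)) f x.
Proof. by rewrite (freeliftEw msuppU_le) big_seq_fset1 mcoeffUU. Qed.

Fact freelift_zmod : zmod_morphism freelift.
Proof.
move=> g h; pose D := (msupp g `|` msupp h)%fset.
rewrite !(@freeliftEw D) ?fsubsetUl ?fsubsetUr ?msuppB_le //.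
rewrite -sumrB; apply: eq_bigr => m _.
by rewrite mcoeffB rmorphB mulrBl.
Qed.
HB.instance Definition _ := GRing.isZmodMorphism.Build F B freelift freelift_zmod.

Fact freelift_monoid : monoid_morphism freelift.
Proof.
split=> [|g h]; first by rewrite freeliftU fm1 big_nil rmorph1 mulr1.
rewrite malgME raddf_sum mulr_suml /=; apply: eq_bigr => m _.
rewrite raddf_sum mulr_sumr /=; apply: eq_bigr => m' _.
rewrite freeliftU rmorphM fmM big_cat /= -!mulrA; congr (_ * _).
by rewrite !mulrA algC_comm.
Qed.
HB.instance Definition _ := GRing.isMonoidMorphism.Build F B freelift freelift_monoid.

Lemma freelift_gen x : freelift (freegen x) = f x.
Proof. by rewrite freeliftU fmU big_seq1 rmorph1 mul1r. Qed.
Lemma freeliftC c : freelift (algC c) = algC c.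
Proof. by rewrite freeliftU fm1 big_nil mulr1. Qed.
End Lift.
End FreeAlg.

Section Supermodules.
Variables (K : fieldType) (A : salgType K).

Record supermod := Supermod {
  smod_sort :> lmodType A;
  spar : bool -> smod_sort -> Prop;
  spar0 : forall b, spar b 0;
  sparD : forall b x y, spar b x -> spar b y -> spar b (x + y);
  sparZ : forall b b' a x, par b a -> spar b' x -> spar (b (+) b') (a *: x) }.

(* The condition M = M_0 (+) M_1; it is kept apart from the record so that the
   induced module below can be formed without a PBW theorem. *)
Definition spar_direct (M : supermod) : Prop :=
  forall x : M, exists! y : M * M,
    [/\ spar false y.1, spar true y.2 & x = y.1 + y.2].

Definition simple_supermod (M : supermod) : Prop :=
  [/\ spar_direct M,
      exists x : M, x <> 0 &
      forall N : M -> Prop,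
        N 0 -> (forall x y, N x -> N y -> N (x + y)) ->
        (forall a x, N x -> N (a *: x)) ->
        (forall x y, spar false x -> spar true y -> N (x + y) -> N x /\ N y) ->
        (forall x, N x -> x = 0) \/ (forall x, N x)].

(* Homomorphisms of parity i; the last field is the usual sign rule
   f (a x) = (-1)^(|f| |a|) a f(x). *)
Record shom (i : bool) (M N : supermod) := Shom {
  shom_fun :> M -> N;
  shomD : forall x y, shom_fun (x + y) = shom_fun x + shom_fun y;
  shom_par : forall b x, spar b x -> spar (i (+) b) (shom_fun x);
  shomZ : forall b a x, par b a ->
    shom_fun (a *: x) = ((-1) ^+ (i && b) * a) *: shom_fun x }.

Definition projective_supermod (P : supermod) : Prop :=
  spar_direct P /\
  forall (M N : supermod) (g : shom false M N) (f : shom false P N),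
    spar_direct M -> spar_direct N -> (forall y, exists x, g x = y) ->
    exists h : shom false P M, forall x, g (h x) = f x.

Lemma shomP i (M N : supermod) (f g : shom i M N) : f =1 g -> f = g.
Proof.
case: f g => [f fD fp fZ] [g gD gp gZ] /= /funext fg; case: _ / fg in gD gp gZ *.
by congr Shom; exact: Prop_irrelevance.
Qed.

Lemma parN1 b (a : A) : par b a -> par b (- a).
Proof.
move=> pa; rewrite -mulN1r -(rmorphN1 algC) -[b]/(false (+) b).
by apply: parM => //; exact: parC.
Qed.

Lemma sparN (M : supermod) b (x : M) : spar b x -> spar b (- x).
Proof.
move=> px; rewrite -scaleN1r -[b]/(false (+) b); apply: sparZ => //.
by rewrite -(rmorphN1 algC); exact: parC.
Qed.

Lemma shom0 i (M N : supermod) (f : shom i M N) : f 0 = 0.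
Proof. by apply: (addrI (f 0)); rewrite -shomD !addr0. Qed.

Lemma shomN i (M N : supermod) (f : shom i M N) x : f (- x) = - f x.
Proof. by apply: (addrI (f x)); rewrite -shomD !subrr shom0. Qed.

Section Hom.
Variables (i : bool) (M N : supermod).
Local Notation H := (shom i M N).

HB.instance Definition _ := gen_eqMixin H.
HB.instance Definition _ := gen_choiceMixin H.

Program Definition shom_zero : H := @Shom i M N (fun=> 0) _ _ _.
Next Obligation. by rewrite addr0. Qed.
Next Obligation. exact: spar0. Qed.
Next Obligation. by rewrite scaler0. Qed.

Program Definition shom_opp (f : H) : H := @Shom i M N (fun x => - f x) _ _ _.
Next Obligation. by rewrite shomD opprD. Qed.
Next Obligation. exact/sparN/shom_par. Qed.
Next Obligation. by rewrite (shomZ _ _ H) scalerN. Qed.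

Program Definition shom_add (f g : H) : H := @Shom i M N (fun x => f x + g x) _ _ _.
Next Obligation. by rewrite !shomD addrACA. Qed.
Next Obligation. by apply: sparD; exact: shom_par. Qed.
Next Obligation. by rewrite !(shomZ _ _ H) scalerDr. Qed.

Fact shom_addA : associative shom_add.
Proof. by move=> f g h; apply: shomP => x /=; rewrite addrA. Qed.
Fact shom_addC : commutative shom_add.
Proof. by move=> f g; apply: shomP => x /=; rewrite addrC. Qed.
Fact shom_add0 : left_id shom_zero shom_add.
Proof. by move=> f; apply: shomP => x /=; rewrite add0r. Qed.
Fact shom_addN : left_inverse shom_zero shom_opp shom_add.
Proof. by move=> f; apply: shomP => x /=; rewrite addNr. Qed.
HB.instance Definition _ := GRing.isZmodule.Build H shom_addA shom_addC shom_add0 shom_addN.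
End Hom.

Lemma sign_addb_and i j b :
  (-1) ^+ (i && b) * (-1) ^+ (j && b) = (-1) ^+ ((i (+) j) && b) :> A.
Proof. by case: i j b => [] [] []; rewrite /= ?expr1 ?expr0 ?mulr1 ?mul1r ?mulrNN ?mulr1. Qed.

Program Definition shom_comp i j (L M N : supermod) (f : shom i M N) (g : shom j L M) :
  shom (i (+) j) L N := @Shom _ L N (fun x => f (g x)) _ _ _.
Next Obligation. by rewrite !shomD. Qed.
Next Obligation. by rewrite -addbA; do 2!apply: shom_par. Qed.
Next Obligation.
have pa : par b ((-1) ^+ (j && b) * a).
  by case: (j && b); rewrite ?mul1r // mulN1r; exact: parN1.
by rewrite (shomZ _ _ H) (shomZ _ _ pa) mulrA sign_addb_and.
Qed.

Program Definition shom_id (M : supermod) : shom false M M := @Shom _ M M id _ _ _.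
Next Obligation. by rewrite mul1r. Qed.

Program Definition shom_C (M : supermod) (c : K) : shom false M M :=
  @Shom _ M M (fun x => algC c *: x) _ _ _.
Next Obligation. by rewrite scalerDr. Qed.
Next Obligation. by apply: (@sparZ M false) => //; exact: parC. Qed.
Next Obligation. by rewrite mul1r !scalerA algC_comm. Qed.

(* sEnd is the superalgebra End_A(M) = Hom_0(M, M) (+) Hom_1(M, M); sEndop is its
   opposite, with product (-1)^(|f| |g|) g f on homogeneous f, g. *)
Section End_.
Variable M : supermod.
Definition sEnd := (shom false M M * shom true M M)%type.
HB.instance Definition _ := GRing.Zmodule.on sEnd.
Implicit Types f g h : sEnd.

Definition sEnd_mul f g : sEnd :=
  (shom_comp f.1 g.1 + shom_comp f.2 g.2, shom_comp f.1 g.2 + shom_comp f.2 g.1).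
Definition sEnd_C c : sEnd := (shom_C M c, 0).
Definition sEnd_par (b : bool) f : Prop := if b then f.1 = 0 else f.2 = 0.

Lemma sEndP f g : f.1 =1 g.1 -> f.2 =1 g.2 -> f = g.
Proof. by case: f g => [f0 f1] [g0 g1] /= /shomP-> /shomP->. Qed.

Fact sEnd_mulA : associative sEnd_mul.
Proof.
by move=> f g h; apply: sEndP => x /=; rewrite !shomD [X in _ + X = _]addrC addrACA.
Qed.
Fact sEnd_mul1 : left_id (shom_id M, 0) sEnd_mul.
Proof. by move=> f; apply: sEndP => x /=; rewrite addr0. Qed.
Fact sEnd_mulr1 : right_id (shom_id M, 0) sEnd_mul.
Proof. by move=> f; apply: sEndP => x /=; rewrite shom0 ?addr0 ?add0r. Qed.
Fact sEnd_mulDl : left_distributive sEnd_mul +%R.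
Proof. by move=> f g h; apply: sEndP => x /=; rewrite addrACA. Qed.
Fact sEnd_mulDr : right_distributive sEnd_mul +%R.
Proof. by move=> f g h; apply: sEndP => x /=; rewrite !shomD addrACA. Qed.
HB.instance Definition _ := GRing.Zmodule_isPzRing.Build sEnd
  sEnd_mulA sEnd_mul1 sEnd_mulr1 sEnd_mulDl sEnd_mulDr.

Fact sEnd_CB : zmod_morphism sEnd_C.
Proof.
move=> c d; apply: sEndP => x /=; last by rewrite subr0.
by rewrite rmorphB scalerBl.
Qed.
Fact sEnd_CM : monoid_morphism sEnd_C.
Proof.
split=> [|c d]; apply: sEndP => x //=; first by rewrite rmorph1 scale1r.
  by rewrite rmorphM scalerA addr0.
by rewrite scaler0 addr0.
Qed.
Lemma shom_algC i (f : shom i M M) c x : f (algC c *: x) = algC c *: f x.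
Proof. by rewrite (shomZ _ _ (parC _)) andbF mul1r. Qed.
Fact sEnd_C_comm c f : sEnd_C c * f = f * sEnd_C c.
Proof. by apply: sEndP => x /=; rewrite shom_algC ?shom0 addrC. Qed.
HB.instance Definition _ := isPzAlg.Build K sEnd sEnd_CB sEnd_CM sEnd_C_comm.

Fact sEnd_par0 b : sEnd_par b 0. Proof. by case: b. Qed.
Fact sEnd_parC c : sEnd_par false (algC c). Proof. by []. Qed.
Fact sEnd_parD b f g : sEnd_par b f -> sEnd_par b g -> sEnd_par b (f + g).
Proof. by case: b => /= -> ->; rewrite addr0. Qed.
Fact sEnd_parM b b' f g : sEnd_par b f -> sEnd_par b' g -> sEnd_par (b (+) b') (f * g).
Proof.
by case: b b' => [] [] /= f0 g0; apply: shomP => x /=; rewrite ?f0 ?g0 /= ?shom0 addr0.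
Qed.
HB.instance Definition _ := hasParity.Build K sEnd sEnd_par0 sEnd_parC sEnd_parD sEnd_parM.

Definition sEndop := sEnd.
HB.instance Definition _ := GRing.Zmodule.on sEndop.
Definition sEndop_mul (f g : sEndop) : sEndop :=
  (shom_comp g.1 f.1 - shom_comp g.2 f.2, shom_comp g.2 f.1 + shom_comp g.1 f.2).

Fact sEndop_mulA : associative sEndop_mul.
Proof.
move=> f g h; apply: sEndP => x /=; rewrite !shomD ?shomN ?shomD ?opprD ?opprK.
  by rewrite [X in _ + X = _]addrC addrACA.
by rewrite [X in _ + X = _]addrC addrACA.
Qed.
Fact sEndop_mul1 : left_id (1 : sEnd) sEndop_mul.
Proof. by move=> f; apply: sEndP => x /=; rewrite shom0 ?subr0 ?addr0 ?add0r. Qed.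
Fact sEndop_mulr1 : right_id (1 : sEnd) sEndop_mul.
Proof. by move=> f; apply: sEndP => x /=; rewrite ?subr0 ?addr0 ?add0r. Qed.
Fact sEndop_mulDl : left_distributive sEndop_mul +%R.
Proof.
by move=> f g h; apply: sEndP => x /=; rewrite !shomD ?opprD addrACA.
Qed.
Fact sEndop_mulDr : right_distributive sEndop_mul +%R.
Proof. by move=> f g h; apply: sEndP => x /=; rewrite ?opprD addrACA. Qed.
HB.instance Definition _ := GRing.Zmodule_isPzRing.Build sEndop
  sEndop_mulA sEndop_mul1 sEndop_mulr1 sEndop_mulDl sEndop_mulDr.

Definition sEndop_C (c : K) : sEndop := sEnd_C c.
Fact sEndop_CM : monoid_morphism sEndop_C.
Proof.
split=> [|c d]; first exact: sEnd_CM.1.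
apply: sEndP => x /=; last by rewrite scaler0 addr0.
by rewrite mulrC rmorphM scalerA subr0.
Qed.
Fact sEndop_C_comm c (f : sEndop) : sEndop_C c * f = f * sEndop_C c.
Proof. by apply: sEndP => x /=; rewrite shom_algC shom0 ?subr0 ?addr0 ?add0r. Qed.
HB.instance Definition _ := isPzAlg.Build K sEndop sEnd_CB sEndop_CM sEndop_C_comm.

Fact sEndop_parM b b' (f g : sEndop) :
  sEnd_par b f -> sEnd_par b' g -> sEnd_par (b (+) b') (f * g).
Proof.
by case: b b' => [] [] /= f0 g0; apply: shomP => x /=;
  rewrite ?f0 ?g0 /= ?shom0 ?subr0 ?addr0.
Qed.
HB.instance Definition _ := hasParity.Build K sEndop sEnd_par0 sEnd_parC sEnd_parD sEndop_parM.
End End_.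
End Supermodules.

(* The matrix superalgebra over B whose rows and columns have the parities pi, i.e.
   the right endomorphisms of a free B-module on generators of parities pi: the
   product is the ordinary one, and the entry (i, j) of a homogeneous matrix of
   parity b has parity b + pi i + pi j. *)
Section MatrixSuperalgebra.
Variables (K : fieldType) (B : salgType K) (d : nat).

Definition smx_of of 'I_d -> bool := 'M[B]_d.

Variable pi : 'I_d -> bool.
Local Notation smx := (smx_of pi).
HB.instance Definition _ := GRing.PzRing.on smx.

Definition smx_C (c : K) : smx := (algC c)%:M.
Definition smx_par (b : bool) (M : smx) : Prop :=
  forall i j, par (b (+) (pi i (+) pi j)) (M i j).

Fact smx_CB : zmod_morphism smx_C.
Proof. by move=> c e; rewrite /smx_C rmorphB raddfB. Qed.
Fact smx_CM : monoid_morphism smx_C.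
Proof. by split=> [|c e]; rewrite /smx_C ?rmorph1 // rmorphM scalar_mxM. Qed.
Fact smx_C_comm c (M : smx) : smx_C c * M = M * smx_C c.
Proof.
rewrite [LHS]mul_scalar_mx; apply/matrixP => i j; rewrite !mxE (bigD1 j) //= big1.
  by rewrite mxE eqxx mulr1n addr0 algC_comm.
by move=> k /negPf kj; rewrite mxE kj mulr0n mulr0.
Qed.
HB.instance Definition _ := isPzAlg.Build K smx smx_CB smx_CM smx_C_comm.

Fact smx_par0 b : smx_par b 0.
Proof. by move=> i j; rewrite mxE; exact: par0. Qed.
Fact smx_parC c : smx_par false (algC c).
Proof.
move=> i j; rewrite mxE; case: eqVneq => [->|_]; last exact: par0.
by rewrite addbb; exact: parC.
Qed.
Fact smx_parD b M N : smx_par b M -> smx_par b N -> smx_par b (M + N).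
Proof. by move=> hM hN i j; rewrite mxE; exact: parD. Qed.
Fact smx_parM b b' M N : smx_par b M -> smx_par b' N -> smx_par (b (+) b') (M * N).
Proof.
move=> hM hN i j; rewrite mxE.
elim/big_ind: _ => [|x y|k _]; [exact: par0|exact: parD|].
have := @parM _ _ _ _ _ _ (hM i k) (hN k j).
by case: b b' (pi i) (pi j) (pi k) {hM hN} => [] [] [] [] [].
Qed.
HB.instance Definition _ := hasParity.Build K smx smx_par0 smx_parC smx_parD smx_parM.
End MatrixSuperalgebra.

Notation smx B pi := (@smx_of _ B _ pi).

Section Superalgebras.
Variable K : fieldType.

Definition salg_iso (A B : salgType K) : Prop :=
  exists f : {rmorphism A -> B},
    [/\ bijective f, forall c, f (algC c) = algC c & forall b x, par b x <-> par b (f x)].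

(* e is a K-basis of A made of homogeneous elements, e i having parity pi i. *)
Definition homog_basis (A : salgType K) (d : nat) (pi : 'I_d -> bool) (e : 'I_d -> A) :=
  (forall i, par (pi i) (e i)) /\
  forall x, exists! c : {ffun 'I_d -> K}, x = \sum_i algC (c i) * e i.
End Superalgebras.

(* A (x)_B M for a morphism j : B -> A and a left B-module M: the free abelian
   group on A x M modulo biadditivity and (a j(b), m) = (a, b m). *)
Section Tensor.
Variables (A B : pzRingType) (j : {rmorphism B -> A}) (M : lmodType B).
Local Notation F := {malg int[(A * M)%type]}.

Inductive tens_rel : F -> Prop :=
| tens_relDl a a' m : tens_rel (<< (a + a', m) >> - (<< (a, m) >> + << (a', m) >>))
| tens_relDr a m m' : tens_rel (<< (a, m + m') >> - (<< (a, m) >> + << (a, m') >>))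
| tens_relM a b m : tens_rel (<< (a * j b, m) >> - << (a, b *: m) >>).

Inductive tens_span : F -> Prop :=
| tens_span0 : tens_span 0
| tens_span_in x : tens_rel x -> tens_span x
| tens_spanB x y : tens_span x -> tens_span y -> tens_span (x - y).

Definition tens_pred : pred F := fun x => `[< tens_span x >].

Fact tens_pred_zmod : zmod_closed tens_pred.
Proof.
split=> [|x y /asboolP Ix /asboolP Iy]; apply/asboolP; first exact: tens_span0.
exact: tens_spanB.
Qed.
HB.instance Definition _ := GRing.isZmodClosed.Build F tens_pred tens_pred_zmod.

Definition tensor := {quot (GRing.ZmodClosed.clone F tens_pred _)}.
HB.instance Definition _ := GRing.Zmodule.on tensor.
HB.instance Definition _ := EqQuotient.on tensor.

Definition tpi (x : F) : tensor := \pi x.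
Definition trepr (x : tensor) : F := repr x.
Lemma treprK x : tpi (trepr x) = x. Proof. exact: reprK. Qed.
Lemma tpiW (P : tensor -> Prop) : (forall x, P (tpi x)) -> forall x, P x.
Proof. by move=> h x; rewrite -[x]treprK. Qed.
Lemma tpiP (x y : F) : tpi x = tpi y <-> tens_span (x - y).
Proof.
split=> [/eqP|h]; first by rewrite -idealrBE => /asboolP.
by apply/eqP; rewrite -idealrBE; apply/asboolP.
Qed.
Fact tpi_zmod : zmod_morphism tpi.
Proof.
have piD x y : tpi (x + y) = tpi x + tpi y by exact: pi_addr.
by move=> x y; apply: (addIr (tpi y)); rewrite -piD !subrK.
Qed.
HB.instance Definition _ := GRing.isZmodMorphism.Build F tensor tpi tpi_zmod.

Definition tens (a : A) (m : M) : tensor := tpi << (a, m) >>.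

Lemma tens_rel0 x : tens_rel x -> tpi x = 0.
Proof.
by move=> h; rewrite -(raddf0 tpi); apply/tpiP; rewrite subr0; exact: tens_span_in.
Qed.
Lemma tensDl a a' m : tens (a + a') m = tens a m + tens a' m.
Proof.
by apply/eqP; rewrite -subr_eq0 -raddfD -raddfB; apply/eqP/tens_rel0/tens_relDl.
Qed.
Lemma tensDr a m m' : tens a (m + m') = tens a m + tens a m'.
Proof.
by apply/eqP; rewrite -subr_eq0 -raddfD -raddfB; apply/eqP/tens_rel0/tens_relDr.
Qed.
Lemma tensM a b m : tens (a * j b) m = tens a (b *: m).
Proof.
by apply/eqP; rewrite -subr_eq0 -raddfB; apply/eqP/tens_rel0/tens_relM.
Qed.

Section Lift.
Variables (V : zmodType) (f : A * M -> V).
Definition zlift (x : F) : V := \sum_(k <- msupp x) f k *~ x@_k.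

Lemma zliftEw (D : {fset (A * M)%type}) x : (msupp x `<=` D)%fset ->
  zlift x = \sum_(k <- D) f k *~ x@_k.
Proof. by move=> le; rewrite /zlift (big_fset_incl _ le) //= => k _ /mcoeff_outdom ->. Qed.

Lemma zliftU k : zlift << k >> = f k.
Proof. by rewrite (zliftEw msuppU_le) big_seq_fset1 mcoeffUU. Qed.

Fact zlift_zmod : zmod_morphism zlift.
Proof.
move=> g h; pose D := (msupp g `|` msupp h)%fset.
rewrite !(@zliftEw D) ?fsubsetUl ?fsubsetUr ?msuppB_le // -sumrB.
by apply: eq_bigr => k _; rewrite mcoeffB mulrzBr.
Qed.
HB.instance Definition _ := GRing.isZmodMorphism.Build F V zlift zlift_zmod.
End Lift.

Lemma malg_ind (P : F -> Prop) : P 0 -> (forall k, P << k >>) ->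
  (forall x y, P x -> P y -> P (x - y)) -> forall x, P x.
Proof.
move=> P0 P1 PB; have PN x : P x -> P (- x) by move=> hx; rewrite -sub0r; apply: PB.
have PD x y : P x -> P y -> P (x + y) by move=> hx /PN hy; rewrite -[y]opprK; apply: PB.
move=> x; rewrite [x]monalgE; elim/big_ind: _ => // k _.
have Pn (n : nat) : P << n%:Z *g k >>.
  elim: n => [|n IH]; first by rewrite monalgU0.
  by rewrite -addn1 PoszD monalgUD; apply: PD.
by case: (x@_k) => n; rewrite ?NegzE ?monalgUN; first exact: Pn; exact/PN/Pn.
Qed.

Definition tens_act (a : A) : F -> tensor := zlift (fun k => tens (a * k.1) k.2).
HB.instance Definition _ a :=
  GRing.isZmodMorphism.Build F tensor (tens_act a) (zlift_zmod _).
Definition tens_scale (a : A) (x : tensor) : tensor := locked (tens_act a (trepr x)).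

Lemma tens_actU a a' m : tens_act a << (a', m) >> = tens (a * a') m.
Proof. exact: zliftU. Qed.

Lemma tens_scaleE a x : tens_scale a (tpi x) = tens_act a x.
Proof.
rewrite /tens_scale -lock; apply/eqP; rewrite -subr_eq0 -raddfB; apply/eqP.
have : tens_span (trepr (tpi x) - x) by apply/tpiP; rewrite treprK.
elim=> [|y hy|y z _ hy _ hz]; first exact: raddf0; last by rewrite raddfB /= hy hz subr0.
case: hy => [a1 a2 m|a1 m m'|a1 b m].
- by rewrite raddfB raddfD /= !tens_actU mulrDr tensDl subrr.
- by rewrite raddfB raddfD /= !tens_actU tensDr subrr.
- by rewrite raddfB /= !tens_actU mulrA tensM subrr.
Qed.

Lemma tens_scale_tens a a' m : tens_scale a (tens a' m) = tens (a * a') m.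
Proof. by rewrite tens_scaleE tens_actU. Qed.

Lemma tens_scaleB a : zmod_morphism (tens_scale a).
Proof. by elim/tpiW=> x; elim/tpiW=> y; rewrite -raddfB !tens_scaleE raddfB. Qed.

Lemma tens_ind (P : tensor -> Prop) : P 0 -> (forall a m, P (tens a m)) ->
  (forall x y, P x -> P y -> P (x - y)) -> forall x, P x.
Proof.
move=> P0 P1 PB; elim/tpiW; elim/malg_ind => [|[a m]|x y hx hy].
- by rewrite raddf0.
- exact: P1.
- by rewrite raddfB; exact: PB.
Qed.

Fact tens_scaleA a b x : tens_scale a (tens_scale b x) = tens_scale (a * b) x.
Proof.
elim/tens_ind: x => [|c m|x y hx hy]; first by rewrite -[0](subrr 0) !tens_scaleB !subrr.
  by rewrite !tens_scale_tens mulrA.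
by rewrite !tens_scaleB hx hy.
Qed.
Fact tens_scale1 : left_id 1 tens_scale.
Proof.
elim/tens_ind => [|c m|x y hx hy]; first by rewrite -[0](subrr 0) !tens_scaleB !subrr.
  by rewrite !tens_scale_tens mul1r.
by rewrite !tens_scaleB hx hy.
Qed.
Fact tens_scaleDr : right_distributive tens_scale +%R.
Proof.
move=> a x y; have N z : tens_scale a (- z) = - tens_scale a z.
  by rewrite -(sub0r z) -{1}(subrr z) !tens_scaleB subrr sub0r.
by rewrite -{1}[y]opprK tens_scaleB N opprK.
Qed.
Fact tens_scaleDl x : {morph tens_scale^~ x : a b / a + b}.
Proof.
move=> a b; elim/tens_ind: x => [|c m|x y hx hy].
- by rewrite -[0](subrr 0) !tens_scaleB !subrr addr0.
- by rewrite !tens_scale_tens mulrDl tensDl.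
- by rewrite !tens_scaleB hx hy opprD addrACA.
Qed.
HB.instance Definition _ := GRing.Zmodule_isLmodule.Build A tensor
  tens_scaleA tens_scale1 tens_scaleDr tens_scaleDl.
Lemma scale_tens a a' m : a *: tens a' m = tens (a * a') m.
Proof. exact: tens_scale_tens. Qed.
End Tensor.

(* A (x)_B M as a left A-supermodule, with |a (x) m| = |a| + |m|. *)
Section InducedModule.
Variables (K : fieldType) (A B : salgType K) (j : {rmorphism B -> A}) (M : supermod B).

Inductive ind_par : bool -> tensor j M -> Prop :=
| ind_par0 b : ind_par b 0
| ind_par_tens b b' a m : par b a -> spar b' m -> ind_par (b (+) b') (tens j a m)
| ind_parD b x y : ind_par b x -> ind_par b y -> ind_par b (x + y).

Fact ind_parZ b b' a x : par b a -> ind_par b' x -> ind_par (b (+) b') (a *: x).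
Proof.
move=> pa; elim=> {b' x}[b'|b' c a' m pa' pm|b' x y _ hx _ hy].
- by rewrite scaler0; exact: ind_par0.
- by rewrite scale_tens addbA; apply: ind_par_tens => //; exact: parM.
- by rewrite scalerDr; exact: ind_parD.
Qed.

Definition ind_supermod : supermod A := Supermod ind_par0 ind_parD ind_parZ.
End InducedModule.

Section MorphTransfer.
Variables (A A' B : pzRingType) (f : {rmorphism A -> B}) (q : {rmorphism A' -> B}).
Variables (x y z : A) (x' y' z' : A').
Hypotheses (fx : f x = q x') (fy : f y = q y') (fz : f z = q z').

Lemma morph_transferD : f (z - (x + y)) = q (z' - (x' + y')).
Proof. by rewrite !rmorphB !rmorphD fx fy fz. Qed.
Lemma morph_transferZ : f (z - x * y) = q (z' - x' * y').
Proof. by rewrite !rmorphB !rmorphM fx fy fz. Qed.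
Lemma morph_transfer_br k :
  f (x * y - (-1) ^+ k * (y * x) - z) = q (x' * y' - (-1) ^+ k * (y' * x') - z').
Proof. by rewrite !rmorphB !rmorphM !rmorphXn !rmorphN1 fx fy fz. Qed.
Lemma morph_transfer_pow k : f (x ^+ k - y - z) = q (x' ^+ k - y' - z').
Proof. by rewrite !rmorphB !rmorphXn fx fy fz. Qed.
End MorphTransfer.

(* A graded subspace of gl(N) is a family a of subspaces, a b being its component
   of parity b; the bracket is the supercommutator of matrices. *)
Section Enveloping.
Variables (K : fieldType) (N p : nat).
Local Notation gl := 'M[K]_N.
Implicit Type a : bool -> {vspace gl}.

Definition sbracket (i j : bool) (x y : gl) : gl :=
  x * y - (-1) ^+ (i && j) *: (y * x).

Definition gens a := {b : bool & subvs_of (a b)}.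
HB.instance Definition _ a := Choice.on (gens a).

Local Notation FU a := {malg K[{fmonom (gens a)}]}.
Definition fgen a b (x : subvs_of (a b)) : FU a :=
  freegen K (Tagged (fun b => subvs_of (a b)) x : gens a).

(* The relations are stated for all z in a whose matrix is [x, y] (resp. x ^+ p
   below), so that closure of a under these operations need not be proved
   beforehand. *)
Inductive U_rel a : FU a -> Prop :=
| U_relD b (x y : subvs_of (a b)) : U_rel (fgen (x + y) - (fgen x + fgen y))
| U_relZ b c (x : subvs_of (a b)) : U_rel (fgen (c *: x) - algC c * fgen x)
| U_rel_bracket i j (x : subvs_of (a i)) (y : subvs_of (a j)) (z : subvs_of (a (i (+) j))) :
    vsval z = sbracket i j (vsval x) (vsval y) ->
    U_rel (fgen x * fgen y - (-1) ^+ (i && j) * (fgen y * fgen x) - fgen z).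

Definition U a := quotalg (@U_rel a).
HB.instance Definition _ a := PzAlg.on (U a).
Definition Ugen a b (x : subvs_of (a b)) : U a := quotpi (@U_rel a) (fgen x).

Variable chi : gl -> K.

Inductive Uchi_rel a : U a -> Prop :=
| Uchi_rel_pow (x z : subvs_of (a false)) : vsval z = vsval x ^+ p ->
    Uchi_rel (Ugen x ^+ p - Ugen z - algC (chi (vsval x) ^+ p)).

Definition Uchi a := quotalg (@Uchi_rel a).
HB.instance Definition _ a := PzAlg.on (Uchi a).
Definition Uchi_gen a b (x : subvs_of (a b)) : Uchi a := quotpi (@Uchi_rel a) (Ugen x).

Inductive Uchi_par a : bool -> Uchi a -> Prop :=
| Uchi_par0 b : Uchi_par b 0
| Uchi_parC c : Uchi_par false (algC c)
| Uchi_par_gen b (x : subvs_of (a b)) : Uchi_par b (Uchi_gen x)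
| Uchi_parD b x y : Uchi_par b x -> Uchi_par b y -> Uchi_par b (x + y)
| Uchi_parM b b' x y : Uchi_par b x -> Uchi_par b' y -> Uchi_par (b (+) b') (x * y).
HB.instance Definition _ a := hasParity.Build K (Uchi a)
  (@Uchi_par0 a) (@Uchi_parC a) (@Uchi_parD a) (@Uchi_parM a).

Section Inclusion.
Variables (a a' : bool -> {vspace gl}) (saa' : forall b, (a b <= a' b)%VS).

Definition incl_gen b (x : subvs_of (a b)) : subvs_of (a' b) := vsproj (a' b) (vsval x).

Lemma incl_genE b (x : subvs_of (a b)) : vsval (incl_gen x) = vsval x.
Proof. by rewrite vsprojK //; apply: (subvP (saa' b)); exact: subvsP. Qed.

Definition incl_F : FU a -> Uchi a' :=
  freelift (fun x : gens a => Uchi_gen (incl_gen (tagged x))).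
HB.instance Definition _ := GRing.RMorphism.on incl_F.

Lemma incl_FE b (x : subvs_of (a b)) : incl_F (fgen x) = Uchi_gen (incl_gen x).
Proof. by rewrite /incl_F freelift_gen. Qed.
Lemma incl_FC c : incl_F (algC c) = algC c.
Proof. exact: freeliftC. Qed.

Lemma Uchi_rel0 x : U_rel x -> quotpi (@Uchi_rel a') (quotpi (@U_rel a') x) = 0.
Proof.
move=> hx; rewrite -(rmorph0 (quotpi _)); congr quotpi.
rewrite -(rmorph0 (quotpi _)); apply/quotpiP; rewrite subr0; exact: ideal_gen_in.
Qed.

Lemma incl_genD b (x y : subvs_of (a b)) : incl_gen (x + y) = incl_gen x + incl_gen y.
Proof. by rewrite /incl_gen !linearD. Qed.
Lemma incl_genZ b c (x : subvs_of (a b)) : incl_gen (c *: x) = c *: incl_gen x.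
Proof. by rewrite /incl_gen !linearZ. Qed.

Lemma incl_F_rel x : U_rel x -> incl_F x = 0.
Proof.
pose q := quotpi (@Uchi_rel a') \o quotpi (@U_rel a').
case=> {x}[b x y|b c x|i j x y z zE].
- rewrite -[RHS](Uchi_rel0 (U_relD (incl_gen x) (incl_gen y))) -incl_genD.
  exact: (morph_transferD (f := incl_F) (q := q)) (incl_FE _) (incl_FE _) (incl_FE _).
- rewrite -[RHS](Uchi_rel0 (U_relZ c (incl_gen x))) -incl_genZ.
  exact: (morph_transferZ (f := incl_F) (q := q)) (incl_FC _) (incl_FE _) (incl_FE _).
have h : vsval (incl_gen z) = sbracket i j (vsval (incl_gen x)) (vsval (incl_gen y)).
  by rewrite !incl_genE.
rewrite -[RHS](Uchi_rel0 (U_rel_bracket h)).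
exact: (@morph_transfer_br _ _ _ incl_F q _ _ _ _ _ _ (incl_FE x) (incl_FE y) (incl_FE z) (i && j)).
Qed.

Definition incl_U : U a -> Uchi a' := quotlift incl_F_rel.
HB.instance Definition _ := GRing.RMorphism.on incl_U.
Lemma incl_U_gen b (x : subvs_of (a b)) : incl_U (Ugen x) = Uchi_gen (incl_gen x).
Proof. by rewrite [LHS]quotliftE; exact: incl_FE. Qed.
Lemma incl_UC c : incl_U (algC c) = algC c.
Proof. by rewrite [LHS]quotliftE; exact: incl_FC. Qed.

Lemma incl_U_rel x : Uchi_rel x -> incl_U x = 0.
Proof.
case=> {x} x z zE.
have h : vsval (incl_gen z) = vsval (incl_gen x) ^+ p by rewrite !incl_genE.
have := Uchi_rel_pow h; rewrite incl_genE => /ideal_gen_in hx.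
have <- : quotpi (@Uchi_rel a') (Ugen (incl_gen x) ^+ p - Ugen (incl_gen z)
    - algC (chi (vsval x) ^+ p)) = 0.
  by rewrite -[RHS](rmorph0 (quotpi (@Uchi_rel a'))); apply/quotpiP; rewrite subr0.
exact: (@morph_transfer_pow _ _ _ incl_U (quotpi (@Uchi_rel a')) _ _ _ _ _ _
  (incl_U_gen x) (incl_U_gen z) (incl_UC _)).
Qed.

Definition Uchi_incl : Uchi a -> Uchi a' := quotlift incl_U_rel.
HB.instance Definition _ := GRing.RMorphism.on Uchi_incl.

Lemma Uchi_incl_gen b (x : subvs_of (a b)) : Uchi_incl (Uchi_gen x) = Uchi_gen (incl_gen x).
Proof. by rewrite [LHS]quotliftE; exact: incl_U_gen. Qed.
Lemma Uchi_inclC c : Uchi_incl (algC c) = algC c.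
Proof. by rewrite [LHS]quotliftE; exact: incl_UC. Qed.
End Inclusion.
End Enveloping.

(* q(n) is embedded in gl(n|n) = 'M_(n + n) by (A, B) |-> (A B; B A). *)
Section Queer.
Variables (K : fieldType) (n : nat).
Local Notation M := 'M[K]_n.
Local Notation gl := 'M[K]_(n + n).

Definition qblock (b : bool) (A : M) : gl :=
  if b then block_mx 0 A A 0 else block_mx A 0 0 A.

Fact qblock_linear b : linear (qblock b).
Proof.
by case: b => c A B; rewrite /qblock scale_block_mx add_block_mx !scaler0 !addr0.
Qed.
HB.instance Definition _ b := GRing.isLinear.Build K M gl *:%R (qblock b) (qblock_linear b).

(* The parity b component of the space of all matrices (A B; B A), A, B in V. *)
Definition qspace (V : {vspace M}) (b : bool) : {vspace gl} :=
  (linfun (qblock b) @: V)%VS.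

Definition qn : bool -> {vspace gl} := qspace fullv.

Definition otr (x : gl) : K := \tr (ursubmx x).

(* chi = (X, -), with X viewed as an odd element of q(n). *)
Definition chi (X : M) (y : gl) : K := otr (qblock true X * y).

(* For a partition d of n, the index i lies in the block number
   reshape_index d i, at the position reshape_offset d i. *)
Definition jordan (d : seq nat) : M :=
  \matrix_(i < n, j < n)
    ((j == i.+1 :> nat) && (reshape_index d i == reshape_index d j))%:R.

Definition weight (d : seq nat) (i : nat) : int :=
  (nth 0 d (reshape_index d i))%:Z - 1 - (reshape_offset d i).*2%:Z.

Definition jordan_form (X P : M) (d : seq nat) : Prop :=
  [/\ P \in unitmx, sorted geq d, all (ltn 0) d, sumn d = n &
      X = P *m jordan d *m invmx P].

(* The grading of gl(n) transported from the Jordan basis: gl(n)(k) is spanned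
   by the P E_ij P^-1 with weight i - weight j = k. *)
Definition gl_deg (P : M) (d : seq nat) (k : int) : {vspace M} :=
  (\sum_(i < n) \sum_(j < n | (weight d i - weight d j == k)%R)
     <[P *m delta_mx i j *m invmx P]>)%VS.

Definition q_deg (P : M) (d : seq nat) (k : int) : bool -> {vspace gl} :=
  qspace (gl_deg P d k).

Definition isotropic (X : M) (b : bool) (V : {vspace gl}) : Prop :=
  forall x y, x \in V -> y \in V -> chi X (sbracket b b x y) = 0.

Definition max_isotropic (X P : M) (d : seq nat) (L : bool -> {vspace gl}) : Prop :=
  forall b,
    [/\ (L b <= q_deg P d (- 1) b)%VS, isotropic X b (L b) &
        forall V, (L b <= V)%VS -> (V <= q_deg P d (- 1) b)%VS ->
          isotropic X b V -> V = L b].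

(* Degrees are differences of weights, so they are smaller than 2 n. *)
Definition m_alg (P : M) (d : seq nat) (L : bool -> {vspace gl}) (b : bool) : {vspace gl} :=
  (\sum_(2 <= k < n.*2) q_deg P d (- k%:Z) b + L b)%VS.

Lemma qspaceS (V W : {vspace M}) b : (V <= W)%VS -> (qspace V b <= qspace W b)%VS.
Proof. exact: limgS. Qed.

Lemma m_alg_sub X P d L : max_isotropic X P d L -> forall b, (m_alg P d L b <= qn b)%VS.
Proof.
move=> hL b; have [Lb _ _] := hL b.
rewrite subv_add (subv_trans Lb) ?qspaceS ?subvf // andbT.
elim/big_ind: _ => [|V W hV hW|k _]; first exact: sub0v.
  by rewrite subv_add hV.
exact/qspaceS/subvf.
Qed.

Definition Q_m (p : nat) (X P : M) (d : seq nat) (L : bool -> {vspace gl})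
    (hL : max_isotropic X P d L) (Kchi : supermod (Uchi p (chi X) (m_alg P d L))) :
    supermod (Uchi p (chi X) qn) :=
  ind_supermod (Uchi_incl (p := p) (chi := chi X) (m_alg_sub hL)) Kchi.
End Queer.

(* Main.v *)
(** Write A for the reduced enveloping algebra of q(n), B for that of m, and
    xi = x - chi(x) for x in m.  Take a homogeneous basis x_1, x_2, ... of m, most
    negative degrees first, and y_1, y_2, ... in g dual to it for the pairing
    chi([x, y]); such y_i exist because ad X is injective in negative degrees.  Let s be
    the product ... xi_2^(h_2 - 1) xi_1^(h_1 - 1), with h = p for even and h = 2 for odd
    generators, and t the product y_1^(h_1 - 1) y_2^(h_2 - 1) ... divided by a product of
    factors (p - 1)!.  If w is a vector of an A-module killed by all the xi, then
    s t w = w: a xi of degree -k lowers the Kazhdan degree of words in the y_i by k, so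
    s t w has degree 0, and its leading coefficient can be read off since chi([x_i, y_j])
    is triangular.

    This identity replaces the PBW theorem.  It makes a v |-> a s a split injection of
    Q = A v into A, and lifts Whittaker vectors along surjections, so that Q is projective.
    Killing the x_i one at a time, it shows that every a in A is uniquely a sum of
    e_i t w_i, where e_i runs over the monomials in the xi and w_i over Wh(A), the elements
    killed by all the xi.  Write 1 = sum_i u_i w_i in this way, with u_i = e_i t.  Then
    w_i u_j v = delta_ij v, and a |-> (w_i a u_j)_ij identifies A with the matrices over
    Wh(Q), which is the opposite of End(Q). *)
From HB Require Import structures.
Require Import Defs.
From mathcomp Require Import all_boot all_order all_algebra.
From mathcomp Require Import zify boolp monalg.

Set Implicit Arguments.
Unset Strict Implicit.
Unset Printing Implicit Defensive.
Import Order.TTheory GRing.Theory Num.Theory.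
Local Open Scope ring_scope.

(** * Triangular systems of generators *)

Section Triangular.
Variables (K : fieldType) (B : pzAlgType K) (T : eqType).
Variables (xi : T -> B) (odd_gen : T -> bool) (height : T -> nat).
Implicit Types (z : T) (pre suf its : seq T) (r : B).

(** The obstacle is that A and B are known only through relations: neither their dimensions nor 1 <>
    0 are available. The argument therefore uses only what s t w = w implies in arbitrary modules.
    If 1 = 0 in A, everything on the side of A is zero; otherwise the identity forces s <> 0 in A,
    and this makes the monomials in the xi independent in B. A letter of degree d gets Kazhdan
    weight d + 2, so that chi, supported in degree -2, produces scalars of weight 0. Then y_i, of
    degree k - 2, has weight k, which is what xi_i of degree -k removes. On leading terms xi_i acts
    as the derivative along y_i; this is the origin of the factorials. The order of the basis puts
    commutators and the powers xi_i^h_i into the span of earlier xi. Hence on the common kernel of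
    xi_1, ..., xi_(i-1) the operator xi_i has h_i-th power zero. If N^h = 0 and N^(h-1) maps a
    subspace Z bijectively onto ker N, the space is the direct sum of the N^a Z for a < h. Starting
    from s t w = w on the smallest kernel, this is applied backwards along the list. *)

Inductive lin_span pre : B -> Prop :=
| lin_span0 : lin_span pre 0
| lin_spanD c z r : z \in pre -> lin_span pre r -> lin_span pre (algC c * xi z + r).

Lemma lin_spanZ pre c r : lin_span pre r -> lin_span pre (algC c * r).
Proof.
elim=> [|c' z r' zp _ IH]; first by rewrite mulr0; exact: lin_span0.
by rewrite mulrDr mulrA -rmorphM; exact: lin_spanD.
Qed.

Lemma lin_span_ind_add pre (P : B -> Prop) r : P 0 ->
  (forall x y, P x -> P y -> P (x + y)) ->
  (forall c z, z \in pre -> P (algC c * xi z)) -> lin_span pre r -> P r.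
Proof. by move=> P0 PD Pz; elim=> // c z r' zp _; apply: PD; exact: Pz. Qed.

(* The multi-indices of the monomials xi_1^a_1 ... xi_m^a_m with a_i < height i. *)
Fixpoint mindex suf : finType :=
  if suf is z :: suf' then ('I_(height z) * mindex suf')%type else unit.

Fixpoint monomial suf : mindex suf -> B :=
  if suf is z :: suf' return mindex suf -> B
  then fun a => xi z ^+ a.1 * monomial a.2 else fun=> 1.

Fixpoint mparity suf : mindex suf -> bool :=
  if suf is z :: suf' return mindex suf -> bool
  then fun a => (odd_gen z && odd a.1) (+) mparity a.2 else fun=> false.

(** The factors are reversed so that on a module the earliest generator acts first, as [killed_mtop]
    needs. *)
Fixpoint mtop suf : B :=
  if suf is z :: suf' then mtop suf' * xi z ^+ (height z).-1 else 1.

Lemma mtop_rcons pre z : mtop (rcons pre z) = xi z ^+ (height z).-1 * mtop pre.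
Proof. by elim: pre => [|y pre IH] /=; rewrite ?mul1r ?mulr1 // IH mulrA. Qed.

Variable its : seq T.
Hypothesis xi_comm : forall pre z suf z', its = pre ++ z :: suf -> z' \in its ->
  lin_span pre (xi z' * xi z - (-1) ^+ (odd_gen z' && odd_gen z) * (xi z * xi z')).
Hypothesis xi_height : forall pre z suf, its = pre ++ z :: suf ->
  lin_span pre (xi z ^+ height z).

(** * Spanning by ordered monomials *)

Section Spanning.
Hypothesis B_gen : forall P : B -> Prop, (forall c, P (algC c)) ->
  (forall z, z \in its -> P (xi z)) -> (forall x y, P x -> P y -> P (x + y)) ->
  (forall x y, P x -> P y -> P (x * y)) -> forall x, P x.

Inductive right_ideal pre : B -> Prop :=
| right_ideal0 : right_ideal pre 0
| right_idealD z b r : z \in pre -> right_ideal pre r -> right_ideal pre (xi z * b + r).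

Lemma right_ideal_add pre r r' : right_ideal pre r -> right_ideal pre r' ->
  right_ideal pre (r + r').
Proof.
move=> hr hr'; elim: hr => [|z b r0 zp _ IH]; first by rewrite add0r.
by rewrite -addrA; exact: right_idealD.
Qed.

Lemma right_ideal_gen pre z b : z \in pre -> right_ideal pre (xi z * b).
Proof. by move=> zp; rewrite -[xi z * b]addr0; apply/right_idealD/right_ideal0. Qed.

Lemma right_idealMr pre r b : right_ideal pre r -> right_ideal pre (r * b).
Proof.
elim=> [|z c r0 zp _ IH]; first by rewrite mul0r; exact: right_ideal0.
by rewrite mulrDl -mulrA; exact: right_idealD.
Qed.

Lemma right_ideal_span pre r : lin_span pre r -> right_ideal pre r.
Proof.
apply: lin_span_ind_add; [exact: right_ideal0|exact: right_ideal_add|].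
by move=> c z zp; rewrite algC_comm; exact: right_ideal_gen.
Qed.

Lemma right_ideal_sub pre pre' r : {subset pre <= pre'} ->
  right_ideal pre r -> right_ideal pre' r.
Proof.
move=> h; elim=> [|z b r' /h zp _ IH]; [exact: right_ideal0|exact: right_idealD].
Qed.

(** Moving a generator past [xi l] costs only a combination of generators before [l], so the right
    ideal of an initial segment is two-sided. *)
Lemma right_idealMl pre suf r b : its = pre ++ suf -> right_ideal pre r ->
  right_ideal pre (b * r).
Proof.
move=> e hr; elim/B_gen: b r hr => [c|z zi|x y hx hy|x y hx hy] r hr.
- by rewrite algC_comm; exact: right_idealMr.
- elim: hr => [|l b r' lp _ IH]; first by rewrite mulr0; exact: right_ideal0.
  rewrite mulrDr; apply: right_ideal_add => //.
  have /path.splitPr e1 := lp; case: e1 e lp => p1 p2 e lp; rewrite -catA cat_cons in e.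
  have h : right_ideal (p1 ++ l :: p2)
      (xi z * xi l - (-1) ^+ (odd_gen z && odd_gen l) * (xi l * xi z)).
    apply: (@right_ideal_sub p1) => [x|]; first by rewrite mem_cat => ->.
    exact/right_ideal_span/(xi_comm e zi).
  rewrite mulrA -[xi z * xi l](subrK ((-1) ^+ (odd_gen z && odd_gen l) * (xi l * xi z))).
  rewrite mulrDl; apply: right_ideal_add; first exact: right_idealMr.
  rewrite -(rmorphN1 algC) -rmorphXn algC_comm -!mulrA; exact: right_ideal_gen.
- by rewrite mulrDl; apply: right_ideal_add; [exact: hx|exact: hy].
- by rewrite -mulrA; apply/hx/hy.
Qed.

Definition mono_span suf (r : B) : Prop :=
  exists c : mindex suf -> K, r = \sum_a algC (c a) * monomial a.

(* One generator at a time, xi_z^k B lies in the ideal of the earlier generators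
   plus xi_z^(k+1) B plus monomials. *)
Lemma monomial_spanning_rel suf pre : its = pre ++ suf -> forall b,
  exists2 r, right_ideal pre r & mono_span suf (b - r).
Proof.
elim: suf pre => [|z suf IH] pre e b.
  (* Here the claim is that [B] is the sum of the scalars and the ideal of all generators, which
     [B_gen] reduces to generators, sums and products. *)
  rewrite cats0 in e; elim/B_gen: b => [c|z zi|x y [r hr [c hc]] [r' hr' [c' hc']]|].
  - exists 0; first exact: right_ideal0.
    by exists (fun=> c); rewrite subr0 (big_pred1 tt) => [|[]//]; rewrite mulr1.
  - exists (xi z); first by rewrite -[xi z]mulr1; apply: right_ideal_gen; rewrite -e.
    by exists (fun=> 0); rewrite subrr big1 // => i _; rewrite rmorph0 mul0r.
  - exists (r + r'); first exact: right_ideal_add.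
    exists (fun a => c a + c' a); rewrite opprD addrACA hc hc' -big_split.
    by apply: eq_bigr => a _; rewrite rmorphD mulrDl.
  move=> x y [r hr [c hc]] [r' hr' [c' hc']].
  have s1 (f : mindex [::] -> K) : \sum_a algC (f a) * monomial a = algC (f tt).
    by rewrite (big_pred1 tt) => [|[]//]; rewrite mulr1.
  have {}hc : x = r + algC (c tt) by rewrite -s1 -hc addrC subrK.
  have {}hc' : y = r' + algC (c' tt) by rewrite -s1 -hc' addrC subrK.
  exists (r * y + algC (c tt) * r').
    apply: right_ideal_add; first exact: right_idealMr.
    by rewrite algC_comm; exact: right_idealMr.
  exists (fun=> c tt * c' tt); rewrite s1 {1}hc mulrDl {2}hc' mulrDr addrA.
  by rewrite [X in X - _]addrC addrK rmorphM.
have IHz := IH (rcons pre z); rewrite cat_rcons in IHz.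
have step k : exists r x (c : nat -> mindex suf -> K), right_ideal pre r /\
    b = r + xi z ^+ k * x + \sum_(j < k) \sum_a algC (c j a) * (xi z ^+ j * monomial a).
  elim: k => [|k [r [x [c [hr hb]]]]].
    exists 0, b, (fun _ _ => 0); split; first exact: right_ideal0.
    by rewrite big_ord0 add0r addr0 expr0 mul1r.
  have [r' hr' [c' hc']] := IHz e x.
  have [r1 [x1 [h1 er']]] : exists r1 x1, right_ideal pre r1 /\ r' = r1 + xi z * x1.
    elim: hr' => [|l y r0 lp _ [r1 [x1 [h1 ->]]]].
      by exists 0, 0; rewrite mulr0 addr0; split => //; exact: right_ideal0.
    move: lp; rewrite mem_rcons inE => /orP[/eqP ->|lp].
      by exists r1, (y + x1); rewrite mulrDr addrCA.
    by exists (xi l * y + r1), x1; rewrite addrA; split => //; exact: right_idealD.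
  exists (r + xi z ^+ k * r1), x1, (fun j => if j == k then c' else c j); split.
    by apply: right_ideal_add => //; exact: right_idealMl e h1.
  rewrite hb big_ord_recr /= eqxx.
  have -> : \sum_(j < k) \sum_a algC ((if j == k :> nat then c' else c j) a) * (xi z ^+ j * monomial a)
     = \sum_(j < k) \sum_a algC (c j a) * (xi z ^+ j * monomial a).
    by apply: eq_bigr => j _; rewrite ltn_eqF.
  have {1}-> : x = r1 + xi z * x1 + \sum_a algC (c' a) * monomial a.
    by rewrite -hc' -er' addrC subrK.
  have -> : \sum_a algC (c' a) * (xi z ^+ k * monomial a) =
      xi z ^+ k * \sum_a algC (c' a) * monomial a.
    by rewrite mulr_sumr; apply: eq_bigr => a _; rewrite mulrA algC_comm -mulrA.
  rewrite !mulrDr mulrA -exprSr -!addrA; do 3!congr (_ + _).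
  by rewrite addrC.
(* At this exponent the remainder falls into the ideal, since the power of [xi z] is a combination
   of earlier generators. *)
have [r [x [c [hr hb]]]] := step (height z).
exists (r + xi z ^+ height z * x).
  by apply: right_ideal_add => //; exact/right_idealMr/right_ideal_span/(xi_height e).
exists (fun a : mindex (z :: suf) => c a.1 a.2); rewrite {1}hb [_ + \sum_(_ < _) _]addrC addrK.
by rewrite pair_big; apply: eq_bigr => -[i a] _.
Qed.

Lemma monomial_spanning b : mono_span its b.
Proof.
have [r hr] := monomial_spanning_rel (pre := [::]) erefl b.
by case: hr => [|z ? ? //]; rewrite subr0.
Qed.

End Spanning.

(** * Common kernels of initial segments *)

Section Action.
Hypothesis height_gt0 : forall z, (0 < height z)%N.
Variables (V : zmodType) (op : B -> V -> V).
Hypotheses (opDl : forall a b v, op (a + b) v = op a v + op b v)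
  (opDr : forall a u v, op a (u + v) = op a u + op a v)
  (opM : forall a b v, op (a * b) v = op a (op b v)) (op1 : forall v, op 1 v = v).
Implicit Types (u v x : V).

(** Signs are negations because [V] is only a [zmodType] on which [B] acts through [op]; this covers
    [B] itself, [A] along a morphism, and a supermodule. *)
Definition sgv (e : bool) v := if e then - v else v.

Lemma sgv_add e e' v : sgv e (sgv e' v) = sgv (e (+) e') v.
Proof. by case: e e' => [] []; rewrite /= ?opprK. Qed.

Lemma op0r a : op a 0 = 0.
Proof. by apply: (addrI (op a 0)); rewrite -opDr !addr0. Qed.
Lemma op0l v : op 0 v = 0.
Proof. by apply: (addrI (op 0 v)); rewrite -opDl !addr0. Qed.
Lemma opNr a v : op a (- v) = - op a v.
Proof. by apply: (addrI (op a v)); rewrite -opDr !subrr op0r. Qed.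
Lemma opNl a v : op (- a) v = - op a v.
Proof. by apply: (addrI (op a v)); rewrite -opDl !subrr op0l. Qed.
Lemma op_sg a e v : op a (sgv e v) = sgv e (op a v).
Proof. by case: e => //=; rewrite opNr. Qed.
Lemma op_sum a (I : finType) (F : I -> V) : op a (\sum_i F i) = \sum_i op a (F i).
Proof. by apply: big_morph; [exact: opDr|exact: op0r]. Qed.

Definition killed pre v := forall z, z \in pre -> op (xi z) v = 0.

Lemma killed0 pre : killed pre 0. Proof. by move=> z _; rewrite op0r. Qed.
Lemma killedD pre u v : killed pre u -> killed pre v -> killed pre (u + v).
Proof. by move=> hu hv z zp; rewrite opDr hu ?hv ?addr0. Qed.
Lemma killed_sg pre e v : killed pre v -> killed pre (sgv e v).
Proof. by move=> hv z zp; rewrite op_sg hv //; case: e; rewrite /= ?oppr0. Qed.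
Lemma killed_sum pre (I : finType) (F : I -> V) :
  (forall i, killed pre (F i)) -> killed pre (\sum_i F i).
Proof.
by move=> h; apply: (big_ind (killed pre)) => //; [exact: killed0|exact: killedD].
Qed.

Lemma killed_span pre r v : lin_span pre r -> killed pre v -> op r v = 0.
Proof.
move=> + hv; apply: (@lin_span_ind_add _ (fun r => op r v = 0)) => [|a b ha hb|c z zp].
- exact: op0l.
- by rewrite opDl ha hb addr0.
- by rewrite opM hv // op0r.
Qed.

Lemma op_comm pre z suf z' v : its = pre ++ z :: suf -> z' \in its -> killed pre v ->
  op (xi z') (op (xi z) v) = sgv (odd_gen z' && odd_gen z) (op (xi z) (op (xi z') v)).
Proof.
move=> e z'i hv; have := killed_span (xi_comm e z'i) hv.
rewrite opDl opNl -!opM => /eqP; rewrite subr_eq0 => /eqP ->.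
by case: (_ && _); rewrite /= ?expr1 ?mulN1r ?opNl // mul1r.
Qed.

(** For [l] in [pre], exchanging [xi l] and [xi z] has an error made of generators before [l], and
    these kill [v] as well. *)
Lemma killed_op pre suf z v : its = pre ++ suf -> z \in its -> killed pre v ->
  killed pre (op (xi z) v).
Proof.
move=> e zi hv l lp; case/path.splitPr: lp e hv => p1 p2 e hv.
rewrite -catA cat_cons in e.
have hv1 : killed p1 v by move=> y yp; apply: hv; rewrite mem_cat yp.
have := op_comm e zi hv1; rewrite (hv l) ?mem_cat ?mem_head ?orbT // op0r.
by case: (_ && _) => /= /eqP; rewrite eq_sym ?oppr_eq0 => /eqP.
Qed.

Lemma killed_opX pre suf z v k : its = pre ++ suf -> z \in its -> killed pre v ->
  killed pre (op (xi z ^+ k) v).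
Proof.
move=> e zi hv; elim: k => [|k IH]; first by rewrite expr0 op1.
by rewrite exprS opM; exact: killed_op e zi IH.
Qed.

Lemma killed_monomial pre suf l v (a : mindex l) : its = pre ++ suf -> {subset l <= its} ->
  killed pre v -> killed pre (op (monomial a) v).
Proof.
move=> e + hv; elim: l a => [|z l IH] a sl /=; first by rewrite op1.
rewrite opM; apply: killed_opX e _ _; first by rewrite sl ?mem_head.
by apply: IH => y yl; rewrite sl // inE yl orbT.
Qed.

Lemma op_commX pre z suf z' v k : its = pre ++ z :: suf -> z' \in its -> killed pre v ->
  op (xi z') (op (xi z ^+ k) v) =
  sgv (odd_gen z && odd k && odd_gen z') (op (xi z ^+ k) (op (xi z') v)).
Proof.
move=> e z'i hv; have zi : z \in its by rewrite e mem_cat mem_head orbT.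
elim: k => [|k IH]; first by rewrite expr0 !op1 andbF.
rewrite exprS !opM (op_comm e z'i) ?IH; last exact: killed_opX e zi hv.
rewrite op_sg sgv_add; congr (sgv _ _); rewrite /=.
by case: (odd k) (odd_gen z) (odd_gen z') => [] [] [].
Qed.

Lemma op_commXX pre z suf z' v k j : its = pre ++ z :: suf -> z' \in its -> killed pre v ->
  op (xi z' ^+ j) (op (xi z ^+ k) v) =
  sgv (odd_gen z && odd k && (odd_gen z' && odd j)) (op (xi z ^+ k) (op (xi z' ^+ j) v)).
Proof.
move=> e z'i hv; elim: j => [|j IH]; first by rewrite expr0 !op1 !andbF.
rewrite exprS !opM IH op_sg (op_commX _ e z'i); last exact: killed_opX e z'i hv.
rewrite sgv_add; congr (sgv _ _); rewrite /=.
by case: (odd k) (odd j) (odd_gen z) (odd_gen z') => [] [] [] [].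
Qed.

Lemma op_comm_monomial pre z suf l v k (a : mindex l) : its = pre ++ z :: suf ->
  {subset l <= its} -> killed pre v ->
  op (monomial a) (op (xi z ^+ k) v) =
  sgv (odd_gen z && odd k && mparity a) (op (xi z ^+ k) (op (monomial a) v)).
Proof.
move=> e + hv; elim: l a => [|z' l IH] a sl /=; first by rewrite !op1 andbF.
have sl' : {subset l <= its} by move=> y yl; rewrite sl // inE yl orbT.
rewrite !opM IH // op_sg (op_commXX _ _ e) ?sl ?mem_head //; last exact: killed_monomial e _ _.
by rewrite sgv_add; congr (sgv _ _); case: (_ && odd k) => //=; rewrite addbC.
Qed.

(** Inside the kernel of [pre], the next factor [xi z ^+ (height z).-1] stays in that kernel, and
    one more [xi z] completes the power that is a combination of generators in [pre]. *)
Lemma killed_mtop pre suf v : its = pre ++ suf -> killed pre (op (mtop pre) v).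
Proof.
elim/last_ind: pre suf v => [|pre z IH] suf v e; first by [].
rewrite cat_rcons in e; have zi : z \in its by rewrite e mem_cat mem_head orbT.
have hk := IH _ v e; rewrite mtop_rcons opM => y.
rewrite mem_rcons inE => /orP[/eqP ->|]; last exact: (killed_opX _ e zi hk).
by rewrite -opM -exprS prednK // (killed_span (xi_height e)).
Qed.

Section Step.
Variables (pre suf : seq T) (z : T) (Z : V -> Prop).
Hypotheses (e : its = pre ++ z :: suf) (Z0 : Z 0) (ZD : forall x y, Z x -> Z y -> Z (x + y))
  (Zkilled : forall x, Z x -> killed pre x)
  (Zsurj : forall v, killed (rcons pre z) v -> exists2 x, Z x & v = op (xi z ^+ (height z).-1) x)
  (Zinj : forall x, Z x -> op (xi z ^+ (height z).-1) x = 0 -> x = 0).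

(** Induction on the order of nilpotency of [xi z] at [v]: if the power k + 1 kills [v], then
    [xi z ^+ k] sends [v] into the next kernel, to some [xi z ^+ (height z).-1] of [x] in [Z];
    subtracting [xi z ^+ ((height z).-1 - k)] of [x] lowers the order. *)
Lemma free_step_ex v : killed pre v -> exists2 c : nat -> V, forall a, Z (c a) &
  v = \sum_(a < height z) op (xi z ^+ a) (c a).
Proof.
have zi : z \in its by rewrite e mem_cat mem_head orbT.
suff h k : (k <= height z)%N -> forall v, killed pre v -> op (xi z ^+ k) v = 0 ->
    exists2 c : nat -> V, forall a, Z (c a) & v = \sum_(a < height z) op (xi z ^+ a) (c a).
  by move=> hv; apply: (h (height z)) => //; exact: killed_span (xi_height e) hv.
elim: k => [_ {}v _|k IH kh {}v hv v0].
  rewrite expr0 op1 => ->; exists (fun=> 0) => //.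
  by rewrite big1 // => a _; rewrite op0r.
have [|x Zx xE] := @Zsurj (op (xi z ^+ k) v).
  move=> y; rewrite mem_rcons inE => /orP[/eqP ->|]; first by rewrite -opM -exprS.
  exact: (killed_opX _ e zi hv).
pose m := ((height z).-1 - k)%N; have mh : (m < height z)%N by rewrite /m; lia.
have [||c Zc cE] := IH (ltnW kh) (v - op (xi z ^+ m) x).
- rewrite -opNr; apply: killedD => //; apply: killed_opX e zi _.
  by rewrite -[- x]/(sgv true x); apply/killed_sg/Zkilled.
- rewrite opDr opNr -opM -exprD xE (_ : (k + m)%N = (height z).-1) ?subrr //.
  by rewrite /m; lia.
exists (fun a => c a + (if a == m then x else 0)) => [a|].
  by apply: ZD => //; case: eqP.
rewrite (eq_bigr (fun a : 'I_(height z) => op (xi z ^+ a) (c a) +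
    (if a == Ordinal mh then op (xi z ^+ m) x else 0))) => [|a _].
  by rewrite big_split /= -cE -big_mkcond big_pred1_eq subrK.
by rewrite opDr -val_eqE /=; case: eqP => [->|_]; rewrite ?op0r.
Qed.

(** Once the coefficients below a vanish, multiplication by [xi z ^+ ((height z).-1 - a)] isolates
    [c a]: the higher terms acquire a power of at least [height z]. *)
Lemma free_step_uniq (c : nat -> V) : (forall a, Z (c a)) ->
  \sum_(a < height z) op (xi z ^+ a) (c a) = 0 -> forall a, (a < height z)%N -> c a = 0.
Proof.
move=> Zc s0; elim/ltn_ind => a IH ah; apply: Zinj => //.
have := congr1 (op (xi z ^+ ((height z).-1 - a)%N)) s0.
rewrite op_sum op0r (bigD1 (Ordinal ah)) //= big1 ?addr0 => [|j ja].
  by rewrite -opM -exprD subnK //; lia.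
case: (ltngtP j a) => [ja'|aj|/eqP]; last by move: ja; rewrite -val_eqE /= => /negPf ->.
  by rewrite IH ?op0r.
rewrite -opM -exprD.
have -> : ((height z).-1 - a + j)%N = ((j - a).-1 + height z)%N by have := ltn_ord j; lia.
rewrite exprD opM (killed_span (xi_height e)) ?op0r //; exact: Zkilled.
Qed.
End Step.

Variable tau : {additive V -> V}.
Hypothesis tauK : forall w : V, killed its w -> op (mtop its) (tau w) = w.

(* By the case of one nilpotent operator, each ker(xi_1, .., xi_i) is free over
   K[xi_(i+1)] as soon as xi_(i+1)^(h-1) maps onto the next kernel. *)
Lemma killed_free suf pre : its = pre ++ suf ->
  (forall v, killed pre v -> exists2 w : mindex suf -> V, forall a, killed its (w a) &
     v = \sum_a op (monomial a) (op (mtop pre) (tau (w a)))) /\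
  (forall w : mindex suf -> V, (forall a, killed its (w a)) ->
     \sum_a op (monomial a) (op (mtop pre) (tau (w a))) = 0 -> forall a, w a = 0).
Proof.
elim: suf pre => [|z suf IH] pre e.
  rewrite cats0 in e; rewrite -e; split=> [v hv|w hw].
    exists (fun=> v) => //; rewrite (big_pred1 tt) => [|[]//].
    by rewrite /= op1 tauK.
  by rewrite (big_pred1 tt) => [|[]//]; rewrite /= op1 tauK // => h [].
have zi : z \in its by rewrite e mem_cat mem_head orbT.
have [|IHex IHu] := IH (rcons pre z); first by rewrite cat_rcons.
have ssuf : {subset suf <= its} by move=> y ys; rewrite e mem_cat inE ys !orbT.
pose S (w : mindex suf -> V) := \sum_a op (monomial a) (op (mtop pre) (tau (w a))).
pose Z x := exists2 w, forall a, killed its (w a) & x = S w.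
(* The sign from moving the top power of [xi z] past the monomial; it is absorbed into the
   coefficient [w a]. *)
pose g (a : mindex suf) := odd_gen z && odd (height z).-1 && mparity a.
have topS w : op (xi z ^+ (height z).-1) (S w) =
    \sum_a op (monomial a) (op (mtop (rcons pre z)) (tau (sgv (g a) (w a)))).
  rewrite op_sum; apply: eq_bigr => a _; rewrite mtop_rcons opM.
  rewrite (op_comm_monomial _ _ e) //; last exact: killed_mtop e.
  rewrite -/(g a); case: (g a) => //=; by rewrite raddfN !opNr opprK.
have Z0 : Z 0.
  by exists (fun=> 0) => [a|]; [exact: killed0|rewrite /S big1 // => a _; rewrite raddf0 !op0r].
have ZD x y : Z x -> Z y -> Z (x + y).
  move=> [w hw ->] [w' hw' ->]; exists (fun a => w a + w' a) => [a|]; first exact: killedD.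
  by rewrite /S -big_split; apply: eq_bigr => a _; rewrite raddfD !opDr.
have Zk x : Z x -> killed pre x.
  move=> [w hw ->]; apply: killed_sum => a; apply: (killed_monomial _ e ssuf).
  exact: killed_mtop e.
have Zs v : killed (rcons pre z) v -> exists2 x, Z x & v = op (xi z ^+ (height z).-1) x.
  move=> /IHex[w hw ->]; exists (S (fun a => sgv (g a) (w a))).
    by exists (fun a => sgv (g a) (w a)) => // a; exact: killed_sg.
  by rewrite topS; apply: eq_bigr => a _; rewrite sgv_add addbb.
have Si w : (forall a, killed its (w a)) -> op (xi z ^+ (height z).-1) (S w) = 0 ->
    forall a, w a = 0.
  move=> hw; rewrite topS => /IHu h a.
  have {h} := h (fun a => killed_sg _ (hw a)) a.
  by case: (g a) => //= /eqP; rewrite oppr_eq0 => /eqP.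
have Zi x : Z x -> op (xi z ^+ (height z).-1) x = 0 -> x = 0.
  move=> [w hw ->] /Si h; rewrite /S big1 // => a _.
  by rewrite h // raddf0 !op0r.
have sumE (w : 'I_(height z) -> mindex suf -> V) :
    \sum_(a : mindex (z :: suf)) op (monomial a) (op (mtop pre) (tau (w a.1 a.2))) =
    \sum_(i < height z) op (xi z ^+ i) (S (w i)).
  under [RHS]eq_bigr do rewrite op_sum.
  by rewrite pair_bigA; apply: eq_bigr => -[i a] _; rewrite /= opM.
split=> [v hv|w hw].
  have [c Zc ->] := free_step_ex e Z0 ZD Zk Zs hv.
  have /choice[f hf] a : exists w, (forall b, killed its (w b)) /\ c a = S w.
    by have [w] := Zc a; exists w.
  exists (fun a : mindex (z :: suf) => f a.1 a.2) => [a|]; first by case: (hf a.1).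
  by rewrite (sumE (fun i => f i)); apply: eq_bigr => i _; case: (hf i) => _ ->.
(* [free_step_uniq] takes coefficients indexed by [nat], hence the extension by 0 beyond
   [height z]. *)
pose w' (i : nat) a := if insub i is Some o then w (o, a) else 0.
have w'E (i : 'I_(height z)) : w' i = fun a => w (i, a) by rewrite /w' valK.
have hw' i a : killed its (w' i a).
  by rewrite /w'; case: insubP => [o _ _|_]; [exact: hw|exact: killed0].
rewrite (eq_bigr (fun a : mindex (z :: suf) =>
    op (monomial a) (op (mtop pre) (tau (w' (a.1 : 'I__) a.2))))); last first.
  by move=> [i a] _; rewrite w'E.
rewrite (sumE (fun i => w' i)) => s0 [i a].
have c0 := free_step_uniq e Zk Zi (fun i => ex_intro2 _ _ (w' i) (hw' i) erefl) s0 (ltn_ord i).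
have := @Si (w' i) (hw' i); rewrite [S _]c0 op0r => /(_ erefl a).
by rewrite w'E.
Qed.
End Action.
End Triangular.

(** * Graded Lie superalgebras of type q(n) *)

Section Graded.
Variables (K : fieldType) (n : nat).
Local Notation M := 'M[K]_n.
Variables (wt : 'I_n -> int) (J : M).
Implicit Types (A B : M) (b : bool) (k l : int).

Definition has_deg k A := forall i j, A i j != 0 -> wt i - wt j = k.

(** This is chi in Jordan coordinates: the product of the odd element X with an odd element is even,
    so its otr is the trace of a zero block. *)
Definition chib b A : K := if b then 0 else \tr (J * A).

Lemma has_degD k A B : has_deg k A -> has_deg k B -> has_deg k (A + B).
Proof.
move=> hA hB i j; rewrite mxE; case: (eqVneq (A i j) 0) => [->|/hA//].
by rewrite add0r => /hB.
Qed.

Lemma has_degZ k c A : has_deg k A -> has_deg k (c *: A).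
Proof. by move=> hA i j; rewrite mxE mulf_eq0 negb_or => /andP[_ /hA]. Qed.

Lemma has_degM k l A B : has_deg k A -> has_deg l B -> has_deg (k + l) (A * B).
Proof.
move=> hA hB i j; rewrite mxE => h.
have [m /andP[/hA <- /hB <-]] : exists m, (A i m != 0) && (B m j != 0).
  apply/existsP; apply: contraNT h; rewrite negb_exists => /forallP h.
  apply/eqP; apply: big1 => m _; apply/eqP; rewrite mulf_eq0.
  by have := h m; rewrite negb_and !negbK.
by rewrite addrA subrK.
Qed.

Lemma has_degX k A e : has_deg k A -> (0 < e)%N -> has_deg (k *+ e) (A ^+ e).
Proof.
move=> hA; case: e => // e _; elim: e => [|e IH] //.
by rewrite exprS mulrS; exact: has_degM.
Qed.

Lemma has_deg_br k l b b' A B :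
  has_deg k A -> has_deg l B -> has_deg (k + l) (sbracket b b' A B).
Proof.
move=> hA hB; apply: has_degD; first exact: has_degM.
by rewrite -scaleNr addrC; apply/has_degZ/has_degM.
Qed.

Fact chib_linear b : scalar (chib b).
Proof.
case: b => c A B; rewrite /chib ?mulr0 ?addr0 //.
by rewrite mulrDr raddfD /= -[J * (c *: A)]scalemxAr mxtraceZ.
Qed.
HB.instance Definition _ b := GRing.isLinear.Build K M K *%R (chib b) (chib_linear b).

(** [J] has degree 2 and a trace sees only degree 0, so chi lives in degree -2. *)
Lemma chib_deg b k A : has_deg 2 J -> has_deg k A -> k != -2 -> chib b A = 0.
Proof.
move=> hJ hA hk; case: b => //; rewrite /chib /mxtrace big1 // => i _.
apply/eqP; apply: contraNT hk => /(has_degM hJ hA); rewrite subrr => h.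
by apply/eqP; lia.
Qed.

(* An item (b, k, x, y) records a basis vector x of m of parity b and degree -k,
   with a vector y of parity b and degree k - 2 such that chi([x, y]) = 1. *)
Definition item := (bool * nat * M * M)%type.
Definition ib (z : item) : bool := z.1.1.1.
Definition ik (z : item) : nat := z.1.1.2.
Definition ix (z : item) : M := z.1.2.
Definition iy (z : item) : M := z.2.

Definition ipair (z z' : item) : K :=
  chib (ib z (+) ib z') (sbracket (ib z) (ib z') (ix z) (iy z')).

(** In degrees below -1 all of gl(n)(-k) belongs to m, hence the bound in [ad_span]; in degree -1
    only the isotropic subspace does. [ad_pw] combines the order by degree with triangularity of the
    pairing, and [ad_iso] says that chi is a character of m. *)
Record adapted (its : seq item) : Prop := Adapted {
  ad_pos : forall z, z \in its -> (0 < ik z)%N;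
  ad_x : forall z, z \in its -> has_deg (- (ik z)%:Z) (ix z);
  ad_y : forall z, z \in its -> has_deg ((ik z)%:Z - 2) (iy z);
  ad_pw : pairwise (fun z z' => (ik z' <= ik z)%N && (ipair z z' == 0)) its;
  ad_diag : forall z, z \in its -> ipair z z = 1;
  ad_iso : forall z z', z \in its -> z' \in its ->
    chib (ib z (+) ib z') (sbracket (ib z) (ib z') (ix z) (ix z')) = 0;
  ad_span : forall b (k : nat) A, (1 < k)%N -> has_deg (- k%:Z) A ->
    A \in <<[seq ix z | z <- its & (ib z == b) && (ik z == k)]>>%VS }.

Lemma pairwise_suffix (T : eqType) (R : rel T) (s s1 s2 : seq T) x y :
  pairwise R s -> s = s1 ++ x :: s2 -> y \in s2 -> R x y.
Proof.
move=> h e; move: h; rewrite e pairwise_cat pairwise_cons => /and3P[_ _ /andP[/allP h _]].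
exact: h.
Qed.

Lemma ad_span_pre its pre z suf b (k : nat) A : adapted its -> its = pre ++ z :: suf ->
  (1 < k)%N -> (ik z < k)%N -> has_deg (- k%:Z) A ->
  A \in <<[seq ix y | y <- pre & (ib y == b)]>>%VS.
Proof.
move=> ad e k1 kz /(ad_span ad b k1); apply/subvP/sub_span => _ /mapP[y + ->].
rewrite mem_filter => /andP[/andP[yb /eqP yk] yits]; apply/map_f.
rewrite mem_filter yb /=; move: yits; rewrite e mem_cat => /orP[//|].
rewrite inE => /orP[/eqP yz|/(pairwise_suffix (ad_pw ad) e)/andP[+ _]].
  by move: kz; rewrite -yz yk ltnn.
by rewrite yk leqNgt kz.
Qed.
End Graded.

(** * Generators shifted by chi *)

Section Shift.
Variables (K : fieldType) (n : nat).
Local Notation M := 'M[K]_n.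
Variables (J : M) (R : pzAlgType K) (rho : bool -> M -> R).
Hypothesis rho_lin : forall b c x y, rho b (c *: x + y) = algC c * rho b x + rho b y.

Definition shifted b x : R := rho b x - algC (chib J b x).

Lemma shifted_lin b c x y :
  shifted b (c *: x + y) = algC c * shifted b x + shifted b y.
Proof.
rewrite /shifted rho_lin linearP /= rmorphD rmorphM mulrBr opprD.
by rewrite -!addrA; congr (_ + _); rewrite addrCA.
Qed.

Lemma shifted0 b : shifted b 0 = 0.
Proof.
apply: (addIr (shifted b 0)); rewrite add0r.
by have := shifted_lin b 1 0 0; rewrite scaler0 addr0 rmorph1 mul1r => <-.
Qed.

Lemma shifted_span (P : R -> Prop) b (s : seq M) A :
  P 0 -> (forall c x r, x \in s -> P r -> P (algC c * shifted b x + r)) ->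
  A \in <<s>>%VS -> P (shifted b A).
Proof.
move=> P0 PD; elim: s PD A => [|x s IH] PD A.
  by rewrite span_nil memv0 => /eqP ->; rewrite shifted0.
rewrite span_cons => /memv_addP[_ /vlineP[c ->] [y ys ->]].
rewrite shifted_lin; apply: (PD); first exact: mem_head.
by apply: IH => // c' x' r x's; apply: PD; rewrite inE x's orbT.
Qed.

Lemma rho_shifted b x : rho b x = shifted b x + algC (chib J b x).
Proof. by rewrite subrK. Qed.

Lemma central_comm (c : K) (x y : R) : (x - algC c) * y - y * (x - algC c) = x * y - y * x.
Proof. by rewrite mulrBl mulrBr algC_comm opprB addrA subrK. Qed.

(* If x and y are odd then chi vanishes on them, otherwise the commutator is the
   usual one and scalars are central. *)
Lemma shifted_comm b b' x y :
  shifted b x * shifted b' y - (-1) ^+ (b && b') * (shifted b' y * shifted b x) =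
  rho b x * rho b' y - (-1) ^+ (b && b') * (rho b' y * rho b x).
Proof.
have [/andP[-> ->]|_] := boolP (b && b'); first by rewrite /shifted rmorph0 !subr0.
by rewrite expr0 !mul1r central_comm -opprB central_comm opprB.
Qed.
End Shift.

(** Frobenius additivity in a form that allows the zero ring, since 1 = 0 is not excluded for an
    algebra given by relations. *)
Lemma exprD_prime_comm (R : pzRingType) (p : nat) (x y : R) : prime p -> p%:R = 0 :> R ->
  GRing.comm x y -> (x + y) ^+ p = x ^+ p + y ^+ p.
Proof.
case: p => [|[|p]] // pp p0 cxy; rewrite exprDn_comm // big_ord_recl big_ord_recr /=.
rewrite bin0 !expr0 !subn0 /bump /= add1n subnn binn !mulr1n mulr1 mul1r.
rewrite big1 ?add0r // => i _; rewrite /bump /= add1n.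
have /dvdnP[q ->] : (p.+2 %| 'C(p.+2, i.+1))%N.
  by apply: prime_dvd_bin => //=; rewrite ltnS ltn_ord.
by rewrite -mulr_natr natrM p0 !mulr0.
Qed.

Section Reduced.
Variables (K : fieldType) (n p : nat).
Local Notation M := 'M[K]_n.
Variables (wt : 'I_n -> int) (J : M).
Local Notation item := (item K n).
Variable its : seq item.
Hypothesis ad : adapted wt J its.
Variables (B : pzAlgType K) (rho : bool -> M -> B).
Hypothesis rho_lin : forall b c x y, rho b (c *: x + y) = algC c * rho b x + rho b y.
Hypothesis rho_br : forall z z', z \in its -> z' \in its ->
  rho (ib z) (ix z) * rho (ib z') (ix z')
    - (-1) ^+ (ib z && ib z') * (rho (ib z') (ix z') * rho (ib z) (ix z))
  = rho (ib z (+) ib z') (sbracket (ib z) (ib z') (ix z) (ix z')).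
Implicit Types (z : item) (pre suf : seq item) (r : B).

Definition xi z : B := shifted J rho (ib z) (ix z).
Definition height z : nat := if ib z then 2 else p.

Lemma lin_span_of_span pre b A :
  A \in <<[seq ix y | y <- pre & ib y == b]>>%VS -> lin_span xi pre (shifted J rho b A).
Proof.
apply: shifted_span => [//||c x r + hr]; first exact: lin_span0.
by case/mapP=> y; rewrite mem_filter => /andP[/eqP <- yp] ->; apply: lin_spanD.
Qed.

Lemma lin_span_deg pre z suf b (k : nat) A : its = pre ++ z :: suf ->
  (1 < k)%N -> (ik z < k)%N -> has_deg wt (- k%:Z) A -> lin_span xi pre (shifted J rho b A).
Proof. move=> e k1 kz hA; apply: lin_span_of_span; exact: ad_span_pre ad e k1 kz hA. Qed.

Lemma mem_mid z pre suf : its = pre ++ z :: suf -> z \in its.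
Proof. by move=> ->; rewrite mem_cat mem_head orbT. Qed.

(** chi vanishes on the bracket by [ad_iso], and the degree of the bracket is strictly below that of
    [z], where the basis vectors all come before [z]. *)
Lemma xi_comm pre z suf z' : its = pre ++ z :: suf -> z' \in its ->
  lin_span xi pre (xi z' * xi z - (-1) ^+ (ib z' && ib z) * (xi z * xi z')).
Proof.
move=> e z'i; have zi := mem_mid e.
rewrite shifted_comm rho_br // (rho_shifted J) (ad_iso ad) // rmorph0 addr0.
have zk := ad_pos ad zi; have zk' := ad_pos ad z'i.
apply: (lin_span_deg (k := (ik z' + ik z)%N) _ e); [by lia|by lia|].
by rewrite PoszD opprD; apply: has_deg_br; apply: (ad_x ad).
Qed.

Hypotheses (charK : p \in [pchar K]) (p_gt2 : (2 < p)%N) (hJ : has_deg wt 2 J).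
Hypothesis rho_pow : forall z, z \in its -> ib z = false ->
  rho false (ix z) ^+ p = rho false (ix z ^+ p) + algC (chib J false (ix z) ^+ p).

(** For odd [z] the square is half the bracket of [xi z] with itself. For even [z], (x - chi(x))^p
    is the generator of x^p, of degree -pk; as pk > 2, chi vanishes there. *)
Lemma xi_height pre z suf : its = pre ++ z :: suf -> lin_span xi pre (xi z ^+ height z).
Proof.
move=> e; have zi := mem_mid e; rewrite /height; case: ifPn => [zb|/negbTE zb].
  have := xi_comm e zi; rewrite zb andbb expr1 mulN1r opprK -mulr2n -expr2.
  move=> /(lin_spanZ (2%:R^-1)); rewrite -[xi z ^+ 2 *+ 2]mulr_natl mulrA.
  rewrite -(rmorph_nat algC 2) -rmorphM mulVf.
    by rewrite rmorph1 mul1r.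
  by rewrite -(dvdn_pcharf charK) gtnNdvd.
have -> : xi z = rho false (ix z) + algC (- chib J false (ix z)).
  by rewrite rmorphN /xi zb.
rewrite exprD_prime_comm ?(pcharf_prime charK) //; last 2 first.
- by rewrite -(rmorph_nat algC) (pcharf0 charK) rmorph0.
- by rewrite /GRing.comm algC_comm.
rewrite rho_pow // -addrA -(rmorphXn algC) -(rmorphD algC) -[(- _) ^+ p]/(pFrobenius_aut charK _).
rewrite pFrobenius_autN subrr rmorph0 addr0 (rho_shifted J).
have h : has_deg wt (- (p * ik z)%:Z) (ix z ^+ p).
  have -> : - (p * ik z)%:Z = (- (ik z)%:Z) *+ p by rewrite -mulr_natl; lia.
  by apply: has_degX; [exact: ad_x ad _ zi|lia].
have zk := ad_pos ad zi.
rewrite (chib_deg _ hJ h) ?rmorph0 ?addr0; last by apply/eqP; nia.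
apply: (lin_span_deg _ e _ _ h); nia.
Qed.
End Reduced.

(** * The Kazhdan filtration *)

Section Kazhdan.
Variables (K : fieldType) (n p : nat).
Local Notation M := 'M[K]_n.
Variables (wt : 'I_n -> int) (J : M).
Hypotheses (charK : p \in [pchar K]) (hJ : has_deg wt 2 J).
Local Notation item := (item K n).
Variable its : seq item.
Hypothesis ad : adapted wt J its.
Variables (A : pzAlgType K) (rho : bool -> M -> A).
Hypothesis rho_lin : forall b c x y, rho b (c *: x + y) = algC c * rho b x + rho b y.
Hypothesis rho_br : forall b b' x y,
  rho b x * rho b' y - (-1) ^+ (b && b') * (rho b' y * rho b x)
  = rho (b (+) b') (sbracket b b' x y).

Definition kaz_tail : A :=
  \prod_(z <- its) rho (ib z) (iy z) ^+ (height p z).-1.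
Definition kaz_const : K := \prod_(z <- its) ((height p z).-1`!)%:R.

Section Module.
Variables (V : lmodType A) (w : V).
Hypothesis killed_w : forall z, z \in its -> xi J rho z *: w = 0.

(* Elements u_1 ... u_m w with u_i of degree d_i >= -1 and sum_i (d_i + 2) <= r. *)
Inductive kaz : int -> V -> Prop :=
| kaz0 r : kaz r 0
| kazC r c : 0 <= r -> kaz r (algC c *: w)
| kazD r u v : kaz r u -> kaz r v -> kaz r (u + v)
| kazM r r' b d x v : has_deg wt d x -> -1 <= d -> kaz r v -> r + d + 2 <= r' ->
    kaz r' (rho b x *: v).

Lemma kaz_le r r' v : r <= r' -> kaz r v -> kaz r' v.
Proof.
move=> + h; elim: h r' => {r v} [r|r c r0|r u v _ hu _ hv|r r1 b d x v hx hd hv _ h] r' le.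
- exact: kaz0.
- by apply: kazC; lia.
- by apply: kazD; [exact: hu|exact: hv].
- by apply: (kazM _ hx hd hv); lia.
Qed.

Lemma kaz_lt0 r v : r < 0 -> kaz r v -> v = 0.
Proof.
move=> + h; elim: h => {r v} [//|r c r0|r u v _ hu _ hv|r r1 b d x v hx hd _ hv h] lt.
- by lia.
- by rewrite hu ?hv ?addr0.
- by rewrite hv ?scaler0 //; lia.
Qed.

Lemma kazZ c r v : kaz r v -> kaz r (algC c *: v).
Proof.
elim=> {r v} [r|r c' r0|r u v _ hu _ hv|r r1 b d x v hx hd _ hv h].
- by rewrite scaler0; exact: kaz0.
- by rewrite scalerA -rmorphM; exact: kazC.
- by rewrite scalerDr; exact: kazD.
- by rewrite scalerA algC_comm -scalerA; exact: kazM hx hd hv h.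
Qed.

Lemma kazN r v : kaz r v -> kaz r (- v).
Proof. by move=> /(kazZ (-1)); rewrite rmorphN1 scaleN1r. Qed.

Lemma rho_swap b b' x y (v : V) : rho b x *: (rho b' y *: v) =
  ((-1) ^+ (b && b') * rho b' y) *: (rho b x *: v) + rho (b (+) b') (sbracket b b' x y) *: v.
Proof. by rewrite -rho_br scalerBl !scalerA mulrA [RHS]addrC subrK. Qed.

Local Notation sh := (shifted J rho).

Lemma sh_swap b b' x y (v : V) : sh b x *: (rho b' y *: v) =
  ((-1) ^+ (b && b') * rho b' y) *: (sh b x *: v) + rho (b (+) b') (sbracket b b' x y) *: v.
Proof.
rewrite /shifted scalerBl rho_swap scalerBl scalerBr [RHS]addrAC; congr (_ - _).
rewrite !scalerA.
by case: b; rewrite ?rmorph0 ?mulr0 ?mul0r // mul1r algC_comm.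
Qed.

Lemma sh_deg_w b (k : nat) x : (1 < k)%N -> has_deg wt (- k%:Z) x -> sh b x *: w = 0.
Proof.
move=> k1 /(ad_span ad b k1).
apply: (shifted_span rho_lin (P := fun r => r *: w = 0)) => [|c _ r /mapP[z + ->] hr].
  by rewrite scale0r.
rewrite mem_filter => /andP[/andP[/eqP <- _] /killed_w hz].
by rewrite scalerDl hr -scalerA hz scaler0 addr0.
Qed.

(** Passing a letter of degree d replaces it by a bracket of degree d - k. If this is at least -1,
    the bracket is a letter of weight k less. Otherwise it is a shifted element, which goes further
    down, plus a scalar that is nonzero only for k = d + 2, when dropping the letter loses exactly
    k. *)
Lemma kaz_sh b (k : int) x r v : 1 <= k -> has_deg wt (- k) x -> sh b x *: w = 0 ->
  kaz r v -> kaz (r - k) (sh b x *: v).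
Proof.
move=> k1 hx xw h; elim: h b k x k1 hx xw => {r v}
  [r|r c r0|r u v _ hu _ hv|r r1 b' d y v hy hd kv hv hr] b k x k1 hx xw.
- by rewrite scaler0; exact: kaz0.
- by rewrite scalerA -algC_comm -scalerA xw scaler0; exact: kaz0.
- by rewrite scalerDr; apply: kazD; [exact: hu|exact: hv].
rewrite sh_swap; apply: kazD.
  rewrite -scalerA; case: (b && b') => /=; rewrite ?expr1 ?scaleN1r ?expr0 ?scale1r.
    by apply/kazN; apply: (kazM _ hy hd (hv _ _ _ k1 hx xw)); lia.
  by apply: (kazM _ hy hd (hv _ _ _ k1 hx xw)); lia.
have hbr := has_deg_br (b := b) (b' := b') hx hy.
have [dk|dk] := lerP (-1) (d - k).
  by apply: (kazM (d := d - k) _ _ _ kv); [by rewrite addrC|by []|lia].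
have [m mE] : exists m : nat, k - d = m%:Z by exists `|k - d|%N; lia.
have hbr' : has_deg wt (- m%:Z) (sbracket b b' x y).
  by have -> : - m%:Z = - k + d by lia.
rewrite (rho_shifted J) scalerDl; apply: kazD.
  apply: (@kaz_le (r - m%:Z)); first by lia.
  by apply: hv => //; [lia|apply: (sh_deg_w _ _ hbr'); lia].
apply: (@kaz_le (if m == 2 then r else r1 - k)); first by case: eqP => hm; lia.
case: eqP => [_|hm]; first exact: kazZ.
by rewrite (chib_deg _ hJ hbr') ?rmorph0 ?scale0r; [exact: kaz0|apply/eqP; lia].
Qed.

Lemma kazMn r v m : kaz r v -> kaz r (v *+ m).
Proof.
move=> hv; elim: m => [|m IH]; first exact: kaz0.
by rewrite mulrS; exact: kazD.
Qed.

Lemma kaz_xiX z r v j : z \in its -> kaz r v ->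
  kaz (r - (ik z * j)%:Z) (xi J rho z ^+ j *: v).
Proof.
move=> zi hv; elim: j => [|j IH].
  by rewrite expr0 scale1r muln0 subr0.
rewrite exprS -scalerA; apply: (kaz_le _ (kaz_sh _ (ad_x ad zi) (killed_w zi) IH)).
  by lia.
by have := ad_pos ad zi; lia.
Qed.

Local Notation Y z := (rho (ib z) (iy z)).

Lemma kaz_yM z r v : z \in its -> kaz r v -> kaz (r + (ik z)%:Z) (Y z *: v).
Proof.
move=> zi hv; have zk := ad_pos ad zi.
by apply: (kazM _ (ad_y ad zi) _ hv); lia.
Qed.

Lemma kaz_yX z r v a : z \in its -> kaz r v -> kaz (r + (ik z * a)%:Z) (Y z ^+ a *: v).
Proof.
move=> zi hv; elim: a => [|a IH]; first by rewrite expr0 scale1r muln0 addr0.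
by rewrite exprS -scalerA; apply: (kaz_le _ (kaz_yM zi IH)); lia.
Qed.

(** The bracket has degree -m with m = k_z - k_u + 2 >= 2, so it lies in m: its shifted part lowers
    the weight by m, and only the scalar [ipair J z u] remains. *)
Lemma kaz_br z u r v : z \in its -> u \in its -> (ik u <= ik z)%N -> kaz r v ->
  kaz (r - (ik z)%:Z + (ik u)%:Z - 2)
    (rho (ib z (+) ib u) (sbracket (ib z) (ib u) (ix z) (iy u)) *: v
     - algC (ipair J z u) *: v).
Proof.
move=> zi ui uz hv; rewrite -scalerBl -/(sh _ _).
have hbr := has_deg_br (b := ib z) (b' := ib u) (ad_x ad zi) (ad_y ad ui).
have [m mE] : exists m : nat, (ik z)%:Z - (ik u)%:Z + 2 = m%:Z.
  by exists (ik z - ik u + 2)%N; lia.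
have hbr' : has_deg wt (- m%:Z) (sbracket (ib z) (ib u) (ix z) (iy u)).
  by have -> : - m%:Z = - (ik z)%:Z + ((ik u)%:Z - 2) by lia.
have -> : r - (ik z)%:Z + (ik u)%:Z - 2 = r - m%:Z by lia.
by apply: kaz_sh => //; [lia|apply: (sh_deg_w _ _ hbr'); lia].
Qed.

(** The bound is 2 below the one of [kaz_sh]: an error term drops a letter of weight k_u and applies
    a shifted bracket, which lowers by a further k_z - k_u + 2. *)
Lemma kaz_commute z u r v a : z \in its -> u \in its -> (ik u <= ik z)%N -> ipair J z u = 0 ->
  kaz r v -> kaz (r - (ik z)%:Z - 2) (xi J rho z *: v) ->
  kaz (r + (ik u * a)%:Z - (ik z)%:Z - 2) (xi J rho z *: (Y u ^+ a *: v)).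
Proof.
move=> zi ui uz zu hv hzv; elim: a => [|a IH].
  by rewrite expr0 scale1r muln0 addr0.
rewrite exprS -[(_ * _) *: v]scalerA sh_swap; apply: kazD.
  rewrite -scalerA; have := kaz_le _ (kaz_yM ui IH).
  move=> /(_ (r + (ik u * a.+1)%:Z - (ik z)%:Z - 2)) h.
  case: (_ && _); rewrite ?expr1 ?scaleN1r ?expr0 ?scale1r; last by apply: h; lia.
  by apply/kazN/h; lia.
have := kaz_br zi ui uz (kaz_yX a ui hv); rewrite zu rmorph0 scale0r subr0.
by apply: kaz_le; lia.
Qed.

(** On leading terms [xi J rho z] differentiates along [Y z], in a Weyl algebra for even [z] and in
    a Clifford algebra for odd [z]; the exponent is at most 1 in the odd case. *)
Lemma kaz_diag z r v a : z \in its -> (ib z -> (a <= 1)%N) ->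
  kaz r v -> kaz (r - (ik z)%:Z - 2) (xi J rho z *: v) ->
  kaz (r + (ik z * a)%:Z - (ik z)%:Z - 2)
    (xi J rho z *: (Y z ^+ a *: v) - (Y z ^+ a.-1 *: v) *+ a).
Proof.
move=> zi ha hv hzv; elim: a ha => [|a IH] ha.
  by rewrite expr0 scale1r muln0 addr0 mulr0n subr0.
have := kaz_br zi zi (leqnn _) (kaz_yX a zi hv); rewrite (ad_diag ad zi) rmorph1 scale1r.
rewrite exprS -[(_ * _) *: v]scalerA sh_swap -[a.+1.-1]/a.
set x := rho _ _ *: _; set y := (_ * _) *: _; move=> hx.
have -> : y + x - Y z ^+ a *: v *+ a.+1 =
    (x - Y z ^+ a *: v) + (y - Y z ^+ a *: v *+ a) by rewrite mulrS opprD [y + x]addrC addrACA.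
apply: kazD; first by apply: kaz_le hx; lia.
rewrite {}/y -scalerA andbb => {x hx}; have [zb|zb] : ib z \/ ib z = false by case: (ib z); [left|right].
  case: a ha IH => [_ _|a /(_ zb)//].
  have -> : (-1) ^+ ib z = -1 :> A by rewrite zb.
  rewrite expr0 !scale1r mulr0n subr0 scaleN1r; apply/kazN.
  by apply: (kaz_le _ (kaz_yM zi hzv)); lia.
have -> : (-1) ^+ ib z = 1 :> A by rewrite zb.
rewrite scale1r.
have -> : Y z ^+ a *: v *+ a = Y z *: ((Y z ^+ a.-1 *: v) *+ a).
  by case: (a) => [|a']; rewrite ?mulr0n ?scaler0 // -scalerMnr scalerA -exprS.
rewrite -scalerBr; apply: (kaz_le _ (kaz_yM zi (IH _))); first by lia.
by rewrite zb.
Qed.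

(** Iterating the derivative produces the falling factorial; for j = a it is the factorial that
    enters [kaz_const]. *)
Lemma kaz_diagX z r v a j : z \in its -> (ib z -> (a <= 1)%N) -> (j <= a)%N ->
  kaz r v -> kaz (r - (ik z)%:Z - 2) (xi J rho z *: v) ->
  kaz (r + (ik z * (a - j))%:Z - 2)
    (xi J rho z ^+ j *: (Y z ^+ a *: v) - (Y z ^+ (a - j) *: v) *+ a ^_ j).
Proof.
move=> zi ha ja hv hzv; elim: j ja => [|j IH] ja.
  by rewrite expr0 scale1r subn0 ffactn0 mulr1n subrr; exact: kaz0.
have h1 := kaz_xiX 1 zi (IH (ltnW ja)).
have h2 : kaz (r + (ik z * (a - j))%:Z - (ik z)%:Z - 2)
    (xi J rho z *: (Y z ^+ (a - j) *: v) - (Y z ^+ (a - j).-1 *: v) *+ (a - j)).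
  by apply: kaz_diag => // /ha; lia.
have le : r + (ik z * (a - j))%:Z - 2 - (ik z * 1)%:Z <=
    r + (ik z * (a - j))%:Z - (ik z)%:Z - 2 by lia.
have {le h1 h2} := kazD (kaz_le le h1) (kazMn (a ^_ j) h2).
rewrite expr1 scalerBr [xi J rho z *: (xi J rho z ^+ j *: _)]scalerA -exprS mulrnBl -mulrnA.
rewrite [((a - j) * _)%N]mulnC -ffactnSr -subnS.
rewrite -scalerMnr addrA subrK; apply: kaz_le; nia.
Qed.

Definition kaz_word suf : V := (\prod_(z <- suf) Y z ^+ (height p z).-1) *: w.
Definition kaz_wt (suf : seq item) : nat := \sum_(z <- suf) ik z * (height p z).-1.

Lemma kaz_word_cons z suf : kaz_word (z :: suf) = Y z ^+ (height p z).-1 *: kaz_word suf.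
Proof. by rewrite /kaz_word big_cons scalerA. Qed.

Lemma kaz_word_in suf : {subset suf <= its} -> kaz (kaz_wt suf)%:Z (kaz_word suf).
Proof.
elim: suf => [|z suf IH] sl.
  rewrite /kaz_wt /kaz_word !big_nil scale1r.
  by have := @kazC 0 1 (lexx _); rewrite rmorph1 scale1r.
rewrite kaz_word_cons /kaz_wt big_cons -/(kaz_wt suf).
have zi : z \in its by rewrite sl ?mem_head.
apply: (kaz_le _ (kaz_yX _ zi (IH _))); first by lia.
by move=> y ys; rewrite sl // inE ys orbT.
Qed.

Lemma kaz_word_commute z suf : z \in its -> {subset suf <= its} ->
  (forall u, u \in suf -> (ik u <= ik z)%N /\ ipair J z u = 0) ->
  kaz ((kaz_wt suf)%:Z - (ik z)%:Z - 2) (xi J rho z *: kaz_word suf).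
Proof.
move=> zi; elim: suf => [|u suf IH] sl h.
  by rewrite /kaz_word big_nil scale1r killed_w //; exact: kaz0.
have sl' : {subset suf <= its} by move=> y ys; rewrite sl // inE ys orbT.
have [uz zu] := h u (mem_head _ _).
rewrite kaz_word_cons /kaz_wt big_cons -/(kaz_wt suf).
apply: (kaz_le _ (kaz_commute _ zi _ uz zu (kaz_word_in sl') _)); first by lia.
  by rewrite sl ?mem_head.
by apply: IH => // y ys; apply: h; rewrite inE ys orbT.
Qed.

(** [mtop] lowers the weight by exactly [kaz_wt suf], so anything of smaller weight ends in negative
    weight, where the filtration is zero. *)
Lemma kaz_mtop_lt pre suf v : its = pre ++ suf -> kaz ((kaz_wt suf)%:Z - 1) v ->
  mtop (xi J rho) (height p) suf *: v = 0.
Proof.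
elim: suf pre v => [|z suf IH] pre v e.
  by rewrite /kaz_wt big_nil scale1r; exact: kaz_lt0.
have zi : z \in its by rewrite e mem_cat mem_head orbT.
rewrite /kaz_wt big_cons -/(kaz_wt suf) => /(kaz_xiX (height p z).-1 zi) hv.
rewrite /= -scalerA; apply: (IH (rcons pre z)); first by rewrite cat_rcons.
by apply: kaz_le hv; lia.
Qed.

(* Since the degrees k decrease along the list, xi_z only meets its own y_z up to
   terms of lower degree, which the remaining xi send to negative degree. *)
Lemma kaz_mtop_word pre suf : its = pre ++ suf ->
  mtop (xi J rho) (height p) suf *: kaz_word suf =
  w *+ \prod_(z <- suf) (height p z).-1`!.
Proof.
elim: suf pre => [|z suf IH] pre e.
  by rewrite /kaz_word !big_nil /= !scale1r.
have zi : z \in its by rewrite e mem_cat mem_head orbT.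
have sl : {subset suf <= its} by move=> y ys; rewrite e mem_cat inE ys !orbT.
have e' : its = rcons pre z ++ suf by rewrite cat_rcons.
have hz : kaz ((kaz_wt suf)%:Z - (ik z)%:Z - 2) (xi J rho z *: kaz_word suf).
  apply: kaz_word_commute => // u us.
  by have /andP[uz /eqP zu] := pairwise_suffix (ad_pw ad) e us; split.
have top1 : ib z -> ((height p z).-1 <= 1)%N by rewrite /height => ->.
have {hz} h := kaz_diagX zi top1 (leqnn _) (kaz_word_in sl) hz.
rewrite subnn muln0 addr0 expr0 scale1r ffactnn in h.
rewrite kaz_word_cons big_cons /= -scalerA.
rewrite -[X in _ *: X](subrK (kaz_word suf *+ (height p z).-1`!)) scalerDr.
rewrite (kaz_mtop_lt e') ?add0r; last by apply: kaz_le h; lia.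
by rewrite -scalerMnr (IH _ e') -mulrnA mulnC.
Qed.

End Module.

Definition kaz_dual : A := algC kaz_const^-1 * kaz_tail.

(** [V] is arbitrary because the identity is needed in [A] itself, in Q and in the targets of
    homomorphisms from Q. The constant is invertible because p divides no factor of (p - 1)!. *)
Lemma kaz_key (V : lmodType A) (w : V) : (forall z, z \in its -> xi J rho z *: w = 0) ->
  mtop (xi J rho) (height p) its *: (kaz_dual *: w) = w.
Proof.
move=> hw; have h := kaz_mtop_word hw (pre := [::]) erefl.
rewrite scalerA /kaz_dual mulrA -algC_comm -mulrA -!scalerA [_ *: (kaz_tail *: w)]h.
rewrite -scaler_nat -(rmorph_nat algC) scalerA -rmorphM natr_prod mulVf.
  by rewrite rmorph1 scale1r.
rewrite prodf_seq_neq0; apply/allP => z _; rewrite /height; case: ib => //=.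
  by rewrite oner_neq0.
have pp := pcharf_prime charK.
rewrite -(dvdn_pcharf charK) fact_prod; apply/negP.
rewrite big_nat; elim/big_ind: _ => [|x y hx hy|i /andP[i0 ip]].
- by rewrite dvdn1 => /eqP p1; rewrite p1 in pp.
- by rewrite Euclid_dvdM // => /orP[].
- by move=> /(dvdn_leq i0); have := prime_gt0 pp; lia.
Qed.
End Kazhdan.

(** * Good gradings *)

Section JordanGrading.
Variables (K : fieldType) (n : nat) (d : seq nat).
Hypothesis dn : sumn d = n.
Local Notation M := 'M[K]_n.
Local Notation J := (jordan K n d).
Local Notation idx := (reshape_index d).
Local Notation off := (reshape_offset d).
Local Notation sz i := (nth 0%N d (idx i)).
Local Notation wt := (fun i : 'I_n => weight d i).
Implicit Types (A : M) (i j : 'I_n).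

Definition jstep i j := (j == i.+1 :> nat) && (idx i == idx j).

Lemma off_lt i : (off i < sz i)%N.
Proof. by apply: reshape_offsetP; rewrite dn. Qed.

Lemma jstep_off i j : jstep i j -> off j = (off i).+1 /\ sz j = sz i.
Proof.
move=> /andP[/eqP ji /eqP ij]; rewrite -ij; split=> //.
have := reshape_indexK d i; have := reshape_indexK d j.
by rewrite /flatten_index -ij; lia.
Qed.

Lemma jstep_succ i : ((off i).+1 < sz i)%N -> exists j, jstep i j.
Proof.
move=> h; have := flatten_indexKl h; have := reshape_indexK d i.
set m := flatten_index d (idx i) (off i).+1 => e em.
have mi : m = i.+1 by rewrite -[X in _ = X.+1]e /m /flatten_index addnS.
have mn : (m < n)%N.
  rewrite -dn; apply: flatten_indexP h; apply: reshape_indexP; by rewrite dn.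
by exists (Ordinal mn); rewrite /jstep /= em -mi !eqxx.
Qed.

Lemma jstep_pred j : (0 < off j)%N -> exists i, jstep i j.
Proof.
move=> h; have h' : ((off j).-1 < sz j)%N by have := off_lt j; lia.
have := flatten_indexKl h'; have := reshape_indexK d j.
set m := flatten_index d (idx j) (off j).-1 => e em.
have mj : m.+1 = j by rewrite -[RHS]e /m /flatten_index -addnS prednK.
have mn : (m < n)%N by apply: leq_trans (ltn_ord j); rewrite -mj.
by exists (Ordinal mn); rewrite /jstep /= em -mj !eqxx.
Qed.

Lemma weightE i : weight d i = (sz i)%:Z - 1 - (off i).*2%:Z. Proof. by []. Qed.

Lemma jordanE i j : J i j = (jstep i j)%:R. Proof. by rewrite mxE. Qed.

Lemma jordan_deg : has_deg wt 2 J.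
Proof.
move=> i j; rewrite jordanE; case: (boolP (jstep i j)) => [/jstep_off[oj sj] _|]; last first.
  by rewrite eqxx.
by rewrite !weightE sj oj; lia.
Qed.

Lemma weight_lt i j (k : nat) : (n.*2 <= k)%N -> weight d i - weight d j != - k%:Z.
Proof.
have sle (l : 'I_n) : (sz l <= n)%N.
  suff: (sz l <= sumn d)%N by rewrite dn.
  rewrite -[X in (_ <= sumn X)%N](cat_take_drop (idx l)) sumn_cat (drop_nth 0%N) /=; first by lia.
  by apply: reshape_indexP; rewrite dn.
by have := sle i; have := sle j; have := off_lt i; have := off_lt j; rewrite !weightE; lia.
Qed.

Lemma mulJE A i i' j : jstep i i' -> (J * A) i j = A i' j.
Proof.
move=> s; rewrite mxE (bigD1 i') //= jordanE s mul1r big1 ?addr0 // => m mi.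
rewrite jordanE; case: (boolP (jstep i m)) => [/andP[/eqP e _]|]; last by rewrite mul0r.
by move: s mi => /andP[/eqP e' _]; rewrite -val_eqE /= e e' eqxx.
Qed.

Lemma mulAJE A i j' j : jstep j' j -> (A * J) i j = A i j'.
Proof.
move=> s; rewrite mxE (bigD1 j') //= jordanE s mulr1 big1 ?addr0 // => m mi.
rewrite jordanE; case: (boolP (jstep m j)) => [/andP[/eqP e _]|]; last by rewrite mulr0.
by move: s mi => /andP[/eqP e' _]; rewrite -val_eqE /= -eqSS -e e' eqxx.
Qed.

Lemma mulAJ0 A i j : off j = 0%N -> (A * J) i j = 0.
Proof.
move=> o; rewrite mxE big1 // => m _; rewrite jordanE.
by case: (boolP (jstep m j)) => [/jstep_off[]|]; rewrite ?o ?mulr0.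
Qed.

Lemma mulJA0 A i j : (sz i <= (off i).+1)%N -> (J * A) i j = 0.
Proof.
move=> o; rewrite mxE big1 // => m _; rewrite jordanE.
case: (boolP (jstep i m)) => [/jstep_off[o1 s1]|]; last by rewrite mul0r.
by have := off_lt m; rewrite o1 s1 ltnNge o.
Qed.

(* The centralizer of J lives in nonnegative degrees: moving up (resp. down) along
   a diagonal one runs out of the block of the column (resp. row) first. *)
Lemma jordan_ad_inj (e : K) (k : nat) A : e != 0 -> (0 < k)%N -> has_deg wt (- k%:Z) A ->
  J * A = e *: (A * J) -> A = 0.
Proof.
move=> e0 k0 hA eA.
have eAij i j : (J * A) i j = e * (A * J) i j by rewrite eA mxE.
have up m i j : (off j <= m)%N -> (off j < off i)%N -> A i j = 0.
  elim: m i j => [|m IH] i j jm ji.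
    have [i' s] := jstep_pred (leq_ltn_trans (leq0n _) ji).
    by rewrite -(mulJE _ _ s) eAij mulAJ0 ?mulr0 //; lia.
  have [i' s] := jstep_pred (leq_ltn_trans (leq0n _) ji).
  have [oj|oj] := posnP (off j).
    by rewrite -(mulJE _ _ s) eAij mulAJ0 ?mulr0.
  have [j' t] := jstep_pred oj.
  rewrite -(mulJE _ _ s) eAij (mulAJE _ _ t) IH ?mulr0 //.
    by have [] := jstep_off t; lia.
  by have [] := jstep_off t; have [] := jstep_off s; lia.
have down m i j : (sz i - off i <= m)%N -> (sz i - off i < sz j - off j)%N -> A i j = 0.
  elim: m i j => [|m IH] i j im ij; first by have := off_lt i; lia.
  have [|j' t] := @jstep_succ j; first by have := off_lt i; lia.
    apply: (mulfI e0); rewrite mulr0 -(mulAJE _ _ t) -eAij.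
  have [oi|oi] := leqP (sz i) (off i).+1; first exact: mulJA0.
  have [i' s] := jstep_succ oi.
  by have [t1 t2] := jstep_off t; have [s1 s2] := jstep_off s; rewrite (mulJE _ _ s) IH //; lia.
apply/matrixP => i j; rewrite mxE; apply/eqP; apply: contraT => Aij.
(* A negative degree forces [off j < off i] or [sz i - off i < sz j - off j], which are the cases
   [up] and [down]. *)
have h := hA i j Aij; rewrite !weightE in h.
have ho := off_lt i; have ho' := off_lt j.
have [ij|ij] := ltnP (off j) (off i); first by rewrite (up _ _ _ (leqnn _) ij) eqxx in Aij.
by rewrite (down _ _ _ (leqnn _)) ?eqxx // in Aij; lia.
Qed.
End JordanGrading.

(** * q(n) in Jordan coordinates *)

Section Queer.
Variables (K : fieldType) (n : nat) (P : 'M[K]_n).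
Hypothesis uP : P \in unitmx.
Local Notation M := 'M[K]_n.
Implicit Types (A B : M) (b : bool).

(** In these coordinates products, brackets, the grading and chi are expressed by n x n matrices,
    with [J] in place of X. *)
Definition qconj b A : 'M[K]_(n + n) := qblock b (P *m A *m invmx P).

Fact qconj_linear b : linear (qconj b).
Proof. by move=> c A B; rewrite /qconj mulmxDr mulmxDl -scalemxAr -scalemxAl linearP. Qed.
HB.instance Definition _ b :=
  GRing.isLinear.Build K M 'M[K]_(n + n) *:%R (qconj b) (qconj_linear b).

Lemma qblockM b b' A B : qblock b A * qblock b' B = qblock (b (+) b') (A * B).
Proof.
by case: b b' => [] []; rewrite /qblock -[LHS]/(_ *m _) mulmx_block;
  rewrite !(mulmx0, mul0mx, addr0, add0r).
Qed.

Lemma qblock_inj b : injective (@qblock K n b).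
Proof. by case: b => A B; rewrite /qblock => /eq_block_mx[]. Qed.

Lemma conjMM A B : (P *m A *m invmx P) * (P *m B *m invmx P) = P *m (A * B) *m invmx P.
Proof. by rewrite -[LHS]/(_ *m _) -[A * B]/(A *m B) !mulmxA mulmxKV. Qed.

Lemma qconjM b b' A B : qconj b A * qconj b' B = qconj (b (+) b') (A * B).
Proof. by rewrite qblockM conjMM. Qed.

Lemma qconj_br b b' A B :
  sbracket b b' (qconj b A) (qconj b' B) = qconj (b (+) b') (sbracket b b' A B).
Proof.
rewrite /sbracket !qconjM [b' (+) b]addbC linearB; congr (_ - _).
by rewrite linearZ.
Qed.

Lemma qconjX A e : qconj false A ^+ e.+1 = qconj false (A ^+ e.+1).
Proof. by elim: e => [|e IH] //; rewrite exprS IH qconjM -exprS. Qed.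

Lemma conjK A : P *m (invmx P *m A *m P) *m invmx P = A.
Proof. by rewrite !mulmxA mulmxV // mul1mx mulmxK. Qed.

Lemma conjVK A : invmx P *m (P *m A *m invmx P) *m P = A.
Proof. by rewrite !mulmxA mulVmx // mul1mx mulmxKV. Qed.

Lemma chi_qconj X J b A : X = P *m J *m invmx P -> chi X (qconj b A) = chib J b A.
Proof.
move=> ->; rewrite /chi /otr qblockM conjMM.
case: b; rewrite /qblock block_mxKur /chib /= ?mxtrace0 //.
by rewrite mxtrace_mulC mulmxA mulVmx // mul1mx.
Qed.

Lemma mem_qn b A : qconj b A \in qn K n b.
Proof. by apply/memv_imgP; exists (P *m A *m invmx P); rewrite ?memvf ?lfunE. Qed.

Section Degrees.
Variable d : seq nat.
Local Notation wt := (fun i : 'I_n => weight d i).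

Lemma has_deg0 k : has_deg wt k (0 : M).
Proof. by move=> i j; rewrite mxE eqxx. Qed.

Lemma mem_q_deg k b A : qconj b A \in q_deg P d k b <-> has_deg wt k A.
Proof.
split=> [/memv_imgP[A' hA']|hA].
  rewrite lfunE => /qblock_inj e; rewrite -[A]conjVK e => {e}.
  move: hA' => /memv_sumP[v hv ->]; rewrite mulmx_sumr mulmx_suml.
  apply: (big_ind (has_deg wt k)); [exact: has_deg0|move=> ? ?; exact: has_degD|].
  move=> i _; have /memv_sumP[v' hv' ->] := hv i isT.
  rewrite mulmx_sumr mulmx_suml.
  apply: (big_ind (has_deg wt k)); [exact: has_deg0|move=> ? ?; exact: has_degD|].
  move=> j /eqP ij; have /vlineP[c ->] := hv' j (introT eqP ij).
  rewrite -scalemxAr -scalemxAl conjVK; apply: has_degZ => i' j'; rewrite mxE.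
  by case: andP => [[/eqP -> /eqP ->]|] //; rewrite eqxx.
apply/memv_imgP; exists (P *m A *m invmx P); last by rewrite lfunE.
rewrite [A]matrix_sum_delta mulmx_sumr mulmx_suml; apply: memv_suml => i _.
rewrite mulmx_sumr mulmx_suml; apply: memv_suml => j _.
have [->|Aij] := eqVneq (A i j) 0; first by rewrite scale0r mulmx0 mul0mx mem0v.
rewrite -scalemxAr -scalemxAl; apply: memvZ.
apply: (subvP (sumv_sup i isT (subvv _))).
by apply: (subvP (sumv_sup j _ (subvv _))); [apply/eqP; exact: hA|exact: memv_line].
Qed.

End Degrees.

(** A linear form f on matrices is A -> tr(A Y), the entry (a, b) of Y being f at the matrix unit
    (b, a); this is applied to the coordinate forms of the free family. *)
Lemma dual_family (X : seq M) : free X ->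
  exists Y : 'I_(size X) -> M, forall i j : 'I_(size X), \tr (X`_i * Y j) = (i == j)%:R.
Proof.
move=> fX; pose f j := coord (in_tuple X) j.
exists (fun j => \matrix_(a, b) f j (delta_mx b a)) => i j.
transitivity (f j X`_i).
  rewrite [X in f j X]matrix_sum_delta /f linear_sum; apply: eq_bigr => a _.
  by rewrite mxE linear_sum; apply: eq_bigr => b _; rewrite linearZ mxE.
exact: (@coord_free _ _ _ (in_tuple X) i j fX).
Qed.
End Queer.

(** * Dual vectors in one degree *)

Section Group.
Variables (K : fieldType) (n : nat) (d : seq nat).
Hypothesis dn : sumn d = n.
Local Notation M := 'M[K]_n.
Local Notation J := (jordan K n d).
Local Notation wt := (fun i : 'I_n => weight d i).

Definition truncdeg (k : int) (A : M) : M :=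
  \matrix_(i, j) if weight d i - weight d j == k then A i j else 0.

Lemma truncdeg_deg k A : has_deg wt k (truncdeg k A).
Proof. by move=> i j; rewrite mxE; case: ifP => [/eqP e _|_]; [exact: e|rewrite eqxx]. Qed.

Lemma truncdeg_tr k A B : has_deg wt (- k) B -> \tr (B * truncdeg k A) = \tr (B * A).
Proof.
move=> hB; rewrite /mxtrace; apply: eq_bigr => i _; rewrite !mxE; apply: eq_bigr => j _.
rewrite mxE; case: eqP => // h; have [->|/hB e] := eqVneq (B i j) 0; first by rewrite !mul0r.
by case: h; rewrite -opprB e opprK.
Qed.

Definition adJ b (A : M) : M := J * A - (-1) ^+ b *: (A * J).

Fact adJ_linear b : linear (adJ b).
Proof.
move=> c A B; rewrite /adJ mulrDr mulrDl scalerDr opprD addrACA.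
by rewrite -[c *: A * J]scalemxAl -[J * (c *: A)]scalemxAr !scalerBr !scalerA [c * _]mulrC.
Qed.
HB.instance Definition _ b := GRing.isLinear.Build K M M *:%R (adJ b) (adJ_linear b).

(** Invariance of the trace form turns the pairing by chi into the trace pairing with ad J, whose
    injectivity is known. *)
Lemma adJ_tr b (A B : M) : chib J false (sbracket b b A B) = \tr (adJ b A * B).
Proof.
rewrite /chib /sbracket /adJ mulrBr mulrBl !raddfB /= andbb; congr (_ - _).
  by rewrite mulrA.
rewrite -[J * (_ *: _)]scalemxAr -[_ *: (A * J) * B]scalemxAl !mxtraceZ; congr (_ * _).
transitivity (\tr (J * B * A)); first by congr (\tr _); exact: mulmxA.
by transitivity (\tr (A *m (J *m B))); [exact: mxtrace_mulC|congr (\tr _); exact: mulmxA].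
Qed.

(** ad J is injective on [V], so it maps a basis to a free family, which has trace-dual vectors. The
    image has degree 2 - k, so truncating these vectors to degree k - 2 keeps the pairing. *)
Lemma dual_items (V : {vspace M}) b (k : nat) : (0 < k)%N ->
  (forall A, A \in V -> has_deg wt (- k%:Z) A) ->
  exists s : seq (item K n),
    [/\ forall z, z \in s -> [/\ ib z = b, ik z = k, ix z \in V,
                               has_deg wt (k%:Z - 2) (iy z) & ipair J z z = 1],
        pairwise (fun z z' => ipair J z z' == 0) s & <<map (@ix K n) s>>%VS = V].
Proof.
move=> k0 hV; pose X := vbasis V; pose f := linfun (adJ b).
have fker : (V :&: lker f = 0)%VS.
  apply/eqP; rewrite -subv0; apply/subvP => A; rewrite memv_cap memv_ker lfunE memv0.
  move=> /andP[/hV hA]; rewrite subr_eq0 => /eqP e; apply/eqP.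
  by apply: (jordan_ad_inj dn _ k0 hA e); rewrite expf_neq0 ?oppr_eq0 ?oner_neq0.
have /basis_free fX := limg_basis_of fker (vbasisP V).
have [Y hY] := dual_family fX; have sX : size (map f X) = size X by rewrite size_map.
pose y (i : 'I_(size X)) := truncdeg (k%:Z - 2) (Y (cast_ord (esym sX) i)).
pose z i : item K n := (b, k, X`_(nat_of_ord i), y i).
have zz i j : ipair J (z i) (z j) = (i == j)%:R.
  rewrite /ipair /= addbb adJ_tr truncdeg_tr.
    have := hY (cast_ord (esym sX) i) (cast_ord (esym sX) j).
    by rewrite (nth_map 0) //= lfunE => ->; rewrite (inj_eq (@cast_ord_inj _ _ _)).
  have hX : has_deg wt (- k%:Z) X`_i by apply/hV/vbasis_mem/mem_nth.
  have hJ := jordan_deg (K := K) dn; rewrite opprB; apply: has_degD; first exact: has_degM.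
  by rewrite -scaleNr addrC; apply/has_degZ/has_degM.
exists [seq z i | i <- enum 'I_(size X)]; split.
- move=> _ /mapP[i _ ->]; rewrite zz eqxx; split => //; last exact: truncdeg_deg.
  by apply/vbasis_mem/mem_nth.
- rewrite pairwise_map; apply: sub_pairwise (_ : pairwise [rel u v | u != v] _) => [i j /= ij|].
    by rewrite zz (negPf ij).
  by rewrite -uniq_pairwise enum_uniq.
- rewrite -map_comp -[RHS](span_basis (vbasisP V)); congr span.
  rewrite -[RHS](mkseq_nth 0) /mkseq -val_enum_ord -map_comp; exact: eq_map.
Qed.
End Group.

(** * An adapted basis of m *)

Section AdaptedBasis.
Variables (K : fieldType) (n : nat) (P X : 'M[K]_n) (d : seq nat).
Hypotheses (uP : P \in unitmx) (dn : sumn d = n) (XJ : X = P *m jordan K n d *m invmx P).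
Variable L : bool -> {vspace 'M[K]_(n + n)}.
Hypotheses (L_deg : forall b, (L b <= q_deg P d (- 1) b)%VS)
  (L_iso : forall b, isotropic X b (L b)).
Local Notation M := 'M[K]_n.
Local Notation J := (jordan K n d).
Local Notation wt := (fun i : 'I_n => weight d i).
Implicit Types (A : M) (b : bool) (k : nat).

Definition m_piece b k : {vspace 'M[K]_(n + n)} :=
  if k == 1%N then L b else q_deg P d (- k%:Z) b.
Definition m_coord b k : {vspace M} := (linfun (qconj P b) @^-1: m_piece b k)%VS.

Lemma m_coordP b k A : (A \in m_coord b k) = (qconj P b A \in m_piece b k).
Proof. by rewrite -memv_preim lfunE. Qed.

Lemma m_coord_deg b k A : A \in m_coord b k -> has_deg wt (- k%:Z) A.
Proof.
rewrite m_coordP /m_piece => h; apply/(mem_q_deg uP _ _ b); move: h.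
by case: eqP => [->|_] // h; exact: (subvP (L_deg b) _ h).
Qed.

Lemma q_deg_limg b k : (q_deg P d (- k%:Z) b <= limg (linfun (qconj P b)))%VS.
Proof.
apply/subvP => _ /memv_imgP[A _ ->]; apply/memv_imgP.
by exists (invmx P *m A *m P); rewrite ?memvf // !lfunE /= /qconj conjK.
Qed.

Lemma m_coordK b k : (linfun (qconj P b) @: m_coord b k)%VS = m_piece b k.
Proof.
apply: lpreimK; rewrite /m_piece; case: eqP => _; last exact: q_deg_limg.
by apply: subv_trans (L_deg b) _; exact: q_deg_limg.
Qed.

Definition piece_items_spec (g : bool -> nat -> seq (item K n)) := forall b k, (0 < k)%N ->
  [/\ forall z, z \in g b k -> [/\ ib z = b, ik z = k, ix z \in m_coord b k,
                             has_deg wt (k%:Z - 2) (iy z) & ipair J z z = 1],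
      pairwise (fun z z' => ipair J z z' == 0) (g b k) &
      <<map (@ix K n) (g b k)>>%VS = m_coord b k].

Lemma piece_items_ex : exists g, piece_items_spec g.
Proof.
have /choice[g hg] (bk : bool * nat) : exists s : seq (item K n), (0 < bk.2)%N ->
  [/\ forall z, z \in s -> [/\ ib z = bk.1, ik z = bk.2, ix z \in m_coord bk.1 bk.2,
                             has_deg wt (bk.2%:Z - 2) (iy z) & ipair J z z = 1],
      pairwise (fun z z' => ipair J z z' == 0) s &
      <<map (@ix K n) s>>%VS = m_coord bk.1 bk.2].
  have [k0|k0] := posnP bk.2; first by exists [::].
  have [s hs] := dual_items dn bk.1 k0 (@m_coord_deg bk.1 bk.2).
  by exists s.
by exists (fun b k => g (b, k)) => b k; exact: (hg (b, k)).
Qed.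

Lemma ipair_lt z z' : has_deg wt (- (ik z)%:Z) (ix z) ->
  has_deg wt ((ik z')%:Z - 2) (iy z') -> (ik z' < ik z)%N -> ipair J z z' = 0.
Proof.
move=> hz hz' zz'.
by apply: (chib_deg _ (jordan_deg (K := K) dn) (has_deg_br hz hz')); apply/eqP; lia.
Qed.

Lemma adapted_exists : exists its : seq (item K n),
  [/\ adapted wt J its,
      forall z, z \in its -> qconj P (ib z) (ix z) \in m_alg P d L (ib z) &
      forall b y, y \in m_alg P d L b ->
        exists2 A, A \in <<[seq ix z | z <- its & ib z == b]>>%VS & y = qconj P b A].
Proof.
have [g hg] := piece_items_ex.
(* The degrees run from 2n - 1 down to 1. Within one degree the two parities may come in any order,
   as they pair to 0 under the even form chi. *)
pose D := [seq (b, k) | k <- rev (iota 1 n.*2.-1), b <- [:: false; true]].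
have memD b k : ((b, k) \in D) = (0 < k < n.*2)%N.
  apply/allpairsP/idP => [[[k' b'] [/=]]|h].
    by rewrite mem_rev mem_iota => h _ [_ ->]; lia.
  by exists (k, b); rewrite mem_rev mem_iota; split => //=; [lia|case: (b)].
pose its := flatten [seq g bk.1 bk.2 | bk <- D].
have memI z : z \in its -> [/\ (0 < ik z < n.*2)%N & z \in g (ib z) (ik z)].
  move=> /flatten_mapP[[b k]]; rewrite memD => h zg.
  have k0 : (0 < k)%N by case/andP: h.
  by have [/(_ _ zg)[eb ek _ _ _] _ _] := hg b k k0; rewrite eb ek.
have gI b k z : (0 < k < n.*2)%N -> z \in g b k -> z \in its.
  by move=> h zg; apply/flatten_mapP; exists (b, k) => //; rewrite memD.
have prop z : z \in its -> [/\ (0 < ik z < n.*2)%N, ix z \in m_coord (ib z) (ik z),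
    has_deg wt ((ik z)%:Z - 2) (iy z) & ipair J z z = 1].
  move=> /memI[h zg]; have k0 : (0 < ik z)%N by case/andP: h.
  by have [/(_ _ zg)[_ _ h1 h2 h3] _ _] := hg (ib z) (ik z) k0.
have xdeg z : z \in its -> has_deg wt (- (ik z)%:Z) (ix z).
  by move=> /prop[_ /m_coord_deg].
have spanI b k : (0 < k < n.*2)%N ->
    (m_coord b k <= <<[seq ix z | z <- its & (ib z == b) && (ik z == k)]>>)%VS.
  move=> h; have k0 : (0 < k)%N by case/andP: h.
  have [h1 _ <-] := hg b k k0; apply: sub_span => _ /mapP[z zg ->]; apply: map_f.
  by rewrite mem_filter (gI _ _ _ h zg) andbT; have [-> -> _ _ _] := h1 z zg; rewrite !eqxx.
have pwD : pairwise (fun a c : bool * nat => (c.2 < a.2)%N || (c.2 == a.2) && (c.1 != a.1)) D.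
  have : pairwise (fun k k' => k' < k)%N (rev (iota 1 n.*2.-1)).
    rewrite -sorted_pairwise; last by move=> x y z /= h1 h2; exact: ltn_trans h2 h1.
    by rewrite rev_sorted iota_ltn_sorted.
  rewrite /D; elim: (rev _) => [//|k s IH] /= /andP[/allP ks /IH ->].
  rewrite ltnn eqxx /= !andbT; apply/andP; split; apply/allP => -[b' k'] /flatten_mapP[k1 /ks h];
    by rewrite !inE => /orP[] /eqP[_ ->]; rewrite h.
exists its; split; first split.
- by move=> z /prop[/andP[]].
- exact: xdeg.
- by move=> z /prop[].
- have h0 : forall bk, bk \in D -> (0 < bk.2)%N.
    by move=> [b k]; rewrite memD => /andP[].
  rewrite /its; move: pwD h0; move: (D) => D0.
  elim: D0 => [//|[b k] D' IH] /= /andP[/allP hD pwD'] h0.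
  have kpos : (0 < k)%N by exact: (h0 (b, k) (mem_head _ _)).
  have h0' bk : bk \in D' -> (0 < bk.2)%N by move=> bD; apply: h0; rewrite inE bD orbT.
  rewrite pairwise_cat IH // andbT; have [gk gpw _] := hg b k kpos; apply/andP; split; last first.
    apply: (sub_in_pairwise (P := mem (g b k))) gpw; last by apply/allP.
    move=> z z' /gk[_ zk _ _ _] /gk[_ zk' _ _ _] /= ->.
    by rewrite zk zk' leqnn.
  apply/allrelP => z z' /gk[zb zk zc zy _] /flatten_mapP[[b' k'] bD'].
  have /= k0' := h0' _ bD'; have [gk' _ _] := hg b' k' k0'.
  move=> /gk'[zb' zk' zc' zy' _]; have := hD _ bD' => /= /orP[kk|/andP[/eqP kk bb]].
    have -> : ipair J z z' = 0.
      apply: ipair_lt; rewrite ?zk ?zk' //; exact: (m_coord_deg zc).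
    by rewrite zk zk' ltnW ?eqxx.
  by rewrite zk zk' kk leqnn /ipair zb zb'; case: (b) (b') bb => [] [] //= _; rewrite eqxx.
- by move=> z /prop[].
(* chi can be nonzero only in total degree -2, hence on two vectors of degree -1: there equal
   parities are settled by isotropy, and distinct ones give an odd bracket. *)
- move=> z z' zi zi'; have [kk|kk] := eqVneq (ik z + ik z')%N 2%N; last first.
    apply: (chib_deg _ (jordan_deg (K := K) dn) (has_deg_br (xdeg z zi) (xdeg z' zi'))).
    by apply/eqP; move/eqP: kk; lia.
  have [/andP[k0 _] hx _ _] := prop z zi; have [/andP[k0' _] hx' _ _] := prop z' zi'.
  have [k1 k1'] : ik z = 1%N /\ ik z' = 1%N by lia.
  have [bb|] := eqVneq (ib z) (ib z'); last first.
    by case: (ib z) (ib z') => [] [].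
  move: hx hx'; rewrite !m_coordP k1 k1' /m_piece /= -bb => hx hx'.
  have := L_iso hx hx'; rewrite qconj_br // (chi_qconj uP _ _ XJ); exact.
(* Weights differ by less than 2n, so there is nothing in degree -k for k >= 2n. *)
- move=> b k A k1 hA; have [kn|kn] := ltnP k n.*2; last first.
    suff -> : A = 0 by exact: mem0v.
    apply/matrixP => i j; rewrite mxE; apply/eqP; apply: contraT => /hA h.
    by have := weight_lt dn i j kn; rewrite h eqxx.
  apply: (subvP (spanI b k _)); first by lia.
  by rewrite m_coordP /m_piece ifF; [apply/mem_q_deg|lia].
- move=> z /prop[/andP[k0 kn]]; rewrite m_coordP /m_piece => h _ _.
  move: h; case: eqP => [_ h|k1 h]; first exact: (subvP (addvSr _ _)).
  apply: (subvP (addvSl _ _)).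
  have kI : ik z \in index_iota 2 n.*2 by rewrite mem_index_iota; lia.
  by rewrite (big_rem _ kI) /=; apply: (subvP (addvSl _ _)).
- move=> b y; suff /subvP h : (m_alg P d L b <=
      linfun (qconj P b) @: <<[seq ix z | z <- its & ib z == b]>>)%VS.
    by move=> /h /memv_imgP[A hA ->]; exists A => //; rewrite lfunE.
  have hk k : (0 < k < n.*2)%N -> (m_piece b k <=
      linfun (qconj P b) @: <<[seq ix z | z <- its & ib z == b]>>)%VS.
    move=> hk; rewrite -m_coordK limgS // (subv_trans (spanI b k hk)) //.
    apply: sub_span => _ /mapP[z + ->]; rewrite mem_filter => /andP[/andP[zb _] zi].
    by apply: map_f; rewrite mem_filter zb.
  rewrite subv_add; apply/andP; split; last first.
    (* For n = 0 the degree 1 is missing from the list, but there the ambient space is zero. *)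
    have [n0|n0] := posnP n; last by apply: (hk 1%N); lia.
    apply/subvP => y' _; suff -> : y' = 0 by exact: mem0v.
    by apply/matrixP => -[i hi]; exfalso; move: hi; rewrite n0.
  rewrite big_nat; elim/big_ind: _ => [|V W hV hW|k /andP[k1 k2]]; first exact: sub0v.
    by rewrite subv_add hV.
  by have := hk k; rewrite /m_piece ifF; [apply; lia|lia].
Qed.
End AdaptedBasis.

(** * Reduced enveloping algebras *)

Lemma free_alg_ind (K : fieldType) (I : choiceType) (P : {malg K[{fmonom I}]} -> Prop) :
  (forall c, P (algC c)) -> (forall i, P (freegen K i)) ->
  (forall x y, P x -> P y -> P (x + y)) -> (forall x y, P x -> P y -> P (x * y)) ->
  forall x, P x.
Proof.
move=> PC Pg PD PM x; rewrite [x]monalgE; apply: (big_ind P) => [||m _].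
- by have := PC 0; rewrite rmorph0.
- exact: PD.
move: (x@_m)%M => {x} c; case: m => s; elim: s => [|i s IH].
  by rewrite -[FMonom [::]]/(FMonom [::]) -(fmE [::]); exact: PC.
have -> : << c *g FMonom (i :: s) >> = freegen K i * << c *g FMonom s >>.
  rewrite malgM_def fgmulUU mul1r; congr << _ *g _ >>.
  by apply/val_inj; rewrite /= fmM fmU.
exact: PM.
Qed.

Section MorphismOfRelations.
Variables (A B : pzRingType) (f : {rmorphism A -> B}) (x y z : A) (k : nat).

Lemma rmorph_relD : f (z - (x + y)) = f z - (f x + f y).
Proof. by rewrite rmorphB rmorphD. Qed.
Lemma rmorph_relZ : f (z - x * y) = f z - f x * f y.
Proof. by rewrite rmorphB rmorphM. Qed.
Lemma rmorph_bracket : f (x * y - (-1) ^+ k * (y * x) - z) =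
  f x * f y - (-1) ^+ k * (f y * f x) - f z.
Proof. by rewrite !rmorphB !rmorphM rmorphXn rmorphN1. Qed.
Lemma rmorph_pow : f (x ^+ k - y - z) = f x ^+ k - f y - f z.
Proof. by rewrite !rmorphB rmorphXn. Qed.
End MorphismOfRelations.

Section Uchi.
Variables (K : fieldType) (N p : nat) (chi : 'M[K]_N -> K) (a : bool -> {vspace 'M[K]_N}).
Local Notation Ua := (Uchi p chi a).
Local Notation gen := (@Uchi_gen K N p chi a _).
Local Notation q := (quotpi (@Uchi_rel K N p chi a) \o quotpi (@U_rel K N a)).

Lemma Uchi_ind (P : Ua -> Prop) : (forall c, P (algC c)) ->
  (forall b (x : subvs_of (a b)), P (gen x)) ->
  (forall x y, P x -> P y -> P (x + y)) -> (forall x y, P x -> P y -> P (x * y)) ->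
  forall x, P x.
Proof.
move=> PC Pg PD PM; elim/quotpiW; elim/quotpiW.
apply: (free_alg_ind (P := fun x => P (q x))) => [c|[b x]|x y hx hy|x y hx hy].
- exact: PC.
- exact: Pg.
- by rewrite rmorphD; exact: PD.
- by rewrite rmorphM; exact: PM.
Qed.

Lemma Uchi_gen_lin b c (x y : subvs_of (a b)) : gen (c *: x + y) = algC c * gen x + gen y.
Proof.
have hD (u v : subvs_of (a b)) : gen (u + v) = gen u + gen v.
  have := Uchi_rel0 p chi (U_relD u v); rewrite -/(q _) (rmorph_relD q).
  by move=> /eqP; rewrite subr_eq0 => /eqP.
rewrite hD; congr (_ + _); have := Uchi_rel0 p chi (U_relZ c x).
by rewrite -/(q _) (rmorph_relZ q) => /eqP; rewrite subr_eq0 => /eqP.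
Qed.

Lemma Uchi_gen_br i j (x : subvs_of (a i)) (y : subvs_of (a j)) (z : subvs_of (a (i (+) j))) :
  vsval z = sbracket i j (vsval x) (vsval y) ->
  gen x * gen y - (-1) ^+ (i && j) * (gen y * gen x) = gen z.
Proof.
move=> /U_rel_bracket /(Uchi_rel0 p chi) h.
rewrite -/(q _) (rmorph_bracket q) in h.
by apply/eqP; rewrite -subr_eq0; apply/eqP.
Qed.

Lemma Uchi_gen_pow (x z : subvs_of (a false)) : vsval z = vsval x ^+ p ->
  gen x ^+ p = gen z + algC (chi (vsval x) ^+ p).
Proof.
move=> h; apply/eqP; rewrite -subr_eq0 opprD addrA; apply/eqP.
have h0 := ideal_gen_in (Uchi_rel_pow chi h).
rewrite -[RHS](rmorph0 (quotpi (@Uchi_rel K N p chi a))).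
transitivity (quotpi (@Uchi_rel K N p chi a) (Ugen x ^+ p - Ugen z - algC (chi (vsval x) ^+ p))).
  by rewrite !rmorphB; congr (_ - _ - _); rewrite rmorphXn.
by apply/quotpiP; rewrite subr0.
Qed.

Section Lift.
Variables (R : pzAlgType K) (f : forall b, subvs_of (a b) -> R).
Hypotheses (f_lin : forall b c (x y : subvs_of (a b)), f (c *: x + y) = algC c * f x + f y)
  (f_br : forall i j (x : subvs_of (a i)) (y : subvs_of (a j)) (z : subvs_of (a (i (+) j))),
     vsval z = sbracket i j (vsval x) (vsval y) ->
     f x * f y - (-1) ^+ (i && j) * (f y * f x) = f z)
  (f_pow : forall x z : subvs_of (a false), vsval z = vsval x ^+ p ->
     f x ^+ p = f z + algC (chi (vsval x) ^+ p)).

(** The universal property of the reduced enveloping algebra; it provides the parity involution. *)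
Lemma Uchi_lift : exists phi : {rmorphism Ua -> R},
  (forall b (x : subvs_of (a b)), phi (gen x) = f x) /\ (forall c, phi (algC c) = algC c).
Proof.
pose F : {rmorphism {malg K[{fmonom (gens a)}]} -> R} := freelift (fun x : gens a => f (tagged x)).
have Fg b (x : subvs_of (a b)) : F (fgen x) = f x by exact: freelift_gen.
have FC c : F (algC c) = algC c by exact: freeliftC.
have f0 b : f (0 : subvs_of (a b)) = 0.
  apply: (addIr (f (0 : subvs_of (a b)))); rewrite add0r.
  by have := f_lin 1 (0 : subvs_of (a b)) 0; rewrite scaler0 addr0 rmorph1 mul1r => <-.
have Frel x : U_rel x -> F x = 0.
  case=> {x}[b x y|b c x|i j x y z zE].
  - rewrite (rmorph_relD F) !Fg -{1}[x]scale1r f_lin rmorph1 mul1r subrr //.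
  - by rewrite (rmorph_relZ F) !Fg FC -[c *: x]addr0 f_lin f0 addr0 subrr.
  - by rewrite (rmorph_bracket F) !Fg (f_br zE) subrr.
pose F1 : {rmorphism U a -> R} := quotlift Frel.
have F1g b (x : subvs_of (a b)) : F1 (Ugen x) = f x.
  by rewrite -Fg; exact: quotliftE.
have F1C c : F1 (algC c) = algC c by rewrite -FC; exact: quotliftE.
have F1rel x : Uchi_rel p chi x -> F1 x = 0.
  case=> {x} x z zE.
  by rewrite (rmorph_pow F1) !F1g F1C (f_pow zE) [f z + _]addrC addrK subrr.
exists (quotlift F1rel); split=> [b x|c].
  by rewrite -F1g; exact: quotliftE.
by rewrite -F1C; exact: quotliftE.
Qed.
End Lift.
End Uchi.

(** * Supermodules *)

Section Superspaces.
Variables (K : fieldType) (A : salgType K).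

Lemma spar_unique (M : supermod A) b (x y x' y' : M) : spar_direct M ->
  spar b x -> spar (~~ b) y -> spar b x' -> spar (~~ b) y' ->
  x + y = x' + y' -> x = x' /\ y = y'.
Proof.
move=> dM; case: b => /= hx hy hx' hy' e.
  have [z [_ uz]] := dM (x + y).
  have h1 : z = (y, x) by apply: uz; split => //=; rewrite addrC.
  have h2 : z = (y', x') by apply: uz; split => //=; rewrite e addrC.
  by have := h1; rewrite h2 => -[-> ->].
have [z [_ uz]] := dM (x + y).
have h1 : z = (x, y) by apply: uz.
have h2 : z = (x', y') by apply: uz.
by have := h1; rewrite h2 => -[-> ->].
Qed.

Lemma spar_split (M : supermod A) b (x : M) : spar_direct M ->
  exists y z, [/\ spar b y, spar (~~ b) z & x = y + z].
Proof.
move=> dM; have [[y z] [[/= hy hz e] _]] := dM x; case: b => /=; last by exists y, z.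
by exists z, y; split => //; rewrite addrC.
Qed.

Lemma spar_disjoint (M : supermod A) b (x : M) : spar_direct M ->
  spar b x -> spar (~~ b) x -> x = 0.
Proof.
move=> dM h h'; have [|->] := @spar_unique M b x 0 0 x dM h (spar0 _ _) (spar0 _ _) h' => //.
by rewrite addrC.
Qed.

Lemma spar_directI (M : supermod A) :
  (forall x : M, exists y z, [/\ spar false y, spar true z & x = y + z]) ->
  (forall x : M, spar false x -> spar true x -> x = 0) -> spar_direct M.
Proof.
move=> hs hd x; have [y [z [hy hz ->]]] := hs x; exists (y, z); split=> // -[y' z'] /= [hy' hz' e].
have h : y - y' = z' - z.
  by apply/eqP; rewrite subr_eq addrAC eq_sym subr_eq addrC -e addrC.
have h0 : y - y' = 0.
  by apply: hd; [|rewrite h]; apply: sparD => //; exact: sparN.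
by congr (_, _); apply/eqP; rewrite -subr_eq0; [rewrite h0|rewrite -opprB -h h0 oppr0].
Qed.

Lemma parX b (x : A) k : par b x -> par (b && odd k) (x ^+ k).
Proof.
move=> hx; elim: k => [|k IH].
  by rewrite andbF expr0 -(rmorph1 algC); exact: parC.
rewrite exprS /=; have := parM _ _ _ _ hx IH.
by case: b (odd k) {hx IH} => [] [].
Qed.

Lemma par_sum b (I : Type) (s : seq I) (F : I -> A) :
  (forall i, par b (F i)) -> par b (\sum_(i <- s) F i).
Proof. by move=> h; elim/big_ind: _ => *; [exact: par0|exact: parD|exact: h]. Qed.

Lemma algC_mulCA (c : K) (x y : A) : x * (algC c * y) = algC c * (x * y).
Proof. by rewrite !mulrA algC_comm. Qed.

Lemma spar_parity (M : supermod A) b b' (x : M) : b = b' -> spar b x -> spar b' x.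
Proof. by move=> ->. Qed.
Lemma par_parity b b' (x : A) : b = b' -> par b x -> par b' x.
Proof. by move=> ->. Qed.
End Superspaces.

(** * Matrices over the opposite endomorphism algebra *)

Section EndMatrix.
Variables (K : fieldType) (A : salgType K) (T : Type) (X : T -> A) (X_odd : T -> bool).
Hypothesis X_par : forall z, par (X_odd z) (X z).
Hypothesis A_split : forall a : A, exists a0 a1, [/\ par false a0, par true a1 & a = a0 + a1].
Variables (Q : supermod A) (ev : bool) (v1 : Q) (twist : bool -> A -> A) (S t : A).
Definition killedX (V : lmodType A) (w : V) := forall z, X z *: w = 0.
Hypotheses (Q_direct : spar_direct Q) (Q_gen : forall x : Q, exists a, x = a *: v1)
  (spar_v1 : forall b a, par b a -> spar (b (+) ev) (a *: v1))
  (v1_eq0 : forall a, a *: v1 = 0 <-> a * S = 0)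
  (key : forall (V : lmodType A) (w : V), killedX w -> S *: (t *: w) = w)
  (twist_par : forall i b a, par b a -> twist i a = (-1) ^+ (i && b) * a)
  (shom_v1 : forall i (f : shom i Q Q) a, f (a *: v1) = twist i a *: f v1)
  (shom_killed : forall i (f : shom i Q Q), killedX (f v1))
  (shom_of_killed : forall i (w : Q), spar (i (+) ev) w -> killedX w ->
     exists f : shom i Q Q, f v1 = w).

Lemma shom_v1_ext i (f g : shom i Q Q) : f v1 = g v1 -> f = g.
Proof. by move=> e; apply: shomP => x; have [a ->] := Q_gen x; rewrite !shom_v1 e. Qed.

Definition ev1 (f : sEndop Q) : Q := f.1 v1 + f.2 v1.

Lemma spar_v1_id : spar ev v1.
Proof.
rewrite -[v1]scale1r -[ev]/(false (+) ev); apply: spar_v1.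
by rewrite -(rmorph1 algC); exact: parC.
Qed.

Lemma shom_ev i (f : shom i Q Q) : spar (i (+) ev) (f v1).
Proof. by apply: shom_par; exact: spar_v1_id. Qed.

Lemma ev1_parts (f : sEndop Q) x y : spar ev x -> spar (~~ ev) y -> ev1 f = x + y ->
  f.1 v1 = x /\ f.2 v1 = y.
Proof.
move=> hx hy; exact: (spar_unique Q_direct (shom_ev f.1) (shom_ev f.2) hx hy).
Qed.

Lemma ev1_inj : injective ev1.
Proof.
move=> f g /ev1_parts => /(_ (shom_ev g.1) (shom_ev g.2))[h1 h2].
by case: f g h1 h2 => [f0 f1] [g0 g1] /= /shom_v1_ext -> /shom_v1_ext ->.
Qed.

Lemma ev1D f g : ev1 (f + g) = ev1 f + ev1 g.
Proof. by rewrite /ev1 /= addrACA. Qed.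
Lemma ev10 : ev1 0 = 0.
Proof. by rewrite /ev1 /= addr0. Qed.
Lemma ev1C c : ev1 (algC c) = algC c *: v1.
Proof. by rewrite /ev1 /= addr0. Qed.
Lemma ev1_sum (I : finType) (F : I -> sEndop Q) : ev1 (\sum_i F i) = \sum_i ev1 (F i).
Proof. by apply: big_morph; [exact: ev1D|exact: ev10]. Qed.

Lemma killed_parts a0 a1 : par false a0 -> par true a1 -> killedX ((a0 + a1) *: v1) ->
  killedX (a0 *: v1) /\ killedX (a1 *: v1).
Proof.
move=> h0 h1 hk.
have p z : X z *: (a0 *: v1) = 0 /\ X z *: (a1 *: v1) = 0.
  have s0 := sparZ (X_par z) (spar_v1 h0).
  have s1 : spar (~~ (X_odd z (+) (false (+) ev))) (X z *: (a1 *: v1)).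
    by apply: spar_parity (sparZ (X_par z) (spar_v1 h1)); case: (X_odd z) (ev) => [] [].
  have [|//] := spar_unique Q_direct s0 s1 (spar0 _ _) (spar0 _ _).
  by rewrite -scalerDr -scalerDl hk addr0.
by split=> z; case: (p z).
Qed.

Lemma ev1_surj a : killedX (a *: v1) -> exists f, ev1 f = a *: v1.
Proof.
have [a0 [a1 [h0 h1 ->]]] := A_split a => /(killed_parts h0 h1)[k0 k1].
have [f hf] := shom_of_killed (spar_v1 h0 : spar (false (+) ev) _) k0.
have [g hg] := shom_of_killed (spar_v1 h1 : spar (true (+) ev) _) k1.
by exists (f, g); rewrite /ev1 /= hf hg scalerDl.
Qed.

Lemma ev1_killed f : killedX (ev1 f).
Proof. by move=> z; rewrite scalerDr !shom_killed addr0. Qed.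

Lemma ev1_par b f a : par b a -> ev1 f = a *: v1 -> sEnd_par b f.
Proof.
move=> pa e; case: b pa => pa /=; apply: shom_v1_ext => /=.
  have [|h _] := @ev1_parts f 0 (a *: v1) (spar0 _ _) (spar_v1 pa); first by rewrite add0r.
  by rewrite h.
have [|_ h] := @ev1_parts f (a *: v1) 0 (spar_v1 pa) (spar0 _ _); first by rewrite addr0.
by rewrite h.
Qed.

(* The sign of the product of the opposite algebra cancels the one of the sign rule. *)
Lemma ev1M (f g : sEndop Q) a : ev1 f = a *: v1 -> ev1 (f * g) = a *: ev1 g.
Proof.
have [a0 [a1 [h0 h1 ->]]] := A_split a; rewrite scalerDl.
move=> /(ev1_parts (spar_v1 h0) (spar_v1 h1))[e0 e1].
rewrite /ev1 /= e0 e1 !shom_v1 !(twist_par _ h0) !(twist_par _ h1) /= expr0 expr1.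
rewrite !mul1r mulN1r scaleNr opprK !scalerDl !scalerDr -!addrA; congr (_ + _).
by rewrite addrCA; congr (_ + _); rewrite addrC.
Qed.

Variables (dl : nat) (pi : 'I_dl -> bool) (bt : bool) (u w : 'I_dl -> A).
Hypotheses (u_par : forall i, par (pi i (+) bt) (u i)) (w_par : forall i, par (pi i (+) bt) (w i))
  (w_killed : forall i z, X z * w i = 0) (uw : \sum_i u i * w i = 1)
  (wu : forall i j, (w i * u j) *: v1 = if i == j then v1 else 0).

Lemma killed_w i a : killedX ((w i * a) *: v1).
Proof. by move=> z; rewrite scalerA mulrA w_killed mul0r scale0r. Qed.

Lemma w_key i : S * (t * w i) = w i.
Proof. by apply: (key (V := A^o)) => z; exact: w_killed. Qed.

(** The difference of [w i * u k] and the Kronecker delta annihilates [v1], hence [S], hence y = S t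
    y. *)
Lemma wu_killed i k (y : Q) : killedX y -> (w i * u k) *: y = if i == k then y else 0.
Proof.
move=> hy; have : (w i * u k - (i == k)%:R) *: v1 = 0.
  by rewrite scalerBl wu scaler_nat; case: eqP => _; rewrite ?subrr ?subr0.
move=> /v1_eq0 h; have : (w i * u k - (i == k)%:R) *: y = 0.
  by rewrite -[y]key // scalerA h scale0r.
by move=> /eqP; rewrite scalerBl scaler_nat subr_eq0 => /eqP ->; case: eqP.
Qed.

(* Evaluation at v1 identifies End(Q)^op with the killed vectors of Q, and
   1 = sum_i u_i w_i splits A into copies of it: a goes to the matrix (w_i a u_j). *)
Lemma end_matrix_iso : salg_iso A (smx (sEndop Q) pi).
Proof.
(* [G] inverts evaluation at [v1], with default 0 where q v1 is not killed; the entries w_i a u_j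
   are always killed. *)
have /choice[G hG] (q : A) : exists f, killedX (q *: v1) -> ev1 f = q *: v1.
  have [h|h] := pselect (killedX (q *: v1)); last by exists 0.
  by have [f hf] := ev1_surj h; exists f.
have GE i a b : ev1 (G (w i * a * b)) = (w i * a * b) *: v1.
  by apply: hG; rewrite -mulrA; exact: killed_w.
pose F (a : A) : smx (sEndop Q) pi := \matrix_(i, j) G (w i * a * u j).
have FE a i j : F a i j = G (w i * a * u j) by rewrite mxE.
have FB : zmod_morphism F.
  move=> a b; apply/matrixP => i j; rewrite !mxE; apply: ev1_inj.
  apply: (addIr (ev1 (G (w i * b * u j)))); rewrite -[RHS]ev1D subrK !GE.
  by rewrite -scalerDl mulrBr mulrBl subrK.
have FM : monoid_morphism F.
  split=> [|a b]; apply/matrixP => i j; rewrite !mxE; apply: ev1_inj.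
    rewrite GE mulr1 wu; case: eqP => _; last by rewrite ev10.
    by rewrite mulr1n -(rmorph1 algC) ev1C rmorph1 scale1r.
  rewrite ev1_sum GE; have e k : ev1 (F a i k * F b k j) =
      (w i * a * (u k * w k) * (b * u j)) *: v1.
    by rewrite (@ev1M _ _ (w i * a * u k)) ?FE ?GE // scalerA !mulrA.
  rewrite (eq_bigr _ (fun k _ => e k)) -scaler_suml -mulr_suml -mulr_sumr uw mulr1.
  by rewrite !mulrA.
pose F1 := GRing.isZmodMorphism.Build A (smx (sEndop Q) pi) F FB.
pose F2 := GRing.isMonoidMorphism.Build A (smx (sEndop Q) pi) F FM.
pose f : {rmorphism A -> smx (sEndop Q) pi} := HB.pack F F1 F2.
(* Inserting 1 = sum_i u_i w_i on the left gives a u_j v1 = 0, so a u_j S = 0. Then a u_j w_j = a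
   u_j S t w_j = 0, and summing over j gives a = 0. *)
have f_inj a : F a = 0 -> a = 0.
  move=> Fa0; have z i j : (w i * a * u j) *: v1 = 0.
    by rewrite -GE -FE Fa0 mxE ev10.
  have z' j : a * u j * S = 0.
    apply/v1_eq0; rewrite -[a]mul1r -uw mulr_suml mulr_suml scaler_suml big1 // => i _.
    by rewrite -!mulrA -scalerA mulrA z scaler0.
  rewrite -[a]mulr1 -uw mulr_sumr big1 // => j _.
  by rewrite -w_key !mulrA z' !mul0r.
(* Writing each entry, evaluated at [v1], as q_kl v1, the preimage is the sum of the u_k q_kl
   w_l. *)
have f_surj N : exists a, F a = N.
  have /choice[q hq] (kl : 'I_dl * 'I_dl) : exists q, ev1 (N kl.1 kl.2) = q *: v1.
    by have [q hq] := Q_gen (ev1 (N kl.1 kl.2)); exists q.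
  exists (\sum_k \sum_l u k * q (k, l) * w l).
  apply/matrixP => i j; rewrite FE; apply: ev1_inj; rewrite GE.
  rewrite mulr_sumr mulr_suml scaler_suml (bigD1 i) //= [X in _ + X]big1 ?addr0; last first.
    move=> k /negPf ki; rewrite mulr_sumr mulr_suml scaler_suml big1 // => l _.
    have -> : w i * (u k * q (k, l) * w l) * u j = (w i * u k) * (q (k, l) * (w l * u j)).
      by rewrite !mulrA.
    rewrite -scalerA -[(q _ * _) *: _]scalerA wu; case: eqP => _; last by rewrite !scaler0.
    by rewrite -(hq (k, l)) wu_killed; [rewrite eq_sym ki|exact: ev1_killed].
  rewrite mulr_sumr mulr_suml scaler_suml (bigD1 j) //= [X in _ + X]big1 ?addr0; last first.
    move=> l /negPf lj.
    have -> : w i * (u i * q (i, l) * w l) * u j = (w i * u i) * (q (i, l) * (w l * u j)).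
      by rewrite !mulrA.
    by rewrite -scalerA -[(q _ * _) *: _]scalerA wu lj !scaler0.
  have -> : w i * (u i * q (i, j) * w j) * u j = (w i * u i) * (q (i, j) * (w j * u j)).
    by rewrite !mulrA.
  rewrite -scalerA -[(q _ * _) *: _]scalerA wu eqxx -(hq (i, j)).
  by rewrite wu_killed ?eqxx //; exact: ev1_killed.
have f_par b a : par b a -> smx_par b (F a).
  move=> pa i j; rewrite FE; apply: ev1_par (GE _ _ _).
  have := parM _ _ _ _ (parM _ _ _ _ (w_par i) pa) (u_par j).
  by apply: par_parity; case: (pi i) (pi j) b (bt) {pa} => [] [] [] [].
have par_disj b (N : smx (sEndop Q) pi) : smx_par b N -> smx_par (~~ b) N -> N = 0.
  move=> h h'; apply/matrixP => i j; rewrite mxE; have := h i j; have := h' i j.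
  rewrite addNb /par /=; case: (b (+) _) => /= h1 h2;
    by change (N i j = 0 :> sEnd Q); apply: sEndP => x; rewrite ?h1 ?h2.
exists f; split.
- have /choice[g hg] := f_surj; exists g => a; last exact: hg.
  apply/eqP; rewrite -subr_eq0; apply/eqP/f_inj.
  by rewrite FB hg subrr.
- move=> c; apply/matrixP => i j; rewrite FE [RHS]mxE; apply: ev1_inj; rewrite GE.
  rewrite -algC_comm -mulrA -scalerA wu; case: eqP => _; last by rewrite scaler0 ev10.
  by rewrite ev1C.
move=> b a; split; first exact: f_par.
(* Parity is reflected because the component of [a] of the wrong parity has an image of both
   parities, hence zero, and [F] is injective. *)
have [a0 [a1 [h0 h1 ->]]] := A_split a.
have FD : F (a0 + a1) = F a0 + F a1 by exact: (rmorphD f).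
move=> h; have {}h : smx_par b (F a0 + F a1) by rewrite -FD.
have parB (x y : smx (sEndop Q) pi) : smx_par b (x + y) -> smx_par b y -> smx_par b x.
  by move=> hx hy; rewrite -[x](addrK y); apply: smx_parD => //; exact: parN1.
case: b h parB => h parB.
  have /f_inj -> : F a0 = 0; last by rewrite add0r.
  by apply: (par_disj true); [apply: parB h _|]; exact: f_par.
have /f_inj -> : F a1 = 0; last by rewrite addr0.
by apply: (par_disj false); [apply: (parB _ (F a0)); [rewrite addrC|]|]; try exact: f_par.
Qed.
End EndMatrix.

(** A spanning family of minimal size is independent, as a relation with [d i0] nonzero allows
    [e i0] to be dropped. This serves the case 1 = 0 in A, where independence of the monomials
    cannot be read off from s. *)
Lemma homog_basis_of_span (K : fieldType) (B : salgType K) (n : nat)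
  (pi : 'I_n -> bool) (e : 'I_n -> B) :
  (forall i, par (pi i) (e i)) -> (forall b, exists c : 'I_n -> K, b = \sum_i algC (c i) * e i) ->
  exists (dl : nat) (pi' : 'I_dl -> bool) (e' : 'I_dl -> B), homog_basis pi' e'.
Proof.
move=> hp hs; pose P m := `[< exists (pi : 'I_m -> bool) (e : 'I_m -> B),
  (forall i, par (pi i) (e i)) /\
  (forall b, exists c : 'I_m -> K, b = \sum_i algC (c i) * e i) >].
have exP : exists m, P m by exists n; apply/asboolP; exists pi, e.
case: (ex_minnP exP) => m /asboolP[{hp hs} {}pi [{}e [hp hs]]] mmin.
exists m, pi, e; split=> // x; have [c hc] := hs x.
have indep (d : 'I_m -> K) : \sum_i algC (d i) * e i = 0 -> forall i, d i = 0.
  move=> d0 i0; apply/eqP; apply: contraT => di0.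
  case: m pi e hp hs c hc d d0 i0 di0 mmin => [|m] pi e hp hs _ _ d d0 i0 di0 mmin.
    by have := ltn_ord i0; rewrite ltn0.
  suff /mmin : P m by rewrite ltnn.
  apply/asboolP; exists (fun i => pi (lift i0 i)), (fun i => e (lift i0 i)); split=> // b.
  have [c ->] := hs b; exists (fun i => c (lift i0 i) - c i0 / d i0 * d (lift i0 i)).
  have : \sum_i algC (c i) * e i = \sum_i algC (c i - c i0 / d i0 * d i) * e i.
    transitivity (\sum_i algC (c i) * e i - algC (c i0 / d i0) * (\sum_i algC (d i) * e i)).
      by rewrite d0 mulr0 subr0.
    rewrite mulr_sumr -sumrB.
    by move: (c i0 / d i0) => r; apply: eq_bigr => i _; rewrite rmorphB rmorphM mulrBl mulrA.
  by move=> ->; rewrite (bigD1_ord i0) //= divfK // subrr rmorph0 mul0r add0r.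
exists [ffun i => c i]; split; first by rewrite {1}hc; apply: eq_bigr => i _; rewrite ffunE.
move=> c' hc'; apply/ffunP => i; rewrite ffunE; apply/eqP; rewrite -subr_eq0; apply/eqP.
apply: (indep (fun i => c i - c' i)); rewrite (eq_bigr (fun i => algC (c i) * e i - algC (c' i) * e i)).
  by rewrite sumrB -hc -hc' subrr.
by move=> k _; rewrite rmorphB mulrBl.
Qed.

(** * Whittaker vectors *)

Section Whittaker.
Variables (K : fieldType) (A B : salgType K) (j : {rmorphism B -> A}) (T : eqType).
Variables (xi : T -> B) (odd_gen : T -> bool) (height : T -> nat) (its : seq T).
Hypothesis xi_comm : forall pre z suf z', its = pre ++ z :: suf -> z' \in its ->
  lin_span xi pre (xi z' * xi z - (-1) ^+ (odd_gen z' && odd_gen z) * (xi z * xi z')).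
Hypothesis xi_height : forall pre z suf, its = pre ++ z :: suf ->
  lin_span xi pre (xi z ^+ height z).
Hypothesis B_gen : forall P : B -> Prop, (forall c, P (algC c)) ->
  (forall z, z \in its -> P (xi z)) -> (forall x y, P x -> P y -> P (x + y)) ->
  (forall x y, P x -> P y -> P (x * y)) -> forall x, P x.
Hypothesis height_gt0 : forall z, (0 < height z)%N.
Hypothesis xi_par : forall z, par (odd_gen z) (xi z).
Hypothesis jC : forall c, j (algC c) = algC c.
Hypothesis j_par : forall b x, par b x -> par b (j x).
Variable sigma : {rmorphism A -> A}.
Hypothesis sigma_par : forall b x, par b x -> sigma x = (-1) ^+ b * x.
Hypothesis A_split : forall a : A, exists a0 a1, [/\ par false a0, par true a1 & a = a0 + a1].
Hypothesis A_disjoint : forall a : A, par false a -> par true a -> a = 0.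
Local Notation s := (mtop xi height its).
Variables (t : A) (bt : bool).
Hypothesis t_par : par bt t.
Definition whit (V : lmodType A) (w : V) := forall z, z \in its -> j (xi z) *: w = 0.
(* With w = v the generator of Q this makes Q -> A, a v |-> a s, a split injection. *)
Hypothesis key : forall (V : lmodType A) (w : V), whit w -> j s *: (t *: w) = w.

Lemma xi_s z : z \in its -> xi z * s = 0.
Proof.
move=> zi; have h := @killed_mtop K B T xi odd_gen height its xi_comm xi_height height_gt0
  B (fun a b => a * b) (fun a b c => mulrDl a b c) (fun a b c => mulrDr a b c)
  (fun a b c => esym (mulrA a b c)) (fun a => mul1r a) its [::] 1.
by have := h (esym (cats0 _)) z zi; rewrite mulr1.
Qed.

Lemma mtop_par suf : exists b, par b (mtop xi height suf).
Proof.
elim: suf => [|z suf [b hb]] /=.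
  by exists false; rewrite -(rmorph1 algC); exact: parC.
by exists (b (+) (odd_gen z && odd (height z).-1)); apply: parM => //; exact: parX.
Qed.

Lemma monomial_par suf (a : mindex height suf) : par (mparity odd_gen a) (monomial xi a).
Proof.
elim: suf a => [|z suf IH] a /=; first by rewrite -(rmorph1 algC); exact: parC.
by apply: parM => //; exact: parX.
Qed.

Variable M : supermod B.
Hypothesis simpleM : simple_supermod M.

(** An argument of Engel type: in each kernel the last nonzero power of the next xi gives a
    homogeneous vector in the following kernel. The line through the final vector is a graded
    submodule, so it is all of [M]. *)
Lemma weight_vector : exists v e, [/\ v <> 0 :> M, spar e v,
  forall z, z \in its -> xi z *: v = 0 & forall m, exists c, m = algC c *: v].
Proof.
have [dM [x x0] hM] := simpleM.
pose kil pre (v : M) := killed xi (fun b v => b *: v) pre v.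
have step suf pre : its = pre ++ suf ->
    (exists v e, [/\ v <> 0, spar e v & kil pre v]) ->
    exists v e, [/\ v <> 0, spar e v & kil its v].
  elim: suf pre => [|z suf IH] pre e; first by rewrite cats0 in e; rewrite -e.
  move=> [v [b [v0 hv kv]]]; apply: (IH (rcons pre z)); first by rewrite cat_rcons.
  have zi : z \in its by rewrite e mem_cat mem_head orbT.
  have ex : exists k, xi z ^+ k *: v == 0.
    exists (height z); apply/eqP.
    by apply: (killed_span _ _ _ (xi_height e) kv) => *; rewrite ?scalerDl ?scalerDr ?scalerA.
  case: (ex_minnP ex) => -[|k] /eqP hk mk.
    by case: v0; rewrite -[v]scale1r -(expr0 (xi z)).
  exists (xi z ^+ k *: v), ((odd_gen z && odd k) (+) b); split.
  - by move=> /eqP /mk; rewrite ltnn.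
  - by apply: sparZ => //; exact: parX.
  move=> y; rewrite mem_rcons inE => /orP[/eqP ->|yp]; first by rewrite scalerA -exprS.
  apply: (killed_opX xi_comm _ _ _ _ _ e zi kv) => // *;
    by rewrite ?scalerDl ?scalerDr ?scalerA ?scale1r.
have [|v [b [v0 hv kv]]] := step its [::] erefl.
  have [y [z [hy hz xE]]] := @spar_split K B M false x dM.
  have [y0|/eqP y0] := eqVneq y 0; last by exists y, false.
  exists z, true; split => // z0; apply: x0; by rewrite xE y0 z0 addr0.
exists v, b; split => //.
pose N (m : M) := exists c, m = algC c *: v.
have NB a m : N m -> N (a *: m).
  move=> [c ->]; elim/B_gen: a c => [c'|z zi|a a' ha ha'|a a' ha ha'] c.
  - by exists (c' * c); rewrite scalerA rmorphM.
  - by exists 0; rewrite scalerA -algC_comm -scalerA kv // scaler0 rmorph0 scale0r.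
  - have [c1 e1] := ha c; have [c2 e2] := ha' c; exists (c1 + c2).
    by rewrite rmorphD !scalerDl e1 e2.
  - by have [c2 e2] := ha' c; rewrite -scalerA e2; exact: ha.
have [||||h|//] := hM N.
- by exists 0; rewrite rmorph0 scale0r.
- by move=> m m' [c ->] [c' ->]; exists (c + c'); rewrite rmorphD scalerDl.
- exact: NB.
- move=> y z hy hz [c e].
  have hc : spar b (algC c *: v) by rewrite -[b]/(false (+) b); apply: sparZ => //; exact: parC.
  have N0 : N 0 by exists 0; rewrite rmorph0 scale0r.
  have Nc : N (algC c *: v) by exists c.
  case: b hc {hv} => hc.
    have [|-> ->//] := @spar_unique K B M false y z 0 (algC c *: v) dM hy hz (spar0 _ _) hc.
    by rewrite add0r.
  have [|-> ->//] := @spar_unique K B M false y z (algC c *: v) 0 dM hy hz hc (spar0 _ _).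
  by rewrite addr0.
by case: v0; apply: h; exists 1; rewrite rmorph1 scale1r.
Qed.
Local Notation mcard := #|mindex height its|.
Let mono (i : 'I_mcard) : B := monomial xi (enum_val i).
Let mono_odd (i : 'I_mcard) : bool := mparity odd_gen (enum_val i : mindex height its).

Lemma sum_mcard (V : zmodType) (F : mindex height its -> V) :
  \sum_(i < mcard) F (enum_val i) = \sum_a F a.
Proof. by rewrite [RHS](reindex _ (onW_bij _ (enum_val_bij _))). Qed.

Lemma mono_par i : par (mono_odd i) (mono i).
Proof. exact: monomial_par. Qed.

Lemma mono_spanning b : exists c : 'I_mcard -> K, b = \sum_i algC (c i) * mono i.
Proof.
have [c ->] := monomial_spanning xi_comm xi_height B_gen b.
by exists (fun i => c (enum_val i)); rewrite -sum_mcard.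
Qed.

Definition whit_elt (a : A) := forall z, z \in its -> j (xi z) * a = 0.

Lemma key_elt a : whit_elt a -> j s * (t * a) = a.
Proof. by move=> h; apply: (key (V := A^o)) => z; exact: h. Qed.

Lemma free_mono :
  (forall a : A, exists2 w : 'I_mcard -> A, forall i, whit_elt (w i) &
     a = \sum_i j (mono i) * (t * w i)) /\
  (forall w : 'I_mcard -> A, (forall i, whit_elt (w i)) ->
     \sum_i j (mono i) * (t * w i) = 0 -> forall i, w i = 0).
Proof.
have [hex hu] := @killed_free K B T xi odd_gen height its xi_comm xi_height height_gt0 A
  (fun b a => j b * a) (fun a b c => etrans (congr1 ( *%R^~ c) (rmorphD j a b)) (mulrDl _ _ _))
  (fun a b c => mulrDr (j a) b c)
  (fun a b c => etrans (congr1 ( *%R^~ c) (rmorphM j a b)) (esym (mulrA _ _ _)))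
  (fun a => etrans (congr1 ( *%R^~ a) (rmorph1 j)) (mul1r a))
  (t \*o idfun : {additive A -> A}) key_elt its [::] erefl.
have E (w : mindex height its -> A) :
    \sum_a j (monomial xi a) * (j (mtop xi height [::]) * (t * w a)) =
    \sum_i j (mono i) * (t * w (enum_val i)).
  rewrite -(sum_mcard (fun a => j (monomial xi a) * (j (mtop xi height [::]) * (t * w a)))).
  by apply: eq_bigr => i _; rewrite /= rmorph1 mul1r.
split=> [a|w hw].
  have [|w hw ->] := hex a; first by [].
  by exists (fun i => w (enum_val i)) => [i|]; [exact: hw|exact: E].
move=> h0 i; have := hu (fun a => w (enum_rank a)) (fun a => hw _).
rewrite [X in X = 0 -> _]E => h; have := h _ (enum_val i); rewrite enum_valK; apply.
by rewrite -[RHS]h0; apply: eq_bigr => k _; rewrite enum_valK.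
Qed.

Lemma whit_elt_js a : whit_elt (j s * a).
Proof. by move=> z zi; rewrite mulrA -rmorphM xi_s // rmorph0 mul0r. Qed.

Lemma js_par : exists b, par b (j s).
Proof. by have [b hb] := mtop_par its; exists b; exact: j_par. Qed.

Lemma whit_eltZ c a : whit_elt a -> whit_elt (algC c * a).
Proof. by move=> ha z zi; rewrite mulrA -algC_comm -mulrA ha // mulr0. Qed.

(** If j s were 0, every killed w = s t w would vanish, and so would 1. Multiplying a relation
    between monomials by t s on the right then contradicts their freeness over the killed
    elements. *)
Lemma mono_basis : (1 : A) <> 0 -> homog_basis mono_odd mono.
Proof.
move=> A1; split=> [|x]; first exact: mono_par.
have s0 : j s <> 0.
  move=> s0; case: A1; have [w hw ->] := free_mono.1 1; apply: big1 => i _.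
  by rewrite -[w i](key_elt (hw i)) s0 mul0r !mulr0.
have [c hc] := mono_spanning x; exists [ffun i => c i]; split.
  by rewrite {1}hc; apply: eq_bigr => i _; rewrite ffunE.
move=> c' hc'; apply/ffunP => i; rewrite ffunE; apply/eqP; rewrite -subr_eq0.
apply: contraT => ci; case: s0.
have h0 : \sum_i j (mono i) * (t * (algC (c i - c' i) * j s)) = 0.
  transitivity (j (\sum_i algC (c i - c' i) * mono i) * (t * j s)).
    rewrite raddf_sum mulr_suml; apply: eq_bigr => k _ /=.
    by rewrite rmorphM jC -mulrA !algC_mulCA.
  rewrite (eq_bigr (fun i => algC (c i) * mono i - algC (c' i) * mono i)).
    by rewrite sumrB -hc -hc' subrr rmorph0 mul0r.
  by move=> k _; rewrite rmorphB mulrBl.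
have hk k : whit_elt (algC (c k - c' k) * j s).
  by apply: whit_eltZ; rewrite -[j s]mulr1; exact: whit_elt_js.
have := free_mono.2 _ hk h0 i => h.
by rewrite -[j s]mul1r -(rmorph1 algC) -(mulVf ci) rmorphM -mulrA h mulr0.
Qed.

(* Homogeneous components of the coordinates of 1 are again coordinates of 1. *)
Lemma mono_dual : exists w : 'I_mcard -> A,
  [/\ forall i, par (mono_odd i (+) bt) (w i), forall i, whit_elt (w i),
      \sum_i (j (mono i) * t) * w i = 1 &
      forall i k, w i * (j (mono k) * t) * j s = if i == k then j s else 0].
Proof.
have [w hw w1] := free_mono.1 1.
have /choice[f hf] i : exists y : A * A, [/\ par (mono_odd i (+) bt) y.1,
    par (~~ (mono_odd i (+) bt)) y.2, w i = y.1 + y.2, whit_elt y.1 & whit_elt y.2].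
  have [a0 [a1 [h0 h1 e]]] := A_split (w i).
  have [k0 k1] : whit_elt a0 /\ whit_elt a1.
    have k z : z \in its -> j (xi z) * a0 = 0 /\ j (xi z) * a1 = 0.
      move=> zi; have := hw i z zi; rewrite e mulrDr => ee.
      have ee' : j (xi z) * a0 = - (j (xi z) * a1) by apply/eqP; rewrite -addr_eq0 ee.
      have p0 := parM _ _ _ _ (j_par (xi_par z)) h0.
      have p1 := parM _ _ _ _ (j_par (xi_par z)) h1.
      have z1 : j (xi z) * a1 = 0.
        have := parN1 p0; rewrite ee' opprK => p0'.
        by move: p0' p1; case: (odd_gen z) => /= p0' p1; exact: A_disjoint.
      by rewrite z1 ee' z1 oppr0.
    by split=> z /k[].
  case: (mono_odd i (+) bt) => /=; first by exists (a1, a0); rewrite /= addrC.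
  by exists (a0, a1).
exists (fun i => (f i).1).
have p1 i : par (mono_odd i (+) bt) (f i).1 by case: (hf i).
have p2 i : par (~~ (mono_odd i (+) bt)) (f i).2 by case: (hf i).
have wE i : w i = (f i).1 + (f i).2 by case: (hf i).
have k1 i : whit_elt (f i).1 by case: (hf i).
have u_par i : par (mono_odd i (+) bt) (j (mono i) * t).
  by apply: parM => //; apply/j_par/mono_par.
have one : \sum_i (j (mono i) * t) * (f i).1 = 1.
  have e : 1 = \sum_i (j (mono i) * t) * (f i).1 + \sum_i (j (mono i) * t) * (f i).2.
    by rewrite w1 -big_split; apply: eq_bigr => i _ /=; rewrite -mulrDr -wE mulrA.
  have q0 : par false (\sum_i (j (mono i) * t) * (f i).1).
    apply: par_sum => i; apply: par_parity (parM _ _ _ _ (u_par i) (p1 i)).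
    by rewrite addbb.
  have q1 : par true (\sum_i (j (mono i) * t) * (f i).2).
    apply: par_sum => i; apply: par_parity (parM _ _ _ _ (u_par i) (p2 i)).
    by case: (_ (+) bt).
  have z : \sum_i (j (mono i) * t) * (f i).2 = 0.
    apply: A_disjoint q1; rewrite -[X in par _ X](addKr (\sum_i (j (mono i) * t) * (f i).1)) -e.
    rewrite addrC; apply: parD; last exact: parN1.
    by rewrite -(rmorph1 algC); exact: parC.
  by rewrite [RHS]e z addr0.
split=> // i k.
(* Freeness applies to killed coefficients only, and 1 is not one of them in general; after
   multiplication by s both sides of w_i u_k = delta_ik are killed. *)
pose g i := (f i).1 * (j (mono k) * t) * j s - (if i == k then j s else 0).
have hg l : whit_elt (g l).
  move=> z zi; rewrite mulrBr !mulrA k1 // !mul0r sub0r; case: eqP => _; rewrite ?mulr0 ?oppr0 //.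
  by rewrite -rmorphM xi_s // rmorph0 oppr0.
have : \sum_l j (mono l) * (t * g l) = 0.
  rewrite (eq_bigr (fun l => (j (mono l) * t) * (f l).1 * (j (mono k) * t) * j s -
    (if l == k then (j (mono k) * t) * j s else 0))); last first.
    move=> l _; rewrite /g !mulrBr !mulrA; congr (_ - _).
    by case: eqP => [->|_]; rewrite ?mulr0.
  by rewrite sumrB -!mulr_suml one mul1r -big_mkcond big_pred1_eq subrr.
by move=> /(free_mono.2 _ hg) /(_ i) /eqP; rewrite subr_eq0 => /eqP.
Qed.

(** * The induced module Q *)

Section Induced.
Variables (v : M) (ev : bool).
Hypotheses (v_neq0 : v <> 0) (v_par : spar ev v)
  (v_kill : forall z, z \in its -> xi z *: v = 0)
  (v_span : forall m, exists c, m = algC c *: v).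
Let Q := ind_supermod j M.
Let v1 : Q := tens j 1 v.
Local Notation js := (j s).

Lemma M_direct : spar_direct M. Proof. by case: simpleM. Qed.

Lemma algC_v_inj c : algC c *: v = 0 -> c = 0.
Proof.
move=> h; apply/eqP; apply: contraT => c0; case: v_neq0.
by rewrite -[v]scale1r -(rmorph1 algC) -(mulVf c0) rmorphM -scalerA h scaler0.
Qed.

Lemma whit_s (V : lmodType A) (m : V) : whit (js *: m).
Proof. by move=> z zi; rewrite scalerA -rmorphM xi_s // rmorph0 scale0r. Qed.

(** Every xi annihilates both v and s, so [B] acts on the two by the same character; this makes a
    (x) v -> a s balanced. *)
Lemma B_weight b : exists c, b *: v = algC c *: v /\ b * s = algC c * s.
Proof.
elim/B_gen: b => [c|z zi|x y [c [h1 h2]] [c' [h1' h2']]|x y [c [h1 h2]] [c' [h1' h2']]].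
- by exists c.
- by exists 0; rewrite rmorph0 scale0r mul0r v_kill // xi_s.
- by exists (c + c'); rewrite rmorphD !scalerDl !mulrDl h1 h2 h1' h2'.
- exists (c * c'); split.
    by rewrite -scalerA h1' scalerA -algC_comm -scalerA h1 scalerA -rmorphM mulrC.
  by rewrite -mulrA h2' mulrA -algC_comm -mulrA h2 mulrA -rmorphM mulrC.
Qed.

Lemma aug_ex : exists coef : M -> K, forall m, m = algC (coef m) *: v.
Proof. by have /choice[f hf] := v_span; exists f. Qed.

Lemma tens_v (x : Q) : exists a, x = a *: v1.
Proof.
elim/tens_ind: x => [|a m|x y [a ->] [b ->]].
- by exists 0; rewrite scale0r.
- have [c ->] := v_span m; exists (a * j (algC c)).
  by rewrite scale_tens mulr1 tensM.
- by exists (a - b); rewrite scalerBl.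
Qed.

Lemma whit_v1 : whit v1.
Proof.
move=> z zi; rewrite scale_tens mulr1 -[j (xi z)]mul1r tensM v_kill //.
by apply: (addrI (tens j 1 (0 : M))); rewrite -tensDr !addr0.
Qed.

(* The map a (x) v |-> a s is well defined since xi s = 0. *)
Lemma tens_v_s : exists psi : Q -> A, forall a, psi (a *: v1) = a * js.
Proof.
have [coef hcoef] := aug_ex.
have coefE m c : m = algC c *: v -> coef m = c.
  move=> e; apply/eqP; rewrite -subr_eq0; apply/eqP/algC_v_inj.
  by rewrite rmorphB scalerBl -hcoef -e subrr.
pose f (k : A * M) := k.1 * algC (coef k.2) * js.
exists (fun x => zlift f (trepr x)) => a; rewrite scale_tens mulr1.
have -> : zlift f (trepr (tens j a v)) = zlift f << (a, v) >>%R.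
  apply/eqP; rewrite -subr_eq0 -raddfB; apply/eqP.
  have : tens_span j (trepr (tpi j (M := M) << (a, v) >>) - << (a, v) >>)%R.
    by apply/tpiP; rewrite treprK.
  elim=> [|y hy|y z _ hy _ hz]; first exact: raddf0; last by rewrite raddfB /= hy hz subr0.
  case: hy => [a1 a2 m|a1 m m'|a1 b m].
  - by rewrite raddfB raddfD /= !zliftU /f /= -!mulrDl subrr.
  - rewrite raddfB raddfD /= !zliftU /f /= -mulrDl -mulrDr -rmorphD.
    rewrite (coefE _ (coef m + coef m')) ?subrr //.
    by rewrite rmorphD scalerDl -!hcoef.
  - rewrite raddfB /= !zliftU /f /=; have [c [h1 h2]] := B_weight b.
    rewrite (coefE (b *: m) (coef m * c)).
      rewrite -algC_comm -!mulrA -rmorphM h2 rmorphM jC rmorphM !mulrA.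
      by rewrite -(algC_comm _ a1) subrr.
    by rewrite {1}(hcoef m) scalerA -algC_comm -scalerA h1 scalerA -rmorphM.
by rewrite zliftU /f /= (coefE v 1) ?rmorph1 ?mulr1 ?scale1r.
Qed.

(** One direction is the map to [A]; the other is v1 = s t v1. *)
Lemma v1_eq0 a : a *: v1 = 0 <-> a * js = 0.
Proof.
split=> [h|h]; last by rewrite -[in LHS](key whit_v1) [LHS]scalerA h scale0r.
by have [psi hpsi] := tens_v_s; rewrite -hpsi h -(scale0r v1) hpsi mul0r.
Qed.

Lemma spar_v1 b a : par b a -> spar (b (+) ev) (a *: v1).
Proof. by move=> pa; rewrite scale_tens mulr1; exact: ind_par_tens. Qed.

Lemma spar_v1_ex b (x : Q) : spar b x -> exists2 a, par (b (+) ev) a & x = a *: v1.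
Proof.
elim=> {b x} [b|b b' a m pa pm|b x y _ [a pa ->] _ [a' pa' ->]].
- by exists 0; [exact: par0|rewrite scale0r].
- have [c hc] := v_span m; have [bb|bb] := eqVneq b' ev.
    exists (algC c * a); last by rewrite hc scale_tens mulr1 -tensM jC algC_comm.
    apply: (@par_parity _ _ (false (+) b)); first by rewrite bb -addbA addbb addbF.
    by apply: parM => //; exact: parC.
  (* As a multiple of [v], [m] also has parity [ev], which differs from [b']. *)
  have -> : m = 0.
    apply: (spar_disjoint M_direct pm); rewrite hc; apply: (@sparZ _ _ M false); first exact: parC.
    by move: v_par; case: b' ev bb {pm hc} => [] [].
  exists 0; first exact: par0.
  by rewrite scale0r; apply: (addrI (tens j a (0 : M))); rewrite -tensDr !addr0.
- by exists (a + a'); [exact: parD|rewrite scalerDl].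
Qed.

(** A vector of both parities is a v1 = a' v1 with a and a' of opposite parities; then a s = a' s
    has both parities in [A] and vanishes. *)
Lemma Q_direct : spar_direct Q.
Proof.
apply: spar_directI => [x|x hx hx'].
  have [a ->] := tens_v x; have [a0 [a1 [h0 h1 ->]]] := A_split a.
  have s0 := spar_v1 h0; have s1 := spar_v1 h1; rewrite scalerDl.
  case: ev s0 s1 => s0 s1; last by exists (a0 *: v1), (a1 *: v1).
  by exists (a1 *: v1), (a0 *: v1); rewrite addrC.
have [a pa ea] := spar_v1_ex hx; have [a' pa' ea'] := spar_v1_ex hx'.
have [b hb] := js_par; rewrite ea; apply/v1_eq0.
have e : a * js = a' * js.
  apply/eqP; rewrite -subr_eq0 -mulrBl; apply/eqP/v1_eq0.
  by rewrite scalerBl -ea -ea' subrr.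
have := parM _ _ _ _ pa hb; have := parM _ _ _ _ pa' hb; rewrite -e.
by case: ev b {pa pa' hb} => [] [] /= h1 h2; exact: A_disjoint.
Qed.

(** The sign rule as a ring endomorphism, so that it also makes sense on inhomogeneous elements. *)
Definition twist (i : bool) (a : A) := if i then sigma a else a.

Lemma twist_par i b a : par b a -> twist i a = (-1) ^+ (i && b) * a.
Proof. by case: i => /= pa; rewrite ?mul1r // (sigma_par pa). Qed.

Lemma twistD i a b : twist i (a + b) = twist i a + twist i b.
Proof. by case: i; rewrite //= rmorphD. Qed.
Lemma twistM i a b : twist i (a * b) = twist i a * twist i b.
Proof. by case: i; rewrite //= rmorphM. Qed.

Lemma par_sign b i (a : A) : par b a -> par b ((-1) ^+ i * a).
Proof.
rewrite -signr_odd; case: (odd i) => /=; rewrite ?expr0 ?mul1r // expr1 mulN1r; exact: parN1.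
Qed.

Lemma shom_v1 i (N : supermod A) (f : shom i Q N) a : f (a *: v1) = twist i a *: f v1.
Proof.
have [a0 [a1 [h0 h1 ->]]] := A_split a.
by rewrite scalerDl shomD (shomZ _ _ h0) (shomZ _ _ h1) twistD scalerDl
  (twist_par _ h0) (twist_par _ h1).
Qed.

Lemma shom_ext i (N : supermod A) (f g : shom i Q N) : f v1 = g v1 -> f = g.
Proof. by move=> e; apply: shomP => x; have [a ->] := tens_v x; rewrite !shom_v1 e. Qed.

Lemma whit_shom i (N : supermod A) (f : shom i Q N) : whit (f v1).
Proof.
move=> z zi; have := shomZ f v1 (j_par (xi_par z)); rewrite whit_v1 // shom0.
case: (i && _); rewrite ?expr0 ?mul1r // expr1 mulN1r scaleNr => /eqP.
by rewrite eq_sym oppr_eq0 => /eqP.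
Qed.

(** The map a v1 -> twist(a) w is well defined: a v1 = 0 gives a s = 0, so twist(a) s = 0 as s is
    homogeneous, and w = s t w. *)
Lemma shom_of_whit i (N : supermod A) (w : N) : spar (i (+) ev) w -> whit w ->
  exists f : shom i Q N, f v1 = w.
Proof.
move=> pw ww; have /choice[lift hlift] := tens_v.
have z0 a : a *: v1 = 0 -> twist i a *: w = 0.
  move=> /v1_eq0 h; have {h} : twist i a * js = 0.
    case: i {pw} => //=; have [b hb] := js_par.
    have := congr1 sigma h; rewrite rmorphM rmorph0 (sigma_par hb).
    case: b {hb}; rewrite ?mul1r // expr1 mulN1r mulrN => /eqP.
    by rewrite oppr_eq0 => /eqP.
  by move=> h; rewrite -(key ww) scalerA h scale0r.
have eqw a b : a *: v1 = b *: v1 -> twist i a *: w = twist i b *: w.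
  move=> /eqP; rewrite -subr_eq0 -scalerBl => /eqP /z0.
  have -> : twist i (a - b) = twist i a - twist i b by case: (i) => //=; rewrite rmorphB.
  by rewrite scalerBl => /eqP; rewrite subr_eq0 => /eqP.
pose f (x : Q) := twist i (lift x) *: w.
have fE a : f (a *: v1) = twist i a *: w by apply: eqw; rewrite -hlift.
have fD x y : f (x + y) = f x + f y.
  by rewrite (hlift x) (hlift y) -scalerDl !fE twistD scalerDl.
have fp b x : spar b x -> spar (i (+) b) (f x).
  move=> /spar_v1_ex[a pa ->]; rewrite fE (twist_par _ pa).
  have -> : i (+) b = (b (+) ev) (+) (i (+) ev) by case: (i) (b) (ev) => [] [] [].
  by apply: sparZ => //; exact: par_sign.
have fZ b a x : par b a -> f (a *: x) = ((-1) ^+ (i && b) * a) *: f x.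
  by move=> pa; rewrite (hlift x) scalerA !fE twistM (twist_par _ pa) scalerA.
exists (Shom fD fp fZ) => /=; rewrite -[v1]scale1r fE.
by case: (i); rewrite /= ?rmorph1 scale1r.
Qed.

(** If x lifts t f(v1), then s x is a Whittaker vector lifting s t f(v1) = f(v1); its component of
    parity [ev] is the image of v1 under the required lift. *)
Lemma Q_projective : projective_supermod Q.
Proof.
split; first exact: Q_direct.
move=> N1 N2 g f d1 d2 gs; have ww := whit_shom f.
have [x gx] := gs (t *: f v1).
have [y [y' [py py' e]]] := @spar_split _ _ _ ev (js *: x) d1.
have wy : whit y.
  move=> z zi; have := @whit_s _ x z zi; rewrite e scalerDr => h.
  have p1 := sparZ (j_par (xi_par z)) py; have p2 := sparZ (j_par (xi_par z)) py'.
  have p2' : spar (~~ (odd_gen z (+) ev)) (j (xi z) *: y').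
    by apply: spar_parity p2; case: (odd_gen z) (ev) => [] [].
  have [|//] := spar_unique d1 p1 p2' (spar0 _ _) (spar0 _ _).
  by rewrite h addr0.
have gy : g y = f v1.
  have hf : spar ev (f v1).
    by apply: (shom_par f); rewrite -[v1]scale1r -[ev]/(false (+) ev);
       apply: spar_v1; rewrite -(rmorph1 algC); exact: parC.
  have [|//] := spar_unique d2 (shom_par g py) (shom_par g py') hf (spar0 _ (~~ ev)).
  rewrite -shomD -e addr0; have [b hb] := js_par.
  by rewrite (shomZ _ _ hb) mul1r gx key.
have [h hv] := @shom_of_whit false N1 y py wy.
exists h => x'; have := @shom_ext false N2 (shom_comp g h) f; rewrite /= hv => /(_ gy) <-.
by [].
Qed.

Lemma Q_iso (dl : nat) (pi : 'I_dl -> bool) (u w : 'I_dl -> A) :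
  (forall i, par (pi i (+) bt) (u i)) -> (forall i, par (pi i (+) bt) (w i)) ->
  (forall i, whit_elt (w i)) -> \sum_i u i * w i = 1 ->
  (forall i k, w i * u k * js = if i == k then js else 0) ->
  salg_iso A (smx (sEndop Q) pi).
Proof.
move=> hu hw kw uw1 wu.
pose X (z : {z : T | z \in its}) := j (xi (val z)).
have killedP (V : lmodType A) (x : V) : killedX X x <-> whit x.
  by split=> [h z zi|h [z zi]]; [exact: (h (exist _ z zi))|exact: h].
have wu1 i k : (w i * u k) *: v1 = if i == k then v1 else 0.
  have [->|ik] := eqVneq i k; last by apply/v1_eq0; rewrite wu (negPf ik).
  apply/eqP; rewrite -subr_eq0 -[X in _ - X]scale1r -scalerBl; apply/eqP/v1_eq0.
  by rewrite mulrBl wu eqxx mul1r subrr.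
apply: (@end_matrix_iso K A _ X (fun z => odd_gen (val z)) _ A_split Q ev v1 twist js t
  Q_direct tens_v _ v1_eq0 _ _ _ _ _ dl pi bt u w hu hw _ uw1 wu1).
- by move=> z; exact: j_par.
- by move=> b a; exact: spar_v1.
- by move=> V x /killedP; exact: key.
- by move=> i b a; exact: twist_par.
- by move=> i f a; exact: shom_v1.
- by move=> i f; apply/killedP; exact: whit_shom.
- by move=> i x px /killedP; exact: shom_of_whit.
- by move=> i [z zi]; exact: kw.
Qed.
End Induced.

Theorem whittaker_equivalence :
  projective_supermod (ind_supermod j M) /\
  exists (delta : nat) (par_ix : 'I_delta -> bool) (e : 'I_delta -> B),
    homog_basis par_ix e /\ salg_iso A (smx (sEndop (ind_supermod j M)) par_ix).
Proof.
have [v [ev [v0 hv kv sv]]] := weight_vector.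
split; first exact: Q_projective v0 hv kv sv.
have [A0|/eqP A1] := eqVneq (1 : A) 0; last first.
  have [w [hw kw w1 wu]] := mono_dual; exists #|mindex height its|, mono_odd, mono.
  split; first exact: mono_basis.
  apply: (Q_iso v0 hv kv sv _ hw kw w1 wu) => i.
  by apply: parM => //; apply/j_par/mono_par.
(* With 1 = 0 in A, the conditions on u and w hold for zero families of any size, so any homogeneous
   basis of [B] will do. *)
have [dl [pi [e he]]] := homog_basis_of_span mono_par mono_spanning.
exists dl, pi, e; split=> //.
have z (a : A) : a = 0 by rewrite -[a]mul1r A0 mul0r.
apply: (Q_iso v0 hv kv sv (u := fun=> 0) (w := fun=> 0)) => [i|i|i y _||i k].
- exact: par0.
- exact: par0.
- exact: z.
- by rewrite [LHS]z [RHS]z.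
- by rewrite [LHS]z [RHS]z.
Qed.
End Whittaker.

(** * The superalgebra q(n) *)

Lemma sign_mulCA (R : pzRingType) k (x y : R) : x * ((-1) ^+ k * y) = (-1) ^+ k * (x * y).
Proof. by rewrite !mulrA (commr_sign x). Qed.

Lemma sign_bracket (R : pzRingType) (i j : bool) (x y z : R) :
  x * y - (-1) ^+ (i && j) * (y * x) = z ->
  ((-1) ^+ i * x) * ((-1) ^+ j * y) - (-1) ^+ (i && j) * (((-1) ^+ j * y) * ((-1) ^+ i * x)) =
  (-1) ^+ (i (+) j) * z.
Proof.
by move=> <-; case: i j => [] [];
  rewrite /= ?expr0 ?expr1 ?mul1r ?mulN1r ?mulNr ?mulrN ?opprK ?opprB ?opprD // addrC.
Qed.

Section MorphismParity.
Variables (K : fieldType) (A B : salgType K) (f : {rmorphism A -> B}) (b b' : bool) (x y : A).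
Lemma rmorph_parD : par b (f x) -> par b (f y) -> par b (f (x + y)).
Proof. by rewrite rmorphD; exact: parD. Qed.
Lemma rmorph_parM : par b (f x) -> par b' (f y) -> par (b (+) b') (f (x * y)).
Proof. by rewrite rmorphM; exact: parM. Qed.
End MorphismParity.

Lemma shifted_morph (K : fieldType) (n : nat) (J : 'M[K]_n) (R S : pzAlgType K)
  (f : {rmorphism R -> S}) (r : bool -> 'M[K]_n -> R) (r' : bool -> 'M[K]_n -> S) b x :
  (forall c, f (algC c) = algC c) -> f (r b x) = r' b x ->
  f (shifted J r b x) = shifted J r' b x.
Proof. by move=> fC fr; rewrite /shifted rmorphB fC fr. Qed.

Lemma mtop_morph (K : fieldType) (R S : pzAlgType K) (T : eqType) (f : {rmorphism R -> S})
  (xi : T -> R) (xi' : T -> S) (height : T -> nat) (s : seq T) :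
  (forall z, z \in s -> f (xi z) = xi' z) -> f (mtop xi height s) = mtop xi' height s.
Proof.
elim: s => [|z s IH] h /=; first by rewrite rmorph1.
rewrite rmorphM rmorphXn h ?mem_head // IH // => y ys.
by apply: h; rewrite inE ys orbT.
Qed.

Section UchiParity.
Variables (K : fieldType) (p : nat) (charK : p \in [pchar K]) (p_gt2 : (2 < p)%N).
Variables (N : nat) (chi : 'M[K]_N -> K) (a : bool -> {vspace 'M[K]_N}).
Local Notation Ua := (Uchi p chi a).

Lemma Uchi_split (x : Ua) : exists x0 x1, [/\ par false x0, par true x1 & x = x0 + x1].
Proof.
elim/Uchi_ind: x => [c|b x|x y [x0 [x1 [h0 h1 ->]]] [y0 [y1 [g0 g1 ->]]]|].
- by exists (algC c), 0; rewrite addr0; split=> //; [exact: parC|exact: par0].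
- case: b x => x; last by exists (Uchi_gen p chi x), 0; rewrite addr0; split=> //;
    [exact: Uchi_par_gen|exact: par0].
  by exists 0, (Uchi_gen p chi x); rewrite add0r; split=> //; [exact: par0|exact: Uchi_par_gen].
- by exists (x0 + y0), (x1 + y1); rewrite addrACA; split=> //; exact: parD.
move=> x y [x0 [x1 [h0 h1 ->]]] [y0 [y1 [g0 g1 ->]]].
exists (x0 * y0 + x1 * y1), (x0 * y1 + x1 * y0); split.
- by apply: parD; [exact: (parM _ _ _ _ h0 g0)|exact: (parM _ _ _ _ h1 g1)].
- by apply: parD; [exact: (parM _ _ _ _ h0 g1)|exact: (parM _ _ _ _ h1 g0)].
- by rewrite !mulrDl !mulrDr -!addrA; congr (_ + _); rewrite [RHS]addrCA; congr (_ + _); rewrite addrC.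
Qed.

(** The sign on odd generators respects the bracket relations, and the p-th power relations involve
    even elements only. *)
Lemma Uchi_involution : exists sigma : {rmorphism Ua -> Ua},
  forall b x, par b x -> sigma x = (-1) ^+ b * x.
Proof.
have [|||sigma [sg sC]] := @Uchi_lift K N p chi a Ua (fun b x => (-1) ^+ b * Uchi_gen p chi x).
- by move=> b c x y; rewrite Uchi_gen_lin mulrDr algC_mulCA.
- by move=> i j x y z h; apply/sign_bracket/Uchi_gen_br.
- by move=> x z h; rewrite expr0 !mul1r; exact: Uchi_gen_pow.
exists sigma => b x; elim=> {b x} [b|c|b x|b x y _ IHx _ IHy|b b' x y _ IHx _ IHy].
- by rewrite rmorph0 mulr0.
- by rewrite sC mul1r.
- exact: sg.
- by rewrite rmorphD IHx IHy mulrDr.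
- by rewrite rmorphM IHx IHy -mulrA sign_mulCA mulrA signr_addb.
Qed.

(** The involution gives x = -x, and 2 is invertible; this replaces a basis adapted to the
    parity. *)
Lemma Uchi_disjoint (x : Ua) : par false x -> par true x -> x = 0.
Proof.
have [sigma hs] := Uchi_involution => h0 h1.
have e : x + x = 0.
  by have := hs _ _ h0; rewrite (hs _ _ h1) mul1r expr1 mulN1r => e; rewrite -{1}e addNr.
rewrite -[x]mul1r -(rmorph1 algC) -(@mulVf _ (2%:R : K)); last first.
  by rewrite -(dvdn_pcharf charK) gtnNdvd.
by rewrite rmorphM -mulrA [X in _ * X](_ : _ = x + x) ?e ?mulr0 // rmorph_nat mulr_natl.
Qed.

Lemma Uchi_incl_par (a' : bool -> {vspace 'M[K]_N}) (saa' : forall b, (a b <= a' b)%VS) b x :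
  par b x -> par b (Uchi_incl (p := p) (chi := chi) saa' x).
Proof.
elim=> {b x} [b|c|b x|b x y _ IHx _ IHy|b b' x y _ IHx _ IHy].
- by rewrite rmorph0; exact: par0.
- by rewrite Uchi_inclC; exact: parC.
- by rewrite Uchi_incl_gen; exact: Uchi_par_gen.
- exact: (rmorph_parD (f := Uchi_incl (p := p) (chi := chi) saa') IHx IHy).
- exact: (rmorph_parM (f := Uchi_incl (p := p) (chi := chi) saa') IHx IHy).
Qed.
End UchiParity.

(** * Application to q(n) *)

Section Main.
Variables (K : fieldType) (p : nat) (charK : p \in [pchar K]) (p_gt2 : (2 < p)%N).
Variables (n : nat) (X P : 'M[K]_n) (d : seq nat).
Hypotheses (uP : P \in unitmx) (dn : sumn d = n) (XJ : X = P *m jordan K n d *m invmx P).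
Local Notation J := (jordan K n d).
Local Notation wt := (fun i : 'I_n => weight d i).

Section Rho.
Variable a : bool -> {vspace 'M[K]_(n + n)}.
(** [vsproj] makes this total; it stands for the generator of x only when [qconj P b x] lies in
    [a b], hence the membership hypotheses below. *)
Definition rho b (x : 'M[K]_n) : Uchi p (chi X) a :=
  Uchi_gen p (chi X) (vsproj (a b) (qconj P b x)).

Lemma rho_lin b c x y : rho b (c *: x + y) = algC c * rho b x + rho b y.
Proof. by rewrite /rho linearP linearP Uchi_gen_lin. Qed.

Lemma rho_br b b' x y : qconj P b x \in a b -> qconj P b' y \in a b' ->
  qconj P (b (+) b') (sbracket b b' x y) \in a (b (+) b') ->
  rho b x * rho b' y - (-1) ^+ (b && b') * (rho b' y * rho b x) =
  rho (b (+) b') (sbracket b b' x y).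
Proof. by move=> hx hy hz; apply: Uchi_gen_br; rewrite !vsprojK // qconj_br. Qed.

Lemma rho_pow x : qconj P false x \in a false -> qconj P false (x ^+ p) \in a false ->
  rho false x ^+ p = rho false (x ^+ p) + algC (chib J false x ^+ p).
Proof.
move=> hx hz; have e : chi X (vsval (vsproj (a false) (qconj P false x))) = chib J false x.
  by rewrite vsprojK // (chi_qconj uP _ _ XJ).
rewrite -e; apply: Uchi_gen_pow.
by rewrite !vsprojK //; case: (p) p_gt2 => // q _; rewrite qconjX.
Qed.

Lemma rho_par b x : par b (rho b x). Proof. exact: Uchi_par_gen. Qed.
End Rho.

Variables (L : bool -> {vspace 'M[K]_(n + n)}) (hL : max_isotropic X P d L).
Local Notation A := (Uchi p (chi X) (qn K n)).
Local Notation B := (Uchi p (chi X) (m_alg P d L)).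
Local Notation inc := (Uchi_incl (p := p) (chi := chi X) (m_alg_sub hL)).
Variables (Kchi : supermod B) (simpleK : simple_supermod Kchi).

Lemma whittaker_q : projective_supermod (Q_m hL Kchi) /\
  exists (delta : nat) (par_ix : 'I_delta -> bool) (e : 'I_delta -> B),
    homog_basis par_ix e /\ salg_iso A (smx (sEndop (Q_m hL Kchi)) par_ix).
Proof.
have [|b|its [ad itsm mits]] := @adapted_exists K n P X d uP dn XJ L.
- by move=> b; case: (hL b).
- by case: (hL b).
have hJ := jordan_deg (K := K) dn.
pose rA := rho (qn K n); pose rB := rho (m_alg P d L).
have m_span b x : x \in <<[seq ix z | z <- its & ib z == b]>>%VS -> qconj P b x \in m_alg P d L b.
  move=> hx; have : linfun (qconj P b) x \in
      (linfun (qconj P b) @: <<[seq ix z | z <- its & ib z == b]>>)%VS by exact: memv_img.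
  rewrite limg_span lfunE; apply/subvP/span_subvP => _ /mapP[y /mapP[z + ->] ->].
  by rewrite mem_filter lfunE => /andP[/eqP <- /itsm].
(* Brackets and p-th powers of basis vectors of m have degree at most -2, where m is everything, so
   m is closed under both. *)
have m_deg b (k : nat) x : (1 < k)%N -> has_deg wt (- k%:Z) x -> qconj P b x \in m_alg P d L b.
  move=> k1 hx; apply: m_span; apply: (subvP _ _ (ad_span ad b k1 hx)).
  apply: sub_span => _ /mapP[z + ->]; rewrite mem_filter => /andP[/andP[zb _] zi].
  by apply: map_f; rewrite mem_filter zb.
have rA_lin := @rho_lin (qn K n); have rB_lin := @rho_lin (m_alg P d L).
have rA_br b b' x y : rA b x * rA b' y - (-1) ^+ (b && b') * (rA b' y * rA b x) =
    rA (b (+) b') (sbracket b b' x y) by apply: rho_br; exact: mem_qn.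
have rB_br z z' : z \in its -> z' \in its ->
    rB (ib z) (ix z) * rB (ib z') (ix z')
      - (-1) ^+ (ib z && ib z') * (rB (ib z') (ix z') * rB (ib z) (ix z))
    = rB (ib z (+) ib z') (sbracket (ib z) (ib z') (ix z) (ix z')).
  move=> zi zi'; apply: rho_br; [exact: itsm|exact: itsm|].
  apply: (@m_deg _ (ik z + ik z')%N).
    by rewrite -addn1 leq_add // (ad_pos ad).
  by rewrite PoszD opprD; apply: has_deg_br; exact: (ad_x ad).
have rB_pow z : z \in its -> ib z = false ->
    rB false (ix z) ^+ p = rB false (ix z ^+ p) + algC (chib J false (ix z) ^+ p).
  move=> zi zb; apply: rho_pow; first by rewrite -zb; exact: itsm.
  apply: (@m_deg _ (p * ik z)%N); first by rewrite (leq_trans (ltnW p_gt2)) // leq_pmulr ?(ad_pos ad).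
  have -> : - (p * ik z)%:Z = (- (ik z)%:Z) *+ p by rewrite mulNrn -mulr_natl PoszM natz.
  by apply: has_degX; [exact: (ad_x ad)|exact: ltnW (ltnW p_gt2)].
have incr b x : qconj P b x \in m_alg P d L b -> inc (rB b x) = rA b x.
  by move=> h; rewrite Uchi_incl_gen /incl_gen vsprojK.
have incxi z : z \in its -> inc (xi J rB z) = xi J rA z.
  by move=> zi; apply: (@shifted_morph K n J B A inc); [exact: Uchi_inclC|exact/incr/itsm].
have [sigma hsigma] := @Uchi_involution K p (n + n) (chi X) (qn K n).
have xpar z : par (ib z) (xi J rB z).
  rewrite /xi /shifted; apply: parD; first exact: rho_par.
  apply: parN1; case: (ib z); first by rewrite rmorph0; exact: par0.
  exact: parC.
have [bt t_par] : exists bt, par bt (kaz_dual p its rA).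
  have [b hb] : exists b, par b (kaz_tail p its rA).
    rewrite /kaz_tail; elim/big_ind: _ => [|x y [b hb] [b' hb']|z _].
    - by exists false; rewrite -(rmorph1 algC); exact: parC.
    - by exists (b (+) b'); exact: parM.
    - by exists (ib z && odd (height p z).-1); apply/parX/rho_par.
  by exists (false (+) b); apply: parM => //; exact: parC.
have incs (l : seq (item K n)) : {subset l <= its} ->
    inc (mtop (xi J rB) (height p) l) = mtop (xi J rA) (height p) l.
  by move=> sl; apply: (@mtop_morph K B A _ inc) => z /sl; exact: incxi.
(* The generators of B are combinations of the xi up to the scalars chi(x), so scalars and xi
   generate B. *)
have Bgen (Q : B -> Prop) : (forall c, Q (algC c)) -> (forall z, z \in its -> Q (xi J rB z)) ->
    (forall x y, Q x -> Q y -> Q (x + y)) -> (forall x y, Q x -> Q y -> Q (x * y)) ->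
    forall x, Q x.
  move=> QC Qx QD QM; apply: Uchi_ind => // b x.
  have [A' hA' xE] := mits b _ (subvsP x).
  have -> : Uchi_gen p (chi X) x = rB b A' by rewrite /rB /rho -xE vsvalK.
  rewrite (rho_shifted J); apply: (QD) => //.
  apply: (shifted_span rB_lin (P := Q) _ _ hA') => [|c y r /mapP[z + ->] hr].
    by have := QC 0; rewrite rmorph0.
  by rewrite mem_filter => /andP[/eqP <- zi]; apply: (QD) => //; apply: (QM) => //; exact: Qx.
rewrite /Q_m.
apply: (@whittaker_equivalence K A B inc _ (xi J rB) (@ib K n) (height p) its _ _ Bgen _ xpar
  _ _ sigma hsigma _ _ (kaz_dual p its rA) bt t_par _ Kchi simpleK).
- exact: (xi_comm ad rB_lin rB_br).
- exact: (xi_height ad rB_lin rB_br charK p_gt2 hJ rB_pow).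
- by move=> z; rewrite /height; case: ib => //; exact: ltnW (ltnW p_gt2).
- by move=> c; exact: Uchi_inclC.
- by move=> b x; exact: Uchi_incl_par.
- exact: Uchi_split.
- exact: (Uchi_disjoint charK p_gt2).
move=> V w hw; have := kaz_key charK hJ ad rA_lin rA_br (w := w).
rewrite -(incs its) //; apply => z zi.
by rewrite -incxi //; exact: hw.
Qed.
End Main.

Theorem theorem4p5 (K : closedFieldType) (p : nat) (charK : p \in [pchar K]) (p_gt2 : (2 < p)%N)
  (n : nat) (X : 'M[K]_n) (nilX : exists k, X ^+ k = 0)
  (P : 'M[K]_n) (d : seq nat) (jX : jordan_form X P d)
  (L : bool -> {vspace 'M[K]_(n + n)}) (hL : max_isotropic X P d L)
  (Kchi : supermod (Uchi p (chi X) (m_alg P d L))) (simpleK : simple_supermod Kchi) :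
  projective_supermod (Q_m hL Kchi) /\
  exists (delta : nat) (par_ix : 'I_delta -> bool)
         (e : 'I_delta -> Uchi p (chi X) (m_alg P d L)),
    homog_basis par_ix e /\
    salg_iso (Uchi p (chi X) (qn K n)) (smx (sEndop (Q_m hL Kchi)) par_ix).
Proof.
by case: jX => uP _ _ dn XJ; exact: (whittaker_q charK p_gt2 uP dn XJ hL simpleK).
Qed.
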